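(* Suppose a constant-depth QAOA circuit $U_{\mathrm{QAOA}}$ prepares a state $|\psi\rangle = U_{\mathrm{QAOA}}|0\rangle^{\otimes N}$ with $N\ge 3$, such that $|\langle x^*|\psi\rangle| \ge \sqrt{p_{\mathrm{opt}}}$, where $|x^*\rangle$ encodes an optimal solution to the $N$-bit LABS problem in a computational basis state, and assume that $p_{\mathrm{opt}}\ge 1/N$. Then the algorithm QAOA+QMF (described in the context), run with parameter $M\ge 1/\sqrt{p_{\mathrm{opt}}}$ and failure probability $\delta$, runs with a gate complexity of $O\big(\mathrm{poly}(N)\log(1/\delta)\,M\big)$ and finds $x^*$ with probability at least $1-\delta$.
   Context: **LABS problem.** For $\boldsymbol{s}=(s_1,\dots,s_N)\in\{\pm1\}^N$ let $\mathcal{A}_k(\boldsymbol{s})=\sum_{i=1}^{N-k}s_is_{i+k}$ and $\mathcal{E}_{\mathrm{sidelobe}}(\boldsymbol{s})=\sum_{k=1}^{N-1}\mathcal{A}_k(\boldsymbol{s})^2$. The $N$-bit LABS (Low Autocorrelation Binary Sequences) problem is to find a sequence minimizing $\mathcal{E}_{\mathrm{sidelobe}}$. Bitstrings $x\in\{0,1\}^N$ are identified with spin sequences by $s_i=(-1)^{x_i}$. **QAOA circuit.** Let $Z_j,X_j$ be the Pauli operators on qubit $j$ and let $$H_C = 2\sum_{i=1}^{N-3}Z_i \sum_{t=1}^{\lfloor (N-i-1)/2\rfloor}\sum_{k=t+1}^{N-i-t}Z_{i+t}Z_{i+k}Z_{i+k+t}+\sum_{i=1}^{N-2}Z_i\sum_{k=1}^{\lfloor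 (N-i)/2\rfloor}Z_{i+2k}$$ be the diagonal Hamiltonian encoding the LABS problem. A QAOA circuit with $\ell$ layers and real parameters $\beta_1,\dots,\beta_\ell,\gamma_1,\dots,\gamma_\ell$ is a unitary $U_{\mathrm{QAOA}}$ on $N$ qubits that prepares, from $|0\rangle^{\otimes N}$, the uniform superposition $|+\rangle^{\otimes N}$ and then, for $l=1,\dots,\ell$ in turn, applies $e^{-i\gamma_l H_C}$ followed by $e^{-i\beta_l\sum_{j=1}^N X_j}$. ''Constant-depth'' means that $\ell$ is a constant independent of $N$. **Cost oracle.** $V_{\mathrm{LABS}}$ is a unitary computing $\mathcal{E}_{\mathrm{sidelobe}}(x)$ into a register. **Subroutine EQSearch (exponential quantum search).** Let $|\psi\rangle=U|0\rangle^{\otimes N}$ be a state in a $2^N$-dimensional Hilbert space with computational basis indexed by $N$-bit strings, and let $m:\{0,1\}^N\to\{0,1\}$ be a marking function with $\sum_{x:\,m(x)=1}|\langle\psi|x\rangle|^2\ge p$. The known quantum algorithm $\mathbf{EQSearch}(U,m,\delta')$ outputs an element $x$ with $m(x)=1$ with probability at least $1-\delta'$, using $O\big(\frac{1}{\sqrt p}\log\frac{1}{\delta'}\big)$ applications of $U$ and $m$. Let $C$ denote the constant corresponding to this $O(\cdot)$. **Algorithm QAOA+QMF (QAOA enhanced with quantum minimum-finding).** Inputs: the unitary $U_{\mathrm{QAOA}}$ as in the claim (with $p_{\mathrm{opt}}$ unknown), $V_{\mathrm{LABS}}$, $\delta\in(0,1)$, and a positive number $M\le 2^N$. Initialize an empty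 list. For $i=1,\dots,\lceil\log(1/\delta)\rceil$ do the following round: - Set $t=0$ and $s_0=\infty$. - While the number of calls to $U_{\mathrm{QAOA}}$ and $V_{\mathrm{LABS}}$ is less than $3CMN$: increase $t$ by $1$; define $m_t:\{0,1\}^N\to\{0,1\}$ by $m_t(x)=1$ if and only if $\mathcal{E}_{\mathrm{sidelobe}}(x)$ is strictly less than the sidelobe energy of $s_{t-1}$ (taken to be $\infty$ when $t=1$), noting that $m_t$ can be coherently evaluated using one query to $V_{\mathrm{LABS}}$; set $s_t=\mathbf{EQSearch}(U_{\mathrm{QAOA}},m_t,1/(6\cdot 2^N))$. - Append $s_t$ to the list. After all rounds, output the minimum of the list (with respect to $\mathcal{E}_{\mathrm{sidelobe}}$). *)

(* Defs.v *)
From mathcomp Require Export all_boot all_order all_algebra.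
From mathcomp Require Export complex.
From mathcomp Require Export all_classical all_reals all_analysis.

Set Implicit Arguments.
Unset Strict Implicit.
Unset Printing Implicit Defensive.

Import Order.TTheory GRing.Theory Num.Theory.
Import numFieldNormedType.Exports.
Local Open Scope ring_scope.
Local Open Scope complex_scope.

Notation bits n := (n.-tuple bool).
Notation qop R n := 'M[R[i]]_#|{: n.-tuple bool}|.
Notation qstate R n := 'cV[R[i]]_#|{: n.-tuple bool}|.

(* [spin x i] is s_i = (-1)^{x_i}; positions are numbered from 1. *)
Definition spin n (x : bits n) (i : nat) : int := (-1) ^+ nth false x i.-1.

Definition autocorr n (x : bits n) (k : nat) : int :=
  \sum_(1 <= i < (n - k).+1) spin x i * spin x (i + k).

Definition sidelobe n (x : bits n) : int :=
  \sum_(1 <= k < n) autocorr x k ^+ 2.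

Definition labs_optimal n (x : bits n) : Prop :=
  forall y : bits n, sidelobe x <= sidelobe y.

Definition op_of (R : realType) n (f : bits n -> bits n -> R[i]) : qop R n :=
  \matrix_(i, j) f (enum_val i) (enum_val j).

Definition diag_op (R : realType) n (f : bits n -> R[i]) : qop R n :=
  op_of (fun y x => if y == x then f x else 0).

(* |x> |-> |f x> *)
Definition map_op (R : realType) n (f : bits n -> bits n) : qop R n :=
  op_of (fun y x => (y == f x)%:R).

Definition ket (R : realType) n (x : bits n) : qstate R n :=
  delta_mx (enum_rank x) 0.

(* <x|v> *)
Definition amp (R : realType) n (v : qstate R n) (x : bits n) : R[i] :=
  v (enum_rank x) 0.

Definition born (R : realType) n (v : qstate R n) (x : bits n) : R :=
  complex.Re (`|amp v x| ^+ 2).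

Definition zeros n : bits n := nseq_tuple n false.

Definition adj (R : realType) n (A : qop R n) : qop R n := (map_mx conjc A)^T.

Definition unitary_op (R : realType) n (A : qop R n) : Prop :=
  adj A *m A = 1%:M.

(* Exponential series of a matrix, the limit being taken entrywise. *)
Definition expmx_partial (R : realType) n (A : qop R n) (K : nat) : qop R n :=
  \sum_(k < K) (k`!%:R)^-1 *: A ^+ k.

Definition expmx (R : realType) n (A : qop R n) : qop R n :=
  \matrix_(i, j)
    (limn (fun K => complex.Re (expmx_partial A K i j))
     +i* limn (fun K => complex.Im (expmx_partial A K i j))).

Definition flip n (k : nat) (x : bits n) : bits n :=
  [tuple tnth x i (+) (val i == k) | i < n].

(* Pauli operators; qubits are numbered from 1, as are the spins. *)
Definition pauliZ (R : realType) n (j : nat) : qop R n :=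
  diag_op (fun x => (-1) ^+ nth false x j.-1).

Definition pauliX (R : realType) n (j : nat) : qop R n :=
  map_op R (flip j.-1).

Inductive gate (R : realType) (n : nat) : Type :=
| Had of 'I_n
| Phase of R & 'I_n
| CNot of 'I_n & 'I_n
| Toffoli of 'I_n & 'I_n & 'I_n.

Definition gate_wf (R : realType) n (g : gate R n) : bool :=
  match g with
  | Had _ | Phase _ _ => true
  | CNot c t => c != t
  | Toffoli c d t => [&& c != d, c != t & d != t]
  end.

Definition gate_op (R : realType) n (g : gate R n) : qop R n :=
  match g with
  | Had j => op_of (fun y x =>
      if [forall k, (k != j) ==> (tnth y k == tnth x k)]
      then ((Num.sqrt 2)^-1)%:C * (-1) ^+ (tnth y j && tnth x j) else 0)
  | Phase theta j => diag_op (fun x =>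
      if tnth x j then cos theta +i* sin theta else 1)
  | CNot c t => map_op R (fun x => if tnth x c then flip t x else x)
  | Toffoli c d t =>
      map_op R (fun x => if tnth x c && tnth x d then flip t x else x)
  end.

(* The head of the list is applied first. *)
Definition circuit_op (R : realType) n (c : seq (gate R n)) : qop R n :=
  foldl (fun A g => gate_op g *m A) 1%:M c.

(* [A] is implemented exactly by at most [g] gates, with the help of [a]
   ancilla qubits which start and end in the state 0. *)
Definition gate_complexity_le (R : realType) n (A : qop R n) (g : nat) : Prop :=
  exists a, exists c : seq (gate R (n + a)),
    [/\ all (@gate_wf R (n + a)) c, (size c <= g)%N &
        forall x : bits n,
          circuit_op c *m ket R (cat_tuple x (zeros a)) =
          \sum_(y : bits n)
            amp (A *m ket R x) y *: ket R (cat_tuple y (zeros a))].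

Definition labs_hamiltonian (R : realType) (N : nat) : qop R N :=
  let Z := pauliZ R N in
  2%:R *: (\sum_(1 <= i < (N - 3).+1)
             Z i * \sum_(1 <= t < ((N - i - 1) %/ 2).+1)
                     \sum_(t.+1 <= k < (N - i - t).+1)
                       Z (i + t)%N * Z (i + k)%N * Z (i + k + t)%N)
  + \sum_(1 <= i < (N - 2).+1)
      Z i * \sum_(1 <= k < ((N - i) %/ 2).+1) Z (i + 2 * k)%N.

Definition mixer (R : realType) (N : nat) : qop R N :=
  \sum_(1 <= j < N.+1) pauliX R N j.

Definition qaoa_layer (R : realType) (N : nat) (beta gamma : R) : qop R N :=
  expmx ((0 -i* beta) *: mixer R N)
  *m expmx ((0 -i* gamma) *: labs_hamiltonian R N).

(* Hadamards on all qubits prepare the uniform superposition. *)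
Definition qaoa (R : realType) (N l : nat) (beta gamma : 'I_l -> R) : qop R N :=
  foldl (fun A i => qaoa_layer N (beta i) (gamma i) *m A)
        (\prod_(j < N) gate_op (Had R j)) (enum 'I_l).

(* sidelobe x < N ^ 3, so this many qubits hold the energy in binary. *)
Definition reg_size (N : nat) : nat := up_log 2 (N ^ 3).

Definition binary b (e : nat) : bits b := [tuple odd (e %/ 2 ^ i) | i < b].

Definition reg_value b (r : bits b) : nat := \sum_(i < b) tnth r i * 2 ^ i.

(* |x>|r> |-> |x>|r xor E(x)> *)
Definition V_labs (R : realType) (N : nat) : qop R (N + reg_size N) :=
  map_op R (fun z : bits (N + reg_size N) =>
    let x : bits N := [tuple tnth z (lshift _ i) | i < N] in
    let e := binary (reg_size N) `|sidelobe x|%N in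
    cat_tuple x [tuple tnth z (rshift N i) (+) tnth e i | i < reg_size N]).

(* A threshold: [None] is the initial threshold s_0 of infinite energy. *)
Definition marks n (s : option (bits n)) (x : bits n) : bool :=
  if s is Some y then sidelobe x < sidelobe y else true.

(* Sign flip on the energy register for the values below the threshold. *)
Definition compare_op (R : realType) n (s : option (bits n)) :
    qop R (reg_size n) :=
  diag_op (fun r =>
    if (if s is Some y then (reg_value r < `|sidelobe y|)%N else true)
    then -1 else 1).

Definition phase_oracle (R : realType) n (m : pred (bits n)) : qop R n :=
  diag_op (fun x => if m x then -1 else 1).

Definition reflect_zero (R : realType) n : qop R n :=
  diag_op (fun x => if x == zeros n then -1 else 1).

(* A list of weighted outcomes; an outcome may occur several times. *)
Definition dist (R : realType) (T : Type) : Type := seq (R * T).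

Definition dret (R : realType) T (a : T) : dist R T := [:: (1, a)].

Definition dbind (R : realType) T S (d : dist R T) (f : T -> dist R S) :
    dist R S :=
  flatten [seq [seq (w.1 * v.1, v.2) | v <- f w.2] | w <- d].

Definition duniform (R : realType) T (s : seq T) : dist R T :=
  [seq ((size s)%:R^-1, a) | a <- s].

Definition measure (R : realType) n (v : qstate R n) : dist R (bits n) :=
  [seq (born v x, x) | x <- enum {: bits n}].

Definition Pr (R : realType) T (d : dist R T) (E : pred T) : R :=
  \sum_(w <- d | E w.2) w.1.

Definition in_every_run (R : realType) T (d : dist R T) (E : pred T) : bool :=
  all (fun w => (0 < w.1) ==> E w.2) d.

(* Operations of a run: the unitary U, its inverse, the marking function used
   as a phase oracle, the reflection about the all-zero state, and the
   evaluation of the marking function on a measured string. *)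
Inductive op := OpU | OpUinv | OpMark | OpZero | OpTest.

Definition is_call (o : op) : bool := if o is OpZero then false else true.

Definition calls (t : seq op) : nat := count is_call t.

Definition op_mx (R : realType) n (U : qop R n) (m : pred (bits n)) (o : op) :
    qop R n :=
  match o with
  | OpU => U
  | OpUinv => adj U
  | OpMark => phase_oracle R m
  | OpZero => reflect_zero R n
  | OpTest => 1%:M
  end.

(* [j] amplitude-amplification iterations on the state prepared by U. *)
Definition amplify (j : nat) : seq op :=
  OpU :: flatten (nseq j [:: OpMark; OpUinv; OpZero; OpU]).

Definition run_ops (R : realType) n (U : qop R n) (m : pred (bits n))
    (t : seq op) : qstate R n :=
  foldl (fun v o => op_mx U m o *m v) (ket R (zeros n)) t.

(* The longest prefix of [t] that makes at most [r] calls. *)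
Fixpoint cut (r : nat) (t : seq op) : seq op :=
  match t with
  | [::] => [::]
  | o :: t' =>
      if is_call o then (if r is r'.+1 then o :: cut r' t' else [::])
      else o :: cut r t'
  end.

(* [sched n d k] lists the iteration numbers from which the k-th attempt of a
   search with failure parameter [d] on [n] qubits draws uniformly: the
   search has to work for an unknown mass p of the marked strings. *)
Definition schedule (R : realType) := nat -> R -> nat -> seq nat.

(* A search that may make at most [r] further calls.  Each attempt amplifies,
   measures and tests the outcome; the search returns the first marked outcome
   and is interrupted, returning [None], when the calls run out.  An attempt
   makes at least two calls, so [fuel := r] is never exhausted early. *)
Fixpoint eqsearch_from (R : realType) (sched : schedule R) n (U : qop R n)
    (m : pred (bits n)) (d : R) (fuel k r : nat) :
    dist R (option (bits n) * seq op) :=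
  if fuel is fuel'.+1 then
    dbind (duniform R (sched n d k)) (fun j =>
      let attempt := rcons (amplify j) OpTest in
      if (r < calls attempt)%N then dret R (None, cut r attempt)
      else
        dbind (measure (run_ops U m (amplify j))) (fun x =>
          if m x then dret R (Some x, attempt)
          else
            dbind (eqsearch_from sched U m d fuel' k.+1 (r - calls attempt))
              (fun res => dret R (res.1, attempt ++ res.2))))
  else dret R (None, [::]).

Definition eqsearch (R : realType) (sched : schedule R) n (U : qop R n)
    (m : pred (bits n)) (d : R) (r : nat) :
    dist R (option (bits n) * seq op) :=
  eqsearch_from sched U m d r 0 r.

(* If the marked strings have mass at least p, then with probability at least
   1 - d a marked string is returned within (C / sqrt p) * log (1 / d) calls.
   The O(.) is a statement for small d, since log (1 / d) vanishes as d tends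
   to 1: no search finds a marked string without making a call. *)
Definition eqsearch_guarantee (R : realType) (sched : schedule R) (C : R) :
    Prop :=
  (forall n d k, sched n d k != [::]) /\
  forall (n : nat) (U : qop R n) (m : pred (bits n)) (p d : R),
    unitary_op U -> 0 < p ->
    p <= \sum_(x : bits n | m x) born (U *m ket R (zeros n)) x ->
    0 < d <= 1 / 2 ->
    1 - d <=
    Pr (eqsearch sched U m d (Num.truncn (C / Num.sqrt p * ln (1 / d))))
       (fun o => if o.1 is Some x then m x else false).

(* One round with threshold [s] and [r] calls left.  An interrupted search
   leaves the threshold unchanged.  A search makes at least two calls, so
   [fuel := r] is never exhausted early. *)
Fixpoint qmf_round (R : realType) (sched : schedule R) n (U : qop R n)
    (fuel : nat) (s : option (bits n)) (r : nat) :
    dist R (option (bits n) * seq op) :=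
  if fuel is fuel'.+1 then
    if r == 0%N then dret R (s, [::])
    else
      dbind (eqsearch sched U (marks s) (1 / (6 * 2 ^+ n)) r) (fun found =>
        if found.1 is Some x then
          dbind (qmf_round sched U fuel' (Some x) (r - calls found.2))
            (fun res => dret R (res.1, found.2 ++ res.2))
        else dret R (s, found.2))
  else dret R (s, [::]).

Definition nat_ceil (R : realType) (x : R) : nat := `|Num.ceil x|%N.

(* The number of calls is an integer, so making calls while their number is
   less than 3CMn is making at most [nat_ceil (3 * C * M * n%:R)] of them. *)
Fixpoint qmf_rounds (R : realType) (sched : schedule R) (C : R) n
    (U : qop R n) (M : R) (k : nat) :
    dist R (seq (option (bits n)) * seq op) :=
  if k is k'.+1 then
    let r := nat_ceil (3 * C * M * n%:R) in
    dbind (qmf_rounds sched C U M k') (fun prev =>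
      dbind (qmf_round sched U r None r) (fun res =>
        dret R (rcons prev.1 res.1, prev.2 ++ res.2)))
  else dret R ([::], [::]).

Definition list_min n (l : seq (option (bits n))) : option (bits n) :=
  foldr (fun a best => if a is Some x then
                         if marks best x then a else best
                       else best) None l.

(* The output together with the trace of all operations performed. *)
Definition qaoa_qmf (R : realType) (sched : schedule R) (C : R) n
    (U : qop R n) (M delta : R) : dist R (option (bits n) * seq op) :=
  dbind (qmf_rounds sched C U M (nat_ceil (ln (1 / delta))))
    (fun res => dret R (list_min res.1, res.2)).

Record gate_counts := GateCounts {
  gates_U : nat;
  gates_V : nat;
  gates_compare : nat;
  gates_zero : nat }.

(* The counts are realized by circuits for U, V_labs, the comparators and the
   reflection about the all-zero state. *)
Definition realizable (R : realType) n (U : qop R n) (gc : gate_counts) :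
    Prop :=
  [/\ gate_complexity_le U (gates_U gc),
      gate_complexity_le (V_labs R n) (gates_V gc),
      forall s : option (bits n),
        gate_complexity_le (compare_op R s) (gates_compare gc) &
      gate_complexity_le (reflect_zero R n) (gates_zero gc)].

(* An inverse takes as many gates as the operator.  The phase oracle of
   [marks s] computes the energy into a clean register, flips the sign below
   the threshold and uncomputes the energy. *)
Definition op_gates (gc : gate_counts) (o : op) : nat :=
  match o with
  | OpU | OpUinv => gates_U gc
  | OpMark => 2 * gates_V gc + gates_compare gc
  | OpZero => gates_zero gc
  | OpTest => gates_V gc
  end.

Definition gates (gc : gate_counts) (t : seq op) : nat :=
  \sum_(o <- t) op_gates gc o.

Definition qaoa_qmf_input (R : realType) (l N : nat) (beta gamma : 'I_l -> R)
    (xopt : bits N) (popt M delta : R) : Prop :=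
  [/\ (3 <= N)%N, labs_optimal xopt,
      (Num.sqrt popt)%:C <= `|amp (qaoa N beta gamma *m ket R (zeros N)) xopt|,
      1 / N%:R <= popt &
      [/\ 0 < M, M <= 2 ^+ N, 1 / Num.sqrt popt <= M & 0 < delta < 1]].

(* Main.v *)
Require Import Defs.
From mathcomp Require Import ring lra zify.

Set Implicit Arguments.
Unset Strict Implicit.
Unset Printing Implicit Defensive.

Import Order.TTheory GRing.Theory Num.Theory.
Import numFieldNormedType.Exports.
Local Open Scope ring_scope.
Local Open Scope complex_scope.

(** The guarantee of the search bounds its calls with high probability, not in expectation, and for
    a search cut off at a bound that depends on the unknown mass. Hence no expected running time is
    formed. Instead a round is handled by an induction that charges each search its guaranteed calls
    plus its failure probability; the induction hypothesis is Markov's inequality with part of the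
    budget already spent. Averaging over the next threshold then requires that the string found be
    independent of the time spent finding it, which is why the law of a search is proved in product
    form.

    Numerically, each search needs about C n ln 2 / sqrt q calls. With x = 1 / sqrt popt and only P
    >= popt, a round with budget 3 C x n would fail with probability up to about 2 ln 2 / 3 = 0.46,
    above 1 / e = 0.37. The factor four in P turns 2 x - 1 into x - 1 and the bound into about 0.23,
    which leaves room for the term ln 6 in the logarithm, for failing searches and for rough
    numerical constants. *)

(* Success.  Amplitude amplification rescales the marked amplitudes uniformly,
   so a search below a threshold returns a string drawn from the initial state
   conditioned on being marked.  If the searches of a round run below masses
   q_1 > q_2 > ..., their costs are of order 1 / sqrt q_i, and comparison with
   the integral of 1 / sqrt q bounds the expected sum of the 1 / sqrt q_i by
   2 / sqrt P - 1, where P is the mass of the optimal strings.  Markov's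
   inequality against the budget 3 C M n alone would not give the failure
   probability 1 / e that [ln (1 / delta)] rounds require.  The missing factor
   comes from symmetry: the circuit commutes with the global spin flip and
   with the alternating spin flip, so each optimal string has four equally
   likely optimal copies and P >= 4 popt.

   Gates.  The mixer is conjugate, under Hadamard gates, to a diagonal
   operator.  All the diagonal operators involved, and the energy itself, are
   functions of the number of true values in a polynomially long list of
   parities.  Such a number is computed in one-hot encoding by a reversible
   circuit, to which phases or copies are applied before uncomputation. *)

(** * Finite distributions *)

(** Weights are not normalized, so that sub-distributions are covered too; total mass one is proved
    separately. *)
Definition Ex (R : realType) T (d : dist R T) (F : T -> R) : R :=
  \sum_(w <- d) w.1 * F w.2.

Definition nonneg (R : realType) T (d : dist R T) : bool :=
  all (fun w => 0 <= w.1) d.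

(** Unlike [in_every_run] it includes entries of weight zero, and so composes under [dbind] without
    sign conditions. *)
Definition always (R : realType) T (d : dist R T) (E : pred T) : bool :=
  all (fun w => E w.2) d.

Lemma Ex_dret (R : realType) T (a : T) (F : T -> R) : Ex (dret R a) F = F a.
Proof. by rewrite /Ex /dret big_seq1 mul1r. Qed.

Lemma Ex_nil (R : realType) T (F : T -> R) : Ex [::] F = 0.
Proof. exact: big_nil. Qed.

Lemma Ex_cons (R : realType) T w (d : dist R T) (F : T -> R) :
  Ex (w :: d) F = w.1 * F w.2 + Ex d F.
Proof. exact: big_cons. Qed.

Lemma Ex_dbind (R : realType) T S (d : dist R T) (f : T -> dist R S) F :
  Ex (dbind d f) F = Ex d (fun a => Ex (f a) F).
Proof.
rewrite /Ex /dbind big_flatten /= big_map; apply: eq_bigr => w _.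
by rewrite big_map big_distrr; apply: eq_bigr => v _; rewrite /= mulrA.
Qed.

Lemma Ex_duniform (R : realType) T (s : seq T) (F : T -> R) :
  Ex (duniform R s) F = \sum_(a <- s) (size s)%:R^-1 * F a.
Proof. by rewrite /Ex /duniform big_map. Qed.

Lemma Ex_measure (R : realType) n (v : qstate R n) (F : bits n -> R) :
  Ex (measure v) F = \sum_x born v x * F x.
Proof. by rewrite /Ex /measure big_map big_enum. Qed.

Lemma eq_Ex (R : realType) T (d : dist R T) (F G : T -> R) :
  F =1 G -> Ex d F = Ex d G.
Proof. by move=> FG; apply: eq_bigr => w _; rewrite FG. Qed.

Lemma Pr_Ex (R : realType) T (d : dist R T) (E : pred T) :
  Pr d E = Ex d (fun a => (E a)%:R).
Proof.
rewrite /Pr /Ex big_mkcond; apply: eq_bigr => w _.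
by case: (E _); rewrite ?mulr1 ?mulr0.
Qed.

Lemma ExZl (R : realType) T (d : dist R T) (c : R) (F : T -> R) :
  Ex d (fun a => c * F a) = c * Ex d F.
Proof. by rewrite /Ex big_distrr; apply: eq_bigr => w _; rewrite /= mulrCA. Qed.

Lemma ExD (R : realType) T (d : dist R T) (F G : T -> R) :
  Ex d (fun a => F a + G a) = Ex d F + Ex d G.
Proof. by rewrite /Ex -big_split; apply: eq_bigr => w _; rewrite mulrDr. Qed.

Lemma Ex_sum (R : realType) T (d : dist R T) (I : Type) (r : seq I)
    (P : pred I) (F : I -> T -> R) :
  \sum_(i <- r | P i) Ex d (F i) = Ex d (fun a => \sum_(i <- r | P i) F i a).
Proof.
by rewrite /Ex exchange_big; apply: eq_bigr => w _; rewrite /= big_distrr.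
Qed.

Lemma le_Ex (R : realType) T (d : dist R T) (E : pred T) (F G : T -> R) :
  nonneg d -> always d E -> (forall a, E a -> F a <= G a) -> Ex d F <= Ex d G.
Proof.
move=> + + FG; rewrite /Ex; elim: d => [|w d IH] /=; first by rewrite !big_nil.
case/andP=> w0 d0 /andP[Ew dE]; rewrite !big_cons lerD ?IH //.
exact/ler_wpM2l/FG.
Qed.

Lemma ler_Ex (R : realType) T (d : dist R T) (F G : T -> R) :
  nonneg d -> (forall a, F a <= G a) -> Ex d F <= Ex d G.
Proof.
move=> d0 FG; apply: (@le_Ex _ _ _ predT) => //.
by rewrite /always; elim: (d).
Qed.

Lemma Ex_ge0 (R : realType) T (d : dist R T) (F : T -> R) :
  nonneg d -> (forall a, 0 <= F a) -> 0 <= Ex d F.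
Proof.
move=> d0 F0; apply: le_trans (ler_Ex d0 F0).
by rewrite /Ex big1 // => w _; rewrite mulr0.
Qed.

Lemma nonneg_dret (R : realType) T (a : T) : nonneg (dret R a).
Proof. by rewrite /nonneg /= ler01. Qed.

Lemma nonneg_dbind (R : realType) T S (d : dist R T) (f : T -> dist R S) :
  nonneg d -> (forall a, nonneg (f a)) -> nonneg (dbind d f).
Proof.
rewrite /nonneg /dbind => + f0; elim: d => //= w d IH /andP[w0 d0].
rewrite all_cat IH // andbT all_map; apply: sub_all (f0 w.2) => v /= v0.
exact: mulr_ge0.
Qed.

Lemma nonneg_duniform (R : realType) T (s : seq T) : nonneg (duniform R s).
Proof.
rewrite /nonneg /duniform all_map.
have: 0 <= (size s)%:R^-1 :> R by rewrite invr_ge0 ler0n.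
by move: _^-1 => c c0; elim: s => //= a s ->; rewrite c0.
Qed.

Lemma born_ge0 (R : realType) n (v : qstate R n) x : 0 <= born v x.
Proof.
by rewrite /born normc_def -rmorphXn /= sqr_sqrtr ?addr_ge0 ?sqr_ge0.
Qed.

Lemma nonneg_measure (R : realType) n (v : qstate R n) : nonneg (measure v).
Proof.
by rewrite /nonneg /measure all_map; apply/allP => x _ /=; rewrite born_ge0.
Qed.

Lemma always_dret (R : realType) T (a : T) (E : pred T) :
  always (dret R a) E = E a.
Proof. by rewrite /always /= andbT. Qed.

Lemma always_dbind (R : realType) T S (d : dist R T) (f : T -> dist R S)
    (D : pred T) (E : pred S) :
  always d D -> (forall a, D a -> always (f a) E) -> always (dbind d f) E.
Proof.
rewrite /always /dbind => + fE; elim: d => //= w d IH /andP[Dw dD].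
rewrite all_cat IH // andbT all_map; exact: sub_all (fE w.2 Dw).
Qed.

Lemma always_true (R : realType) T (d : dist R T) (E : pred T) :
  (forall a, E a) -> always d E.
Proof. by move=> ET; rewrite /always; elim: d => //= w d ->; rewrite ET. Qed.

Lemma always_in_every_run (R : realType) T (d : dist R T) (E : pred T) :
  always d E -> in_every_run d E.
Proof. by apply: sub_all => w Ew; rewrite Ew implybT. Qed.

Lemma Ex_duniform_cst (R : realType) T (s : seq T) (c : R) :
  (0 < size s)%N -> Ex (duniform R s) (fun=> c) = c.
Proof.
move=> s0; rewrite Ex_duniform big_const_seq count_predT.
rewrite iter_addr_0 -mulrnAl -[_ *+ size s]mulr_natl mulfV ?mul1r //.
by rewrite pnatr_eq0 -lt0n.
Qed.

Arguments always : simpl never.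
Arguments Ex : simpl never.
Arguments nonneg : simpl never.

(** * Operators on bit strings *)

Definition ent (R : realType) n (A : qop R n) (y x : bits n) : R[i] :=
  A (enum_rank y) (enum_rank x).

Lemma sum_enum_rank (V : nmodType) (T : finType) (F : 'I_#|T| -> V) :
  \sum_i F i = \sum_(x : T) F (enum_rank x).
Proof. exact: (reindex _ (onW_bij _ (@enum_rank_bij T))). Qed.

Lemma op_ext (R : realType) n (A B : qop R n) :
  (forall y x, ent A y x = ent B y x) -> A = B.
Proof.
move=> AB; apply/matrixP => i j.
by rewrite -(enum_valK i) -(enum_valK j); exact: AB.
Qed.

Lemma state_ext (R : realType) n (v w : qstate R n) :
  (forall x, amp v x = amp w x) -> v = w.
Proof.
move=> vw; apply/matrixP => i j.
by rewrite -(enum_valK i) ord1; exact: vw.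
Qed.

Lemma ent_op_of (R : realType) n (f : bits n -> bits n -> R[i]) y x :
  ent (op_of f) y x = f y x.
Proof. by rewrite /ent mxE !enum_rankK. Qed.

Lemma ent_mul (R : realType) n (A B : qop R n) y x :
  ent (A *m B) y x = \sum_z ent A y z * ent B z x.
Proof. by rewrite /ent mxE sum_enum_rank. Qed.

Lemma amp_mul (R : realType) n (A : qop R n) v y :
  amp (A *m v) y = \sum_z ent A y z * amp v z.
Proof. by rewrite /amp mxE sum_enum_rank. Qed.

Lemma amp_ket (R : realType) n (x y : bits n) : amp (ket R x) y = (y == x)%:R.
Proof. by rewrite /amp mxE eqxx andbT (inj_eq enum_rank_inj). Qed.

Lemma ampD (R : realType) n (v w : qstate R n) x :
  amp (v + w) x = amp v x + amp w x.
Proof. by rewrite /amp mxE. Qed.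

Lemma ampZ (R : realType) n a (v : qstate R n) x : amp (a *: v) x = a * amp v x.
Proof. by rewrite /amp mxE. Qed.

Lemma amp_sum (R : realType) n (I : Type) (r : seq I) (P : pred I)
    (F : I -> qstate R n) x :
  amp (\sum_(i <- r | P i) F i) x = \sum_(i <- r | P i) amp (F i) x.
Proof. by rewrite /amp summxE. Qed.

Lemma amp_mul_ket (R : realType) n (A : qop R n) x y :
  amp (A *m ket R x) y = ent A y x.
Proof.
rewrite amp_mul (bigD1 x) //= big1 => [|z zx].
  by rewrite amp_ket eqxx mulr1 addr0.
by rewrite amp_ket (negPf zx) mulr0.
Qed.

Lemma ent_adj (R : realType) n (A : qop R n) y x :
  ent (adj A) y x = (ent A x y)^*.
Proof. by rewrite /ent /adj !mxE. Qed.

Lemma ent1 (R : realType) n (y x : bits n) :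
  ent (1%:M : qop R n) y x = (y == x)%:R.
Proof. by rewrite /ent mxE (inj_eq enum_rank_inj). Qed.

Lemma entD (R : realType) n (A B : qop R n) y x :
  ent (A + B) y x = ent A y x + ent B y x.
Proof. by rewrite /ent mxE. Qed.

Lemma entZ (R : realType) n a (A : qop R n) y x :
  ent (a *: A) y x = a * ent A y x.
Proof. by rewrite /ent mxE. Qed.

Lemma ent_sum (R : realType) n (I : Type) (r : seq I) (P : pred I)
    (F : I -> qop R n) y x :
  ent (\sum_(i <- r | P i) F i) y x = \sum_(i <- r | P i) ent (F i) y x.
Proof. by rewrite /ent summxE. Qed.

Lemma ent_diag (R : realType) n (f : bits n -> R[i]) y x :
  ent (diag_op f) y x = f x *+ (y == x).
Proof. by rewrite ent_op_of; case: eqP. Qed.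

Lemma diag_op_ket (R : realType) n (f : bits n -> R[i]) x :
  diag_op f *m ket R x = f x *: ket R x.
Proof.
apply: state_ext => y; rewrite amp_mul_ket ent_diag ampZ amp_ket.
by rewrite mulr_natr.
Qed.

Lemma map_op_ket (R : realType) n (f : bits n -> bits n) x :
  map_op R f *m ket R x = ket R (f x).
Proof. by apply: state_ext => y; rewrite amp_mul_ket ent_op_of amp_ket. Qed.

Lemma amp_diag (R : realType) n (f : bits n -> R[i]) v x :
  amp (diag_op f *m v) x = f x * amp v x.
Proof.
rewrite amp_mul (bigD1 x) //= big1 => [|z zx].
  by rewrite ent_diag eqxx mulr1n addr0.
by rewrite ent_diag eq_sym (negPf zx) mulr0n mul0r.
Qed.

Lemma diag_op_mul (R : realType) n (f g : bits n -> R[i]) :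
  diag_op f *m diag_op g = diag_op (fun x => f x * g x).
Proof.
apply: op_ext => y x.
rewrite -amp_mul_ket -mulmxA !amp_diag amp_ket ent_diag.
by case: eqP => [->|_]; rewrite ?mulr1 ?mulr0 ?mulr1n ?mulr0n.
Qed.

Lemma adjM (R : realType) n (A B : qop R n) : adj (A *m B) = adj B *m adj A.
Proof. by rewrite /adj map_mxM trmx_mul. Qed.

Lemma adjK (R : realType) n (A : qop R n) : adj (adj A) = A.
Proof. by apply: op_ext => y x; rewrite !ent_adj conjcK. Qed.

Lemma unitary1 (R : realType) n : unitary_op (1%:M : qop R n).
Proof.
rewrite /unitary_op mulmx1; apply: op_ext => y x.
by rewrite ent_adj !ent1 eq_sym conjc_nat.
Qed.

Lemma unitaryM (R : realType) n (A B : qop R n) :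
  unitary_op A -> unitary_op B -> unitary_op (A *m B).
Proof.
rewrite /unitary_op => uA uB.
by rewrite adjM mulmxA -(mulmxA (adj B)) uA mulmx1.
Qed.

Lemma unitary_adj (R : realType) n (A : qop R n) :
  unitary_op A -> unitary_op (adj A).
Proof. by rewrite /unitary_op adjK => /mulmx1C. Qed.

Lemma unitary_diag (R : realType) n (f : bits n -> R[i]) :
  (forall x, f x * (f x)^* = 1) -> unitary_op (diag_op f).
Proof.
move=> f1; rewrite /unitary_op.
have -> : adj (diag_op f) = diag_op (fun x => (f x)^*).
  apply: op_ext => y x; rewrite ent_adj !ent_diag eq_sym.
  by case: eqP => [->|_]; rewrite ?mulr1n // !mulr0n rmorph0.
rewrite diag_op_mul; apply: op_ext => y x.
by rewrite ent_diag ent1 mulrC f1.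
Qed.

Lemma bornE (R : realType) n (v : qstate R n) x :
  (born v x)%:C = amp v x * (amp v x)^*.
Proof.
rewrite /born sqr_normc RRe_real //.
by rewrite realE mulcJ_ge0.
Qed.

Lemma sum_born (R : realType) n (v : qstate R n) :
  (\sum_x born v x)%:C = ((map_mx conjc v)^T *m v) 0 0.
Proof.
rewrite rmorph_sum mxE sum_enum_rank; apply: eq_bigr => x _ /=.
by rewrite bornE mulrC !mxE.
Qed.

Lemma unitary_born (R : realType) n (A : qop R n) v :
  unitary_op A -> \sum_x born (A *m v) x = \sum_x born v x.
Proof.
move=> uA; apply: (@complexI R); rewrite !sum_born map_mxM trmx_mul -!mulmxA.
by congr ((_ *m _) 0 0); rewrite mulmxA (_ : _ *m A = 1%:M) ?mul1mx.
Qed.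

Lemma sum_born_ket (R : realType) n (x : bits n) :
  \sum_y born (ket R x) y = 1.
Proof.
rewrite (bigD1 x) //= big1 => [|y yx]; rewrite /born amp_ket.
  by rewrite eqxx normr1 expr1n addr0.
by rewrite (negPf yx) normr0 expr0n.
Qed.

(** * Amplitude amplification and search *)

Lemma unitary_op_mx (R : realType) n (U : qop R n) (m : pred (bits n)) o :
  unitary_op U -> unitary_op (op_mx U m o).
Proof.
move=> uU.
have sgn_unitary (P : pred (bits n)) :
    unitary_op (diag_op (fun x => if P x then -1 else 1 : R[i])).
  apply: unitary_diag => x.
  by case: ifP => _; rewrite ?rmorphN rmorph1 ?mulrNN mulr1.
case: o => /=; [exact: uU|exact: unitary_adj|exact: sgn_unitary| |].
  exact: (sgn_unitary (pred1 _)).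
exact: unitary1.
Qed.

Lemma sum_born_run_ops (R : realType) n (U : qop R n) (m : pred (bits n)) t :
  unitary_op U -> \sum_x born (run_ops U m t) x = 1.
Proof.
move=> uU; rewrite /run_ops -[RHS](sum_born_ket R (zeros n)).
elim: t (ket _ _) => //= o t IH v.
by rewrite IH unitary_born //; exact: unitary_op_mx.
Qed.

(** The reflection is a rank-one perturbation of the identity. *)
Lemma reflect_zeroE (R : realType) n (v : qstate R n) :
  reflect_zero R n *m v = v - (2 * amp v (zeros n)) *: ket R (zeros n).
Proof.
apply: state_ext => x; rewrite amp_diag -scaleNr ampD ampZ amp_ket.
by case: eqP => [->|_] /=; ring.
Qed.

(* Locked, so that simplification does not unfold traces. *)
Definition attempt (j : nat) : seq op := locked (rcons (amplify j) OpTest).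

Lemma attemptE j : attempt j = rcons (amplify j) OpTest.
Proof. by rewrite /attempt -lock. Qed.

Arguments amplify : simpl never.
Arguments eqsearch_from : simpl never.

Lemma eqsearch_from0 (R : realType) (sched : schedule R) n (U : qop R n) m d k r :
  eqsearch_from sched U m d 0 k r = dret R (None, [::]).
Proof. by []. Qed.

Lemma eqsearch_fromS (R : realType) (sched : schedule R) n (U : qop R n)
    m d fuel k r :
  eqsearch_from sched U m d fuel.+1 k r =
  dbind (duniform R (sched n d k)) (fun j =>
    if (r < calls (attempt j))%N then dret R (None, cut r (attempt j))
    else dbind (measure (run_ops U m (amplify j))) (fun x =>
      if m x then dret R (Some x, attempt j)
      else dbind (eqsearch_from sched U m d fuel k.+1 (r - calls (attempt j)))
        (fun res => dret R (res.1, attempt j ++ res.2)))).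
Proof. by congr dbind; apply: funext => j; rewrite attemptE. Qed.

(* Marked and unmarked amplitudes are each rescaled as a whole, so a marked
   outcome is distributed as in the initial state. *)
Lemma amplify_amp (R : realType) n (U : qop R n) (m : pred (bits n)) j :
  unitary_op U -> exists a b : R[i], forall x,
    amp (run_ops U m (amplify j)) x =
    (if m x then a else b) * amp (U *m ket R (zeros n)) x.
Proof.
move=> uU; rewrite /run_ops /amplify /=; set psi := U *m _.
pose shape v := exists a b : R[i], forall x,
  amp v x = (if m x then a else b) * amp psi x.
suff step v : shape v -> shape (foldl (fun v o => op_mx U m o *m v) v
    (flatten (nseq j [:: OpMark; OpUinv; OpZero; OpU]))).
  by apply: step; exists 1, 1 => x; rewrite if_same mul1r.
elim: j v => //= j IH v [a [b vE]]; apply: IH.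
(* Conjugated by [U], the reflection subtracts a multiple of [psi], which shifts the marked and the
   unmarked factor by the same constant. *)
have -> : U *m (reflect_zero R n *m (adj U *m (phase_oracle R m *m v))) =
    phase_oracle R m *m v -
    (2 * amp (adj U *m (phase_oracle R m *m v)) (zeros n)) *: psi.
  rewrite reflect_zeroE mulmxBr -scalemxAr (mulmxA U (adj U)).
  by rewrite (mulmx1C uU) mul1mx.
set c := amp (adj U *m _) _; exists (- a - 2 * c), (b - 2 * c) => x.
rewrite -scaleNr ampD ampZ amp_diag vE -/psi.
by case: ifP => _; ring.
Qed.

Lemma amplify_born (R : realType) n (U : qop R n) (m : pred (bits n)) j :
  unitary_op U -> exists2 a : R, 0 <= a & forall x, m x ->
    born (run_ops U m (amplify j)) x = a * born (U *m ket R (zeros n)) x.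
Proof.
move=> uU; have [a [b ampE]] := amplify_amp m j uU.
have a0 := mulcJ_ge0 a; exists (complex.Re (a * a^*)).
  by move: a0; rewrite lecE => /andP[].
move=> x mx; apply: (@complexI R); rewrite rmorphM /= !bornE ampE mx.
by rewrite RRe_real ?realE ?a0 // rmorphM /=; ring.
Qed.

Lemma calls_cat t u : calls (t ++ u) = (calls t + calls u)%N.
Proof. exact: count_cat. Qed.

Lemma calls_amplify j : calls (amplify j) = (1 + 3 * j)%N.
Proof.
rewrite /calls /amplify /= mulnC; congr addn.
by elim: j => //= j ->; rewrite mulSn.
Qed.

Lemma calls_attempt j : calls (attempt j) = (2 + 3 * j)%N.
Proof. by rewrite attemptE -cats1 calls_cat calls_amplify addnAC. Qed.

Lemma calls_cut r t : (calls (cut r t) <= r)%N.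
Proof.
elim: t r => [|o t IH] r //=.
case: ifP => ot; last by rewrite /= ot; exact: IH.
by case: r => //= r; rewrite ot add1n ltnS; exact: IH.
Qed.

Definition is_zero (o : op) : bool := if o is OpZero then true else false.

(** Zero reflections are free in the call budget but cost gates. Bounding them by the calls turns a
    call bound into a gate bound. *)
Definition zero_count (t : seq op) : nat := count is_zero t.

Lemma zero_count_cat t u : zero_count (t ++ u) = (zero_count t + zero_count u)%N.
Proof. exact: count_cat. Qed.

Lemma zero_count_cut_attempt j r :
  (zero_count (cut r (attempt j)) <=
   calls (cut r (attempt j)))%N.
Proof.
rewrite attemptE /amplify; case: r => // r; rewrite /= add0n add1n; apply: leqW.
(* An iteration makes three calls, hence the case analysis on a budget of 0, 1, 2 or at least 3. *)
elim: j r => [|j IH] [|[|[|r]]] //=.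
by have := IH r; rewrite /zero_count /calls /=; lia.
Qed.

Lemma zero_count_attempt j :
  (zero_count (attempt j) <=
   calls (attempt j))%N.
Proof.
have -> : zero_count (attempt j) = j.
  rewrite attemptE -cats1 zero_count_cat addn0 /zero_count /amplify /=.
  by elim: j => //= j ->.
by rewrite calls_attempt; lia.
Qed.

Arguments cut : simpl never.
Arguments calls : simpl never.
Arguments zero_count : simpl never.

Lemma nonneg_eqsearch_from (R : realType) (sched : schedule R) n (U : qop R n)
    m d fuel k r :
  nonneg (eqsearch_from sched U m d fuel k r).
Proof.
elim: fuel k r => [|fuel IH] k r; first exact: nonneg_dret.
rewrite eqsearch_fromS.
apply: nonneg_dbind (nonneg_duniform _ _) _ => j.
case: ifP => _; first exact: nonneg_dret.
apply: nonneg_dbind (nonneg_measure _) _ => x.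
case: ifP => _; first exact: nonneg_dret.
by apply: nonneg_dbind (IH _ _) _ => o; exact: nonneg_dret.
Qed.

Lemma mass_eqsearch_from (R : realType) (sched : schedule R) n (U : qop R n)
    m d fuel k r :
  unitary_op U -> (forall n d k, sched n d k != [::]) ->
  Ex (eqsearch_from sched U m d fuel k r) (fun=> 1) = 1.
Proof.
move=> uU sched0; elim: fuel k r => [|fuel IH] k r.
  by rewrite eqsearch_from0 Ex_dret.
rewrite eqsearch_fromS Ex_dbind.
rewrite -[RHS](@Ex_duniform_cst R _ (sched n d k) 1); last first.
  by rewrite lt0n size_eq0.
apply: eq_Ex => j; case: ifP => _; first by rewrite Ex_dret.
rewrite Ex_dbind -[RHS](@sum_born_run_ops R n U m (amplify j)) //.
rewrite Ex_measure; apply: eq_bigr => x _.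
case: ifP => _; first by rewrite Ex_dret mulr1.
rewrite Ex_dbind (eq_Ex _ (G := fun=> 1)) ?IH ?mulr1 // => o.
by rewrite Ex_dret.
Qed.

(** That a successful search makes calls at all is what keeps the fuel of a round from running out
    before its budget. *)
Lemma always_eqsearch_from (R : realType) (sched : schedule R) n (U : qop R n)
    m d fuel k r :
  always (eqsearch_from sched U m d fuel k r) (fun o =>
    [&& (calls o.2 <= r)%N, (zero_count o.2 <= calls o.2)%N &
        if o.1 is Some x then m x && (1 < calls o.2)%N else true]).
Proof.
elim: fuel k r => [|fuel IH] k r; first by rewrite eqsearch_from0 always_dret.
rewrite eqsearch_fromS.
apply: (@always_dbind _ _ _ _ _ predT) => [|j _]; first exact: always_true.
rewrite /=.
case: ifP => [_|/negbT]; last rewrite -leqNgt => rj.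
  rewrite always_dret; apply/and3P.
  by split; [exact: calls_cut|exact: zero_count_cut_attempt|].
apply: (@always_dbind _ _ _ _ _ predT) => [|x _]; first exact: always_true.
rewrite /=.
case: ifP => mx.
  rewrite always_dret; apply/and3P; split; [exact: rj|exact: zero_count_attempt|].
  by rewrite mx calls_attempt.
apply: always_dbind (IH _ _) _ => -[x' t] /and3P[/= o1 o2 o3].
rewrite always_dret; apply/and3P; rewrite /= calls_cat zero_count_cat; split.
- by rewrite -leq_subRL.
- by rewrite leq_add ?zero_count_attempt.
- by case: x' o3 => //= y /andP[-> ?]; rewrite ltn_addl.
Qed.

(** The string found and the number of calls are independent: [j] iterations rescale all marked
    masses by one factor, and a failed attempt only adds time. The weights of [h] are relative to
    the initial masses, so [h] need not have mass one. *)
Lemma eqsearch_from_law (R : realType) (sched : schedule R) n (U : qop R n)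
    m d fuel k r :
  unitary_op U -> exists2 h : dist R nat, nonneg h &
  forall F : bits n -> nat -> R,
    Ex (eqsearch_from sched U m d fuel k r)
       (fun o => if o.1 is Some x then F x (calls o.2) else 0) =
    \sum_(x | m x) born (U *m ket R (zeros n)) x * Ex h (F x).
Proof.
move=> uU; elim: fuel k r => [|fuel IH] k r.
  exists [::] => // F; rewrite eqsearch_from0 Ex_dret big1 // => x _.
  by rewrite Ex_nil mulr0.
have [h h0 hE] : exists2 h : nat -> dist R nat, forall j, nonneg (h j) &
    forall j F,
    Ex (eqsearch_from sched U m d fuel k.+1 (r - calls (attempt j)))
       (fun o => if o.1 is Some x then F x (calls o.2) else 0) =
    \sum_(x | m x) born (U *m ket R (zeros n)) x * Ex (h j) (F x).
  have /choice[h hP] : forall j, exists h : dist R nat, nonneg h /\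
      forall F,
      Ex (eqsearch_from sched U m d fuel k.+1 (r - calls (attempt j)))
         (fun o => if o.1 is Some x then F x (calls o.2) else 0) =
      \sum_(x | m x) born (U *m ket R (zeros n)) x * Ex h (F x).
    by move=> j; case: (IH k.+1 (r - calls (attempt j))%N) => h;
       exists h.
  by exists h => [j|j F]; case: (hP j).
have [a a0 aE] : exists2 a : nat -> R, forall j, 0 <= a j & forall j x, m x ->
    born (run_ops U m (amplify j)) x = a j * born (U *m ket R (zeros n)) x.
  have /choice[a aP] : forall j, exists a : R, 0 <= a /\ forall x, m x ->
      born (run_ops U m (amplify j)) x = a * born (U *m ket R (zeros n)) x.
    by move=> j; case: (amplify_born m j uU) => a; exists a.
  by exists a => [j|j x]; case: (aP j) => // _; apply.
pose c j := calls (attempt j).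
pose b j := \sum_(x | ~~ m x) born (run_ops U m (amplify j)) x.
(* Law of the calls: stop after [c j] calls with the relative weight [a j], or measure an unmarked
   string, of probability [b j], and continue with the time shifted by [c j]. *)
exists (dbind (duniform R (sched n d k)) (fun j =>
  if (r < c j)%N then [::] else
  (a j, c j) :: dbind [:: (b j, tt)] (fun=> dbind (h j) (fun i =>
     dret R (c j + i)%N)))).
  apply: nonneg_dbind (nonneg_duniform _ _) _ => j; case: ifP => //= _.
  rewrite /nonneg /= a0; apply: nonneg_dbind => [|_].
    by rewrite /nonneg /= andbT sumr_ge0 // => x _; exact: born_ge0.
  by apply: nonneg_dbind => // i; exact: nonneg_dret.
move=> F; rewrite eqsearch_fromS Ex_dbind.
under [RHS]eq_bigr => x _ do rewrite Ex_dbind -ExZl.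
rewrite Ex_sum; apply: eq_Ex => j /=; rewrite -/(c j).
case: ifP => _.
  by rewrite Ex_dret /= big1 // => x _; rewrite Ex_nil mulr0.
rewrite Ex_dbind Ex_measure (bigID m) /=.
under eq_bigr => x mx do rewrite mx Ex_dret /= aE // -/(c j).
under [RHS]eq_bigr => x mx do
  rewrite Ex_cons mulrDr mulrA [_ * a j]mulrC Ex_dbind Ex_cons Ex_nil addr0 /=.
rewrite [RHS]big_split /=; congr (_ + _).
transitivity (b j * \sum_(x | m x) born (U *m ket R (zeros n)) x *
    Ex (h j) (fun i => F x (c j + i)%N)).
  rewrite -(hE j (fun x i => F x (c j + i)%N)) /b big_distrl /=.
  apply: eq_bigr => x /negPf mx; rewrite mx Ex_dbind; congr (_ * _).
  by apply: eq_Ex => o; rewrite Ex_dret /=; case: (o.1) => // y; rewrite calls_cat.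
rewrite big_distrr; apply: eq_bigr => x _ /=.
rewrite mulrCA; congr (_ * (_ * _)).
by rewrite Ex_dbind; apply: eq_Ex => i; rewrite Ex_dret.
Qed.

(** A larger budget does not alter what happens within the first [r0] calls; the two searches are
    compared attempt by attempt. The guarantee speaks of the small budget, a round runs the large
    one. *)
Lemma eqsearch_from_budget (R : realType) (sched : schedule R) n (U : qop R n)
    m d fuel fuel0 k r r0 :
  (fuel0 <= fuel)%N -> (r0 <= r)%N ->
  Pr (eqsearch_from sched U m d fuel0 k r0)
     (fun o => if o.1 is Some x then m x else false) <=
  Ex (eqsearch_from sched U m d fuel k r)
     (fun o => if o.1 is Some x then (calls o.2 <= r0)%:R else 0).
Proof.
rewrite Pr_Ex.
elim: fuel0 fuel k r r0 => [|fuel0 IH] fuel k r r0 + r0r.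
  move=> _; rewrite eqsearch_from0 Ex_dret /=.
  apply: Ex_ge0 (nonneg_eqsearch_from _ _ _ _ _ _ _) _.
  by move=> o; case: (o.1) => // x; rewrite ler0n.
case: fuel => // fuel; rewrite ltnS => le_fuel.
rewrite !eqsearch_fromS !Ex_dbind.
apply: ler_Ex (nonneg_duniform _ _) _ => j.
set t := attempt j; case: (ltnP r0 (calls t)) => r0t.
  rewrite Ex_dret /= (@Ex_ge0 R) // => [|o].
    case: ifP => _; first exact: nonneg_dret.
    apply: nonneg_dbind (nonneg_measure _) _ => x.
    case: ifP => _; first exact: nonneg_dret.
    apply: nonneg_dbind (nonneg_eqsearch_from _ _ _ _ _ _ _) _ => o.
    exact: nonneg_dret.
  by case: (o.1) => // x; rewrite ler0n.
rewrite ltnNge (leq_trans r0t r0r) /= !Ex_dbind.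
apply: ler_Ex (nonneg_measure _) _ => x.
case: ifP => mx; first by rewrite !Ex_dret /= mx r0t.
rewrite !Ex_dbind; under eq_Ex => o do rewrite Ex_dret /=.
under [leRHS]eq_Ex => o do rewrite Ex_dret /= calls_cat -/t.
have le_r : (r0 - calls t <= r - calls t)%N by rewrite leq_sub2r.
apply: le_trans (IH fuel k.+1 _ _ le_fuel le_r) _.
apply: ler_Ex (nonneg_eqsearch_from _ _ _ _ _ _ _) _ => o.
by case: (o.1) => // y; rewrite leq_subRL.
Qed.

(** * The potential of a threshold *)

Definition mass_below (R : realType) (T : finType) (p : T -> R) (E : T -> nat)
    (e : nat) : R :=
  \sum_(x | (E x < e)%N) p x.

(* Expected value of the sum of 1 / sqrt q over the searches still to be made
   below the threshold [e], where q runs over the masses below the successive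
   thresholds and [e0] is the least energy. *)
Definition potential (R : realType) (T : finType) (p : T -> R) (E : T -> nat)
    (e0 e : nat) : R :=
  if (e <= e0)%N then 0 else
  2 / Num.sqrt (mass_below p E e0.+1) - (Num.sqrt (mass_below p E e))^-1.

Lemma mass_below_ge0 (R : realType) (T : finType) (p : T -> R) E e :
  (forall x, 0 <= p x) -> 0 <= mass_below p E e.
Proof. by move=> p0; apply: sumr_ge0. Qed.

Lemma sum_ltnS (R : realType) (T : finType) (F : T -> R) (E : T -> nat) e :
  \sum_(x | (E x < e.+1)%N) F x =
  \sum_(x | (E x < e)%N) F x + \sum_(x | E x == e) F x.
Proof.
rewrite (bigID (fun x => E x < e)%N) /=; congr (_ + _).
  by apply: eq_bigl => x; lia.
by apply: eq_bigl => x; lia.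
Qed.

Lemma mass_belowS (R : realType) (T : finType) (p : T -> R) E e :
  mass_below p E e.+1 = mass_below p E e + \sum_(x | E x == e) p x.
Proof. exact: sum_ltnS. Qed.

Lemma le_mass_below (R : realType) (T : finType) (p : T -> R) E e f :
  (forall x, 0 <= p x) -> (e <= f)%N -> mass_below p E e <= mass_below p E f.
Proof.
move=> p0 ef; rewrite -(subnK ef); elim: (f - e)%N => //= k IH.
by rewrite addSn mass_belowS (le_trans IH) // lerDl sumr_ge0.
Qed.

Lemma mass_below0 (R : realType) (T : finType) (p : T -> R) E e :
  (forall x, (e <= E x)%N) -> mass_below p E e = 0.
Proof. by move=> Ee; rewrite /mass_below big1 // => x; rewrite ltnNge Ee. Qed.

(* The sum is an upper Riemann sum of the integral of 1 / sqrt q. *)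
Lemma record_sum (R : realType) (T : finType) (p : T -> R) E e0 e :
  (forall x, 0 <= p x) -> (forall x, (e0 <= E x)%N) ->
  0 < mass_below p E e0.+1 ->
  2 * (Num.sqrt (mass_below p E e) - Num.sqrt (mass_below p E e0.+1)) <=
  \sum_(x | (E x < e)%N) p x * (Num.sqrt (mass_below p E (E x)))^-1.
Proof.
move=> p0 Ee0 P0; case: (leqP e e0.+1) => [le_e|].
  apply: (@le_trans _ _ 0); last first.
    by apply: sumr_ge0 => x _; rewrite mulr_ge0 ?invr_ge0 ?sqrtr_ge0.
  by rewrite pmulr_rle0 // subr_le0 ler_wsqrtr // le_mass_below.
move=> lt_e; rewrite -(subnK (ltnW lt_e)); move: (e - e0.+1)%N => {e lt_e} k.
elim: k => [|k IH].
  rewrite add0n subrr mulr0 sumr_ge0 // => x _.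
  by rewrite mulr_ge0 ?invr_ge0 ?sqrtr_ge0.
rewrite addSn; set f := (k + e0.+1)%N in IH *.
rewrite sum_ltnS [X in _ <= _ + X](eq_bigr (fun x => p x *
  (Num.sqrt (mass_below p E f))^-1)) => [|x /eqP ->] //.
rewrite -big_distrl /=.
have Pf : 0 < mass_below p E f.
  by apply: lt_le_trans P0 _; rewrite le_mass_below // leq_addl.
have ff : mass_below p E f <= mass_below p E f.+1 by exact: le_mass_below.
set a := Num.sqrt (mass_below p E f); set b := Num.sqrt (mass_below p E f.+1).
have a0 : 0 < a by rewrite sqrtr_gt0.
have ab : a <= b by rewrite ler_wsqrtr.
have -> : \sum_(x | E x == f) p x = b ^+ 2 - a ^+ 2.
  by rewrite !sqr_sqrtr ?mass_below_ge0 // mass_belowS addrC addKr.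
(* The right side is (b - a) (b + a) / a, and b + a >= 2 a. *)
suff : 2 * (b - a) <= (b ^+ 2 - a ^+ 2) / a.
  move: IH; rewrite -/a; set S := \sum_(_ | _) _; lra.
rewrite ler_pdivlMr //; nra.
Qed.

(** After division by the mass q below [e]: when the next threshold is drawn from the strings below
    [e], the expected potential drops by at least 1 / sqrt q, the cost of the current search. *)
Lemma potential_rec (R : realType) (T : finType) (p : T -> R) E e0 e :
  (forall x, 0 <= p x) -> (forall x, (e0 <= E x)%N) ->
  0 < mass_below p E e0.+1 -> (e0 < e)%N ->
  \sum_(x | (E x < e)%N) p x * potential p E e0 (E x) <=
  mass_below p E e *
    (potential p E e0 e - (Num.sqrt (mass_below p E e))^-1).
Proof.
move=> p0 Ee0 P0 lt_e; have := record_sum e p0 Ee0 P0.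
rewrite /potential leqNgt lt_e /=.
have PQ : mass_below p E e0.+1 <= mass_below p E e by exact: le_mass_below.
set P := mass_below p E e0.+1 in P0 PQ *; set Q := mass_below p E e in PQ *.
have Q0 : 0 < Q := lt_le_trans P0 PQ.
set S := (X in _ <= X -> _) => leS; set c := 2 / Num.sqrt P.
have PE : P = \sum_(x | (E x < e)%N) (if (E x <= e0)%N then p x else 0).
  by rewrite -big_mkcondr; apply: eq_bigl => x; lia.
have -> : \sum_(x | (E x < e)%N) p x * (if (E x <= e0)%N then 0 else
    c - (Num.sqrt (mass_below p E (E x)))^-1) = (Q - P) * c - S.
  rewrite PE -sumrB big_distrl -sumrB; apply: eq_bigr => x _ /=.
  (* No mass lies below the least energy, so the convention 0^-1 = 0 makes the summand of [S] vanish
     there. *)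
  case: ifP => [le_x|_]; last by ring.
  rewrite (mass_below0 _ (e := E x)) => [|y]; first by rewrite sqrtr0 invr0; ring.
  exact: leq_trans (Ee0 y).
have sP : 0 < Num.sqrt P by rewrite sqrtr_gt0.
have sQ : 0 < Num.sqrt Q by rewrite sqrtr_gt0.
(* The share [P * c] that ends at an optimal string cancels the lower limit in the integral
   estimate. *)
have PP : P * c = 2 * Num.sqrt P.
  by rewrite -{1}[P]sqr_sqrtr ?ltW // /c; field; rewrite gt_eqF.
have QQ : Q * (Num.sqrt Q)^-1 = Num.sqrt Q.
  by rewrite -{1}[Q]sqr_sqrtr ?ltW //; field; rewrite gt_eqF.
by move: leS; rewrite !mulrBl !mulrBr PP QQ; lra.
Qed.

(** * A round of minimum finding *)

Definition energy n (x : bits n) : nat := `|sidelobe x|%N.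

Lemma sidelobe_ge0 n (x : bits n) : 0 <= sidelobe x.
Proof. by apply: sumr_ge0 => k _; exact: sqr_ge0. Qed.

Lemma sidelobeE n (x : bits n) : sidelobe x = (energy x)%:Z.
Proof. by rewrite /energy gez0_abs ?sidelobe_ge0. Qed.

(* For the infinite initial threshold, any value above all energies will do. *)
Definition threshold n (s : option (bits n)) : nat :=
  if s is Some y then energy y else (\max_(x : bits n) energy x).+1.

Lemma marksE n (s : option (bits n)) x : marks s x = (energy x < threshold s)%N.
Proof.
case: s => [y|] /=; first by rewrite !sidelobeE ltz_nat.
by rewrite ltnS leq_bigmax.
Qed.

Arguments qmf_round : simpl never.

Lemma qmf_roundS (R : realType) (sched : schedule R) n (U : qop R n) fuel s r :
  qmf_round sched U fuel.+1 s r =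
  if r == 0%N then dret R (s, [::])
  else dbind (eqsearch sched U (marks s) (1 / (6 * 2 ^+ n)) r) (fun found =>
    if found.1 is Some x then
      dbind (qmf_round sched U fuel (Some x) (r - calls found.2))
        (fun res => dret R (res.1, found.2 ++ res.2))
    else dret R (s, found.2)).
Proof. by []. Qed.

Lemma qmf_round0 (R : realType) (sched : schedule R) n (U : qop R n) s r :
  qmf_round sched U 0 s r = dret R (s, [::]).
Proof. by []. Qed.

Lemma nonneg_qmf_round (R : realType) (sched : schedule R) n (U : qop R n)
    fuel s r :
  nonneg (qmf_round sched U fuel s r).
Proof.
elim: fuel s r => [|fuel IH] s r; first exact: nonneg_dret.
rewrite qmf_roundS; case: ifP => _; first exact: nonneg_dret.
apply: nonneg_dbind (nonneg_eqsearch_from _ _ _ _ _ _ _) _ => -[[x|] t] /=.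
  by apply: nonneg_dbind (IH _ _) _ => res; exact: nonneg_dret.
exact: nonneg_dret.
Qed.

Lemma mass_qmf_round (R : realType) (sched : schedule R) n (U : qop R n)
    fuel s r :
  unitary_op U -> (forall n d k, sched n d k != [::]) ->
  Ex (qmf_round sched U fuel s r) (fun=> 1) = 1.
Proof.
move=> uU sched0; elim: fuel s r => [|fuel IH] s r.
  by rewrite qmf_round0 Ex_dret.
rewrite qmf_roundS; case: ifP => _; first by rewrite Ex_dret.
rewrite Ex_dbind -[RHS](mass_eqsearch_from (marks s) (1 / (6 * 2 ^+ n)) r 0 r
  uU sched0).
apply: eq_Ex => -[[x|] t] /=; last by rewrite Ex_dret.
by rewrite Ex_dbind (eq_Ex _ (G := fun=> 1)) ?IH // => o; rewrite Ex_dret.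
Qed.

Lemma always_qmf_round (R : realType) (sched : schedule R) n (U : qop R n)
    fuel s r :
  always (qmf_round sched U fuel s r)
    (fun o => (calls o.2 <= r)%N && (zero_count o.2 <= calls o.2)%N).
Proof.
elim: fuel s r => [|fuel IH] s r; first by rewrite qmf_round0 always_dret.
rewrite qmf_roundS; case: ifP => _; first by rewrite always_dret.
apply: always_dbind (always_eqsearch_from _ _ _ _ _ _ _) _.
move=> -[[x|] t] /and3P[] /= tr zt _; last by rewrite always_dret /= tr.
apply: always_dbind (IH _ _) _ => -[y u] /andP[] /= ur zu.
rewrite always_dret /= calls_cat zero_count_cat leq_add // andbT.
by rewrite -leq_subRL.
Qed.

Definition hits n (e : nat) (s : option (bits n)) : bool :=
  if s is Some x then energy x == e else false.

(** Below the least energy nothing is marked, so a further search returns nothing and the threshold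
    stays. *)
Lemma qmf_round_done (R : realType) (sched : schedule R) n (U : qop R n)
    fuel s r e :
  unitary_op U -> (forall n d k, sched n d k != [::]) ->
  (forall x : bits n, (e <= energy x)%N) -> hits e s ->
  1 <= Ex (qmf_round sched U fuel s r) (fun o => (hits e o.1)%:R).
Proof.
move=> uU sched0 min_e se; case: fuel => [|fuel].
  by rewrite qmf_round0 Ex_dret se.
rewrite qmf_roundS; case: ifP => _; first by rewrite Ex_dret se.
rewrite Ex_dbind -[leLHS](mass_eqsearch_from (marks s) (1 / (6 * 2 ^+ n)) r 0 r
  uU sched0).
apply: le_Ex (nonneg_eqsearch_from _ _ _ _ _ _ _)
  (always_eqsearch_from _ _ _ _ _ _ _) _.
move=> -[[x|] t] /and3P[] /= _ _; last by rewrite Ex_dret se.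
rewrite marksE; case: s se => //= y /eqP ->.
by rewrite ltnNge min_e.
Qed.

Lemma eqsearch_within (R : realType) (sched : schedule R) (C : R) n
    (U : qop R n) (m : pred (bits n)) (d : R) r (q : R) :
  eqsearch_guarantee sched C -> unitary_op U -> 0 < d <= 1 / 2 -> 0 < q ->
  q <= \sum_(x | m x) born (U *m ket R (zeros n)) x ->
  let r0 := Num.truncn (C / Num.sqrt q * ln (1 / d)) in
  (r0 <= r)%N ->
  1 - d <= Ex (eqsearch sched U m d r)
    (fun o => if o.1 is Some x then (calls o.2 <= r0)%:R else 0).
Proof.
move=> [_ guarantee] uU d01 q0 qm r0 le_r.
apply: le_trans (guarantee n U m q d uU q0 qm d01) _.
exact: eqsearch_from_budget.
Qed.

(** Markov's inequality in inductive form: r / B is the share of the budget still available, and a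
    search below mass q is charged 1 / sqrt q times K / B + d, for its calls and its possible
    failure. The potential bounds the expected sum of the factors 1 / sqrt q. *)
Lemma qmf_round_success (R : realType) (sched : schedule R) (C : R) n
    (U : qop R n) fuel s (r B e : nat) :
  let p := born (U *m ket R (zeros n)) in
  let d := 1 / (6 * 2 ^+ n) : R in
  0 < C -> eqsearch_guarantee sched C -> unitary_op U ->
  (forall x : bits n, (e <= energy x)%N) ->
  0 < mass_below p (@energy n) e.+1 ->
  (r <= fuel)%N -> (r <= B)%N -> (0 < B)%N ->
  r%:R / B%:R - potential p (@energy n) e (threshold s) *
    (C * ln (1 / d) / B%:R + d) <=
  Ex (qmf_round sched U fuel s r) (fun o => (hits e o.1)%:R).
Proof.
move=> p d C0 guarantee uU min_e P0 + + B0.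
set K := C * ln (1 / d).
have d0 : 0 < d by rewrite divr_gt0 // mulr_gt0 // exprn_gt0.
have d1 : d <= 1 / 6.
  rewrite /d ler_pM2l // lef_pV2 ?posrE ?mulr_gt0 ?exprn_gt0 //.
  by rewrite ler_peMr // exprn_ege1 // ler1n.
have K0 : 0 < K.
  rewrite mulr_gt0 // ln_gt0 // ltr_pdivlMr // mul1r; lra.
have B0' : 0 < B%:R :> R by rewrite ltr0n.
have p0 x : 0 <= p x by exact: born_ge0.
have kappa0 : 0 < K / B%:R + d by rewrite addr_gt0 // divr_gt0.
have S0 fu t u : 0 <= Ex (qmf_round sched U fu t u) (fun o => (hits e o.1)%:R : R).
  by apply: Ex_ge0 (nonneg_qmf_round _ _ _ _ _) _ => o; rewrite ler0n.
elim: fuel s r => [|fuel IH] s r le_r le_B.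
  move: le_r; rewrite leqn0 => /eqP ->; rewrite mul0r sub0r.
  apply: le_trans (S0 _ _ _); rewrite oppr_le0 mulr_ge0 ?(ltW kappa0) //.
  rewrite /potential; case: ltnP => // lt_e.
  have PQ : mass_below p (@energy n) e.+1 <= mass_below p (@energy n) (threshold s).
    exact: le_mass_below.
  rewrite subr_ge0.
  have Q0 := lt_le_trans P0 PQ.
  rewrite -[_^-1]mul1r ler_pM // ?invr_ge0 ?sqrtr_ge0 ?ler1n //.
  by rewrite lef_pV2 ?posrE ?sqrtr_gt0 // ler_wsqrtr.
have rB : r%:R / B%:R <= 1 :> R by rewrite ler_pdivrMr // mul1r ler_nat.
case: (leqP (threshold s) e) => [le_s|lt_s].
  rewrite /potential le_s mul0r subr0; apply: le_trans rB _.
  case: guarantee => sched0 _; apply: qmf_round_done => //.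
  case: s le_s => [y|] /=; first by rewrite eqn_leq min_e andbT.
  by rewrite ltnNge (leq_trans (min_e (zeros n))) // leq_bigmax.
set t := (X in X <= _).
(* A positive bound [t] means that the budget exceeds [phi * K], hence the guaranteed cost [r0] of
   the current search. *)
case: (lerP t 0) => [t0|t0]; first exact: le_trans t0 _.
set Q := mass_below p (@energy n) (threshold s).
have PQ : mass_below p (@energy n) e.+1 <= Q by exact: le_mass_below.
have Q0 : 0 < Q := lt_le_trans P0 PQ.
have Q1 : Q <= 1.
  rewrite -(sum_born_ket R (zeros n)) -(unitary_born (ket R (zeros n)) uU).
  by rewrite [leRHS](bigID (fun x => energy x < threshold s)%N) /= lerDl sumr_ge0.
have sQ0 : 0 < Num.sqrt Q by rewrite sqrtr_gt0.
set phi := potential p (@energy n) e (threshold s) in t t0 *.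
have phiE : phi = 2 / Num.sqrt (mass_below p (@energy n) e.+1) - (Num.sqrt Q)^-1.
  by rewrite /phi /potential leqNgt lt_s.
have sV : (Num.sqrt Q)^-1 <= (Num.sqrt (mass_below p (@energy n) e.+1))^-1.
  by rewrite lef_pV2 ?posrE ?sqrtr_gt0 // ler_wsqrtr.
have phi_ge : (Num.sqrt Q)^-1 <= phi by rewrite phiE; lra.
have sV1 : 1 <= (Num.sqrt Q)^-1.
  by rewrite invf_ge1 // -sqrtr1 ler_wsqrtr.
set r0 := Num.truncn (C / Num.sqrt Q * ln (1 / d)).
have r0E : r0%:R <= K * (Num.sqrt Q)^-1.
  rewrite (_ : K * _ = C / Num.sqrt Q * ln (1 / d)); last by rewrite /K; ring.
  rewrite truncn_le // mulr_ge0 ?divr_ge0 ?ltW //.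
  by rewrite ln_gt0 // ltr_pdivlMr // mul1r; lra.
have le_r0 : (r0 <= r)%N.
  rewrite -(@ler_nat R); apply: le_trans r0E _.
  have : 0 < r%:R - phi * (K + d * B%:R).
    rewrite -(pmulr_rgt0 _ (x := B%:R^-1)) ?invr_gt0 //.
    apply: lt_le_trans t0 _; rewrite le_eqVlt; apply/orP; left; apply/eqP.
    by rewrite /t; field; rewrite gt_eqF.
  have : K * (Num.sqrt Q)^-1 <= phi * K by rewrite mulrC ler_wpM2r // ltW.
  have : 0 <= phi * (d * B%:R).
    by rewrite !mulr_ge0 ?(ltW d0) ?ler0n // (le_trans _ phi_ge) // (le_trans _ sV1).
  rewrite mulrDr; lra.
rewrite qmf_roundS; case: eqP => [r0'|_].
  move: le_r0 t0; rewrite r0' leqn0 => _; rewrite /t r0' mul0r sub0r oppr_gt0.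
  rewrite pmulr_llt0 // => phi_lt.
  have := lt_le_trans phi_lt (le_trans (ltW ltr01) (le_trans sV1 phi_ge)).
  by rewrite ltxx.
have [h h0 hE] := eqsearch_from_law sched (marks s) d r 0 r uU.
have marked : Q = \sum_(x | marks s x) p x.
  by apply: eq_bigl => x; rewrite marksE.
have d12 : 0 < d <= 1 / 2 by rewrite d0 /=; lra.
have Q_le : Q <= \sum_(x | marks s x) p x by rewrite -marked.
have := eqsearch_within guarantee uU d12 Q0 Q_le le_r0.
rewrite -/r0 (hE (fun _ c => (c <= r0)%N%:R)) -/p -big_distrl /= -marked.
(* By the product law the guarantee reads 1 - d <= Q * a, where [a] is the weight that [h] gives to
   at most [r0] calls. *)
set a := Ex h _ => aQ.
pose kappa := K / B%:R + d.
(* Only searches ending within [r0] calls are credited. They leave at least r - r0 calls, and [F] is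
   the induction hypothesis for that remainder. *)
pose F (x : bits n) (c : nat) : R := (c <= r0)%:R * ((r%:R - r0%:R) / B%:R -
   potential p (@energy n) e (energy x) * kappa).
apply: (@le_trans _ _ (Ex (eqsearch sched U (marks s) d r)
  (fun o => if o.1 is Some x then F x (calls o.2) else 0))); last first.
  rewrite Ex_dbind; apply: le_Ex (nonneg_eqsearch_from _ _ _ _ _ _ _)
    (always_eqsearch_from _ _ _ _ _ _ _) _.
  move=> -[[x|] w] /and3P[] /= wr _; last by rewrite Ex_dret ler0n.
  case/andP=> _ w1; rewrite Ex_dbind.
  under eq_Ex => o do rewrite Ex_dret /=.
  rewrite /F; case: leqP => [w0|_]; last by rewrite mul0r; exact: S0.
  rewrite mul1r; apply: le_trans (IH (Some x) _ _ _); last 2 first.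
  - by rewrite leq_subLR (leq_trans le_r) // -add1n leq_add2r ltnW.
  - by rewrite (leq_trans (leq_subr _ _)).
  rewrite lerD2r ler_pM2r ?invr_gt0 // natrB //.
  by rewrite lerD2l lerN2 ler_nat.
have := potential_rec p0 min_e P0 lt_s.
rewrite (eq_bigl (marks s)); last by move=> x; rewrite marksE.
rewrite -/phi -/Q; set S := \sum_(_ | _) _ => leS.
pose w := (r%:R - r0%:R) / B%:R : R.
have -> : Ex (eqsearch sched U (marks s) d r)
    (fun o => if o.1 is Some x then F x (calls o.2) else 0) =
    a * (Q * w - S * kappa).
  rewrite hE (eq_bigr (fun x => a * (p x * w -
      p x * potential p (@energy n) e (energy x) * kappa))) => [|x _].
    by rewrite -mulr_sumr sumrB -!mulr_suml -marked.
  rewrite -/p (eq_Ex _ (G := fun c =>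
    (w - potential p (@energy n) e (energy x) * kappa) * (c <= r0)%:R)).
    by rewrite ExZl -/a; ring.
  by move=> c; rewrite /F mulrC.
(* [Z] bounds from below the mean value of the induction hypothesis over the next threshold, with
   the drop of the potential inserted. *)
pose Z := w - kappa * (phi - (Num.sqrt Q)^-1).
have QZ : Q * Z <= Q * w - S * kappa.
  rewrite /Z mulrBr lerD2l lerN2 mulrCA [leRHS]mulrC.
  by apply: ler_wpM2r leS; exact: ltW.
have tZ : t + d <= Z.
  have : t + d = r%:R / B%:R - phi * kappa + d by rewrite /t.
  have : r0%:R / B%:R <= K * (Num.sqrt Q)^-1 / B%:R by rewrite ler_pM2r ?invr_gt0.
  (* As Q <= 1, the drop of the potential also pays for one failure probability [d]. *)
  have : d <= d * (Num.sqrt Q)^-1 by rewrite ler_peMr // ltW.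
  have : kappa * (Num.sqrt Q)^-1 = K * (Num.sqrt Q)^-1 / B%:R + d * (Num.sqrt Q)^-1.
    by rewrite /kappa; ring.
  rewrite /Z mulrBr /w mulrBl [phi * _]mulrC; lra.
(* A failing search loses at most [d * Z], hence at most the [d] set aside in [tZ]. *)
have Z1 : Z <= 1.
  have : 0 <= kappa * (phi - (Num.sqrt Q)^-1) by rewrite mulr_ge0 ?subr_ge0 // ltW.
  have : w <= r%:R / B%:R by rewrite ler_pM2r ?invr_gt0 // gerBl ler0n.
  by rewrite /Z; lra.
have a0 : 0 <= a by apply: Ex_ge0 => // c; rewrite ler0n.
apply: (@le_trans _ _ (a * (Q * Z))); last by rewrite ler_wpM2l.
have : (1 - d) * Z <= a * (Q * Z).
  by rewrite mulrA [a * Q]mulrC ler_wpM2r //; lra.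
have : d * Z <= d by rewrite ler_piMr // ltW.
lra.
Qed.

(** * Success probability of the algorithm *)

Arguments qmf_rounds : simpl never.

Lemma qmf_rounds0 (R : realType) (sched : schedule R) C n (U : qop R n) M :
  qmf_rounds sched C U M 0 = dret R ([::], [::]).
Proof. by []. Qed.

Lemma qmf_roundsS (R : realType) (sched : schedule R) C n (U : qop R n) M k :
  let r := nat_ceil (3 * C * M * n%:R) in
  qmf_rounds sched C U M k.+1 =
  dbind (qmf_rounds sched C U M k) (fun prev =>
    dbind (qmf_round sched U r None r) (fun res =>
      dret R (rcons prev.1 res.1, prev.2 ++ res.2))).
Proof. by []. Qed.

Lemma nonneg_qmf_rounds (R : realType) (sched : schedule R) C n (U : qop R n)
    M k :
  nonneg (qmf_rounds sched C U M k).
Proof.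
elim: k => [|k IH]; first exact: nonneg_dret.
rewrite qmf_roundsS; apply: nonneg_dbind IH _ => prev.
by apply: nonneg_dbind (nonneg_qmf_round _ _ _ _ _) _ => res; exact: nonneg_dret.
Qed.

Lemma always_qmf_rounds (R : realType) (sched : schedule R) C n (U : qop R n)
    M k :
  always (qmf_rounds sched C U M k)
    (fun o => (calls o.2 <= k * nat_ceil (3 * C * M * n%:R))%N &&
              (zero_count o.2 <= calls o.2)%N).
Proof.
elim: k => [|k IH]; first by rewrite qmf_rounds0 always_dret.
rewrite qmf_roundsS; apply: (always_dbind IH) => -[l t] /= /andP[tr zt].
apply: always_dbind (always_qmf_round _ _ _ _ _) _ => -[y u] /andP[] /= ur zu.
rewrite always_dret /= calls_cat zero_count_cat (leq_add zt) // andbT.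
by rewrite mulSn addnC leq_add.
Qed.

(** Every round restarts from the infinite threshold, so failures multiply. *)
Lemma qmf_rounds_success (R : realType) (sched : schedule R) C n (U : qop R n)
    M k e (s : R) :
  let r := nat_ceil (3 * C * M * n%:R) in
  unitary_op U -> (forall n d k, sched n d k != [::]) -> s <= 1 ->
  s <= Ex (qmf_round sched U r None r) (fun o => (hits e o.1)%:R) ->
  1 - (1 - s) ^+ k <=
  Ex (qmf_rounds sched C U M k) (fun o => (has (@hits n e) o.1)%:R).
Proof.
move=> r uU sched0 s1 le_s.
have mass l : Ex (qmf_rounds sched C U M l) (fun=> 1) = 1.
  elim: l => [|l IH]; first by rewrite qmf_rounds0 Ex_dret.
  rewrite qmf_roundsS Ex_dbind -[RHS]IH; apply: eq_Ex => prev.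
  rewrite Ex_dbind (eq_Ex _ (G := fun=> 1)) ?mass_qmf_round // => res.
  by rewrite Ex_dret.
elim: k => [|k IH].
  by rewrite expr0 subrr Ex_ge0 ?nonneg_qmf_rounds // => o; rewrite ler0n.
rewrite qmf_roundsS Ex_dbind.
apply: (@le_trans _ _ (Ex (qmf_rounds sched C U M k)
    (fun o => s * 1 + (1 - s) * (has (@hits n e) o.1)%:R))).
  rewrite ExD !ExZl mass exprS.
  have : (1 - s) * (1 - (1 - s) ^+ k) <= (1 - s) *
      Ex (qmf_rounds sched C U M k) (fun o => (has (@hits n e) o.1)%:R).
    by rewrite ler_wpM2l // subr_ge0.
  lra.
apply: ler_Ex (nonneg_qmf_rounds _ _ _ _ _) _ => prev.
rewrite Ex_dbind; under eq_Ex => res do rewrite Ex_dret /= has_rcons.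
case: (has _ _).
  rewrite (eq_Ex _ (G := fun=> 1)) => [|res]; last by rewrite orbT.
  by rewrite mass_qmf_round // !mulr1 addrC subrK.
rewrite mulr0 addr0 mulr1; apply: le_trans le_s _.
by apply: ler_Ex (nonneg_qmf_round _ _ _ _ _) _ => res; rewrite orbF.
Qed.

Lemma hits_list_min n e (l : seq (option (bits n))) :
  (forall x : bits n, (e <= energy x)%N) -> has (@hits n e) l ->
  hits e (list_min l).
Proof.
move=> min_e; elim: l => //= -[x|] l IH /=; last exact: IH.
have best b : hits e b -> marks b x = false.
  case: b => //= y /eqP ye.
  by rewrite !sidelobeE ltz_nat ye ltnNge min_e.
case/orP=> [xe|/IH le_hits]; last by rewrite best.
case: ifP => //; rewrite marksE.
case: (list_min l) => [y|] /=; rewrite (eqP xe).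
  by rewrite ltnNge => /negbFE; rewrite eqn_leq min_e => ->.
by rewrite ltnS -(eqP xe) leq_bigmax.
Qed.

Lemma nat_ceil_ge (R : realType) (x : R) : x <= (nat_ceil x)%:R.
Proof.
rewrite /nat_ceil; apply: le_trans (ceil_ge x) _.
by rewrite -[(absz _)%:R]/(`|Num.ceil x|%N%:Z%:~R) ler_int abszE ler_norm.
Qed.

(** The numerical bounds below start from 1 + x <= exp x at a small argument and are squared
    repeatedly, rounding down where convenient. *)
Lemma expR_square (R : realType) (x y a : R) :
  y = x + x -> 0 <= a -> a <= expR x -> a * a <= expR y.
Proof. by move=> -> a0 ax; rewrite expRD ler_pM. Qed.

Lemma ln2_le (R : realType) : ln 2 <= 3 / 4 :> R.
Proof.
rewrite -ler_expR lnK ?posrE //.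
have h1 : 35 / 32 <= expR (3 / 32) :> R.
  by apply: le_trans (expR_ge1Dx _); lra.
have h2 : 1196 / 1000 <= expR (3 / 16) :> R.
  by apply: le_trans (expR_square _ _ h1); lra.
have h3 : 143 / 100 <= expR (3 / 8) :> R.
  by apply: le_trans (expR_square _ _ h2); lra.
by apply: le_trans (expR_square _ _ h3); lra.
Qed.

Lemma ln6_le (R : realType) : ln 6 <= 2 :> R.
Proof.
rewrite -ler_expR lnK ?posrE //.
have h1 : 9 / 8 <= expR (1 / 8) :> R.
  by apply: le_trans (expR_ge1Dx _); lra.
have h2 : 126 / 100 <= expR (1 / 4) :> R.
  by apply: le_trans (expR_square _ _ h1); lra.
have h3 : 158 / 100 <= expR (1 / 2) :> R.
  by apply: le_trans (expR_square _ _ h2); lra.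
have h4 : 249 / 100 <= expR 1 :> R.
  by apply: le_trans (expR_square _ _ h3); lra.
by apply: le_trans (expR_square _ _ h4); lra.
Qed.

(** 5/16 is the failure bound of a round: 1/4 for the budget and 1/16 for failing searches. *)
Lemma expRN1_ge (R : realType) : 5 / 16 <= expR (- 1) :> R.
Proof.
have h1 : 3 / 4 <= expR (- (1 / 4)) :> R.
  by apply: le_trans (expR_ge1Dx _); lra.
have h2 : 9 / 16 <= expR (- (1 / 2)) :> R.
  by apply: le_trans (expR_square _ _ h1); lra.
by apply: le_trans (expR_square _ _ h2); lra.
Qed.

(* [x] bounds the potential of the infinite threshold by [x - 1]. *)
Lemma round_failure (R : realType) (n : nat) (C M x B : R) :
  let d := 1 / (6 * 2 ^+ n) : R in
  0 < C -> (4 <= n)%N -> 1 <= x -> x <= M -> x ^+ 2 <= n%:R ->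
  3 * C * M * n%:R <= B ->
  (x - 1) * (C * ln (1 / d) / B + d) <= 5 / 16.
Proof.
move=> d C0 n4 x1 xM x2 le_B.
have n0 : 0 < n%:R :> R by rewrite ltr0n; lia.
have n4' : 4 <= n%:R :> R by rewrite ler_nat.
have x0 : 0 < x by lra.
have M0 : 0 < M by lra.
have p2 : 0 < 2 ^+ n :> R by rewrite exprn_gt0.
have LE : ln (1 / d) = ln 6 + n%:R * ln 2.
  by rewrite /d invf_div divr1 mul1r lnM ?posrE // lnXn // mulr_natl.
have L_le : ln (1 / d) <= 2 + 3 / 4 * n%:R.
  by rewrite LE; have := ln6_le R; have := ln2_le R; nra.
have L0 : 0 <= ln (1 / d).
  by rewrite LE addr_ge0 ?mulr_ge0 ?ler0n ?ln_ge0 //; lra.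
(* From x^2 <= n and n >= 4 follows x <= n / 2, and 2 n <= 2^n; so even 1/24 would do. *)
have xd : (x - 1) * d <= 1 / 16.
  have : x <= n%:R / 2 by rewrite ler_pdivlMr //; nra.
  have : n%:R <= 2 ^+ n / 2 :> R.
    rewrite ler_pdivlMr // -natrX -natrM ler_nat.
    case: n n4 {n0 n4' x2 le_B p2 LE L_le L0 d} => // n _.
    by rewrite expnS mulnC leq_mul2l /= ltn_expl.
  rewrite /d mul1r ler_pdivrMr ?mulr_gt0 //; lra.
have B0 : 0 < B by apply: lt_le_trans le_B; rewrite !mulr_gt0.
have Cx : (x - 1) * (C * ln (1 / d) / B) <= 1 / 4.
  rewrite !mulrA ler_pdivrMr //.
  have le_B' : 3 * C * x * n%:R <= B.
    by apply: le_trans le_B; rewrite ler_wpM2r ?ler0n // ler_wpM2l // mulr_ge0 // ltW.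
  apply: (@le_trans _ _ (1 / 4 * (3 * C * x * n%:R))); last by rewrite ler_pM2l.
  have -> : 1 / 4 * (3 * C * x * n%:R) = C * (3 / 4 * x * n%:R) by field.
  have -> : (x - 1) * C * ln (1 / d) = C * ((x - 1) * ln (1 / d)) by ring.
  rewrite ler_pM2l //.
  have le1 : (x - 1) * ln (1 / d) <= (x - 1) * (2 + 3 / 4 * n%:R).
    by rewrite ler_wpM2l // subr_ge0.
  (* Replacing x by x - 1 frees 3 n / 4 for the constant 2 that bounds ln 6. By (x - 2)^2 >= 0 and
     x^2 <= n, even 2 (x - 1) <= n / 2. *)
  suff : (x - 1) * 2 <= 3 / 4 * n%:R by lra.
  have : 0 <= (x - 2) ^+ 2 by exact: sqr_ge0.
  by rewrite expr2 in x2 *; nra.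
by rewrite mulrDr; lra.
Qed.

Lemma failure_power (R : realType) (f delta : R) :
  0 <= f -> f <= expR (- 1) -> 0 < delta < 1 ->
  f ^+ nat_ceil (ln (1 / delta)) <= delta.
Proof.
move=> f0 fe /andP[d0 d1]; have := nat_ceil_ge (ln (1 / delta)).
set k := nat_ceil _ => le_k.
apply: (@le_trans _ _ (expR (- 1) ^+ k)).
  by apply: lerXn2r; rewrite ?nnegrE ?expR_ge0.
rewrite -expRM_natl mulrN1 -[leRHS]lnK ?posrE // ler_expR.
by move: le_k; rewrite mul1r lnV ?posrE //; lra.
Qed.

Lemma qaoa_qmf_success (R : realType) (sched : schedule R) (C : R) n
    (U : qop R n) (xopt : bits n) (popt M delta : R) :
  let p := born (U *m ket R (zeros n)) in
  0 < C -> eqsearch_guarantee sched C -> unitary_op U -> labs_optimal xopt ->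
  (0 < n)%N -> 1 / n%:R <= popt ->
  4 * popt <= mass_below p (@energy n) (energy xopt).+1 ->
  1 / Num.sqrt popt <= M -> 0 < delta < 1 ->
  1 - delta <= Pr (qaoa_qmf sched C U M delta)
    (fun o => if o.1 is Some x then sidelobe x == sidelobe xopt else false).
Proof.
move=> p C0 guarantee uU opt n0 np P_ge xM d01.
set P := mass_below _ _ _ in P_ge.
have n0' : 0 < n%:R :> R by rewrite ltr0n.
have popt0 : 0 < popt by apply: lt_le_trans np; rewrite divr_gt0.
have P0 : 0 < P by apply: lt_le_trans P_ge; rewrite mulr_gt0.
have min_e (x : bits n) : (energy xopt <= energy x)%N.
  by rewrite -lez_nat -!sidelobeE; exact: opt.
have p1 : \sum_x p x = 1 by rewrite unitary_born ?sum_born_ket.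
have P1 : P <= 1.
  rewrite -p1 [leRHS](bigID (fun x => energy x < (energy xopt).+1)%N) /=.
  by rewrite lerDl sumr_ge0 // => x _; exact: born_ge0.
have Q1 : mass_below p (@energy n) (threshold (None : option (bits n))) = 1.
  rewrite -[RHS]p1 /mass_below; apply: eq_bigl => x.
  by rewrite /threshold ltnS leq_bigmax.
set x := 1 / Num.sqrt popt in xM.
have s0 : 0 < Num.sqrt popt by rewrite sqrtr_gt0.
have x0 : 0 < x by rewrite divr_gt0.
have x2 : x ^+ 2 <= n%:R.
  rewrite /x expr_div_n sqr_sqrtr ?(ltW popt0) // expr1n.
  by rewrite ler_pdivrMr // -ler_pdivrMl // mulrC.
(* The symmetric copies give 4 popt <= 1, and 1 / n <= popt: the case n = 3 cannot occur. *)
have n4 : (4 <= n)%N.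
  rewrite -(@ler_nat R); have : 4 * popt <= 1 by lra.
  move: np; rewrite ler_pdivrMr // => np' p4.
  have : 4 * 1 <= 4 * popt * n%:R by rewrite -mulrA ler_pM2l.
  have : 4 * popt * n%:R <= 1 * n%:R by rewrite ler_wpM2r // ltW.
  lra.
(* Here P >= 4 popt turns 2 / sqrt P into at most 1 / sqrt popt = x. *)
have phi_le : potential p (@energy n) (energy xopt)
    (threshold (None : option (bits n))) <= x - 1.
  rewrite /potential Q1 sqrtr1 invr1 leqNgt.
  rewrite (_ : (energy xopt < _)%N); last by rewrite /threshold ltnS leq_bigmax.
  rewrite lerB // /x -/P.
  have : 2 * Num.sqrt popt <= Num.sqrt P.
    have <- : Num.sqrt (4 * popt) = 2 * Num.sqrt popt.
      rewrite (_ : 4 = 2 ^+ 2 :> R); last by ring.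
      by rewrite sqrtrM ?sqr_ge0 // sqrtr_sqr ger0_norm.
    by rewrite ler_wsqrtr.
  have sP : 0 < Num.sqrt P by rewrite sqrtr_gt0.
  by move=> le_s; rewrite ler_pdivrMr // mul1r mulrC ler_pdivlMr.
have M0 : 0 < M := lt_le_trans x0 xM.
set r := nat_ceil (3 * C * M * n%:R).
have rB : 3 * C * M * n%:R <= r%:R := nat_ceil_ge _.
have r0 : (0 < r)%N by rewrite -(ltr_nat R) (lt_le_trans _ rB) // !mulr_gt0.
have := qmf_round_success None C0 guarantee uU min_e P0 (leqnn r) (leqnn r) r0.
rewrite divff ?pnatr_eq0 -?lt0n // -/p.
set d := 1 / (6 * 2 ^+ n); set phi := potential _ _ _ _ in phi_le *.
move=> success.
have x1 : 1 <= x.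
  rewrite /x ler_pdivlMr // mul1r -[leRHS]sqrtr1 ler_wsqrtr //; lra.
have fail : (x - 1) * (C * ln (1 / d) / r%:R + d) <= 5 / 16.
  exact: round_failure C0 n4 x1 xM x2 rB.
have kappa0 : 0 <= C * ln (1 / d) / r%:R + d.
  have d0 : 0 < d by rewrite divr_gt0 // mulr_gt0 // exprn_gt0.
  rewrite addr_ge0 ?(ltW d0) // divr_ge0 ?ler0n // mulr_ge0 ?(ltW C0) // ln_ge0 //.
  rewrite /d invf_div divr1 mul1r.
  have : 1 <= 2 ^+ n :> R by rewrite exprn_ege1 // ler1n.
  lra.
have phi_fail : phi * (C * ln (1 / d) / r%:R + d) <= 5 / 16.
  by apply: le_trans fail; rewrite ler_wpM2r.
have success' : 1 - 5 / 16 <=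
    Ex (qmf_round sched U r None r) (fun o => (hits (energy xopt) o.1)%:R).
  by apply: le_trans success; lra.
have := qmf_rounds_success (C := C) (M := M) (nat_ceil (ln (1 / delta))) uU
  guarantee.1 _ success'.
have -> : 1 - (1 - 5 / 16) = 5 / 16 :> R by ring.
move=> /(_ _)/le_trans h; rewrite Pr_Ex /qaoa_qmf Ex_dbind.
apply: (@le_trans _ _ (1 - (5 / 16) ^+ nat_ceil (ln (1 / delta)))).
  by rewrite lerB // failure_power // ?expRN1_ge //; lra.
apply: h; first by lra.
apply: ler_Ex (nonneg_qmf_rounds _ _ _ _ _) _ => o; rewrite Ex_dret /=.
case: (boolP (has _ _)) => [/(hits_list_min min_e)|_]; last by rewrite ler0n.
by case: (list_min _) => //= y /eqP ye; rewrite !sidelobeE ye eqxx.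
Qed.

(** * Exponentials of diagonal operators *)

Lemma diag_opD (R : realType) n (f g : bits n -> R[i]) :
  diag_op f + diag_op g = diag_op (fun x => f x + g x).
Proof. by apply: op_ext => y x; rewrite entD !ent_diag mulrnDl. Qed.

Lemma diag_opZ (R : realType) n a (f : bits n -> R[i]) :
  a *: diag_op f = diag_op (fun x => a * f x).
Proof. by apply: op_ext => y x; rewrite entZ !ent_diag mulrnAr. Qed.

Lemma diag_op_sum (R : realType) n (I : Type) (r : seq I) (P : pred I)
    (f : I -> bits n -> R[i]) :
  \sum_(i <- r | P i) diag_op (f i) =
  diag_op (fun x => \sum_(i <- r | P i) f i x).
Proof.
apply: op_ext => y x; rewrite ent_sum ent_diag -sumrMnl.
by apply: eq_bigr => i _; rewrite ent_diag.
Qed.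

Lemma diag_op1 (R : realType) n : 1%:M = diag_op (fun=> 1) :> qop R n.
Proof. by apply: op_ext => y x; rewrite ent1 ent_diag. Qed.

Lemma diag_opX (R : realType) n (f : bits n -> R[i]) k :
  diag_op f ^+ k = diag_op (fun x => f x ^+ k).
Proof.
elim: k => [|k IH]; first by rewrite expr0 -diag_op1.
by rewrite exprS IH [LHS]diag_op_mul; congr diag_op; apply: funext => x; rewrite exprS.
Qed.

Definition cis (R : realType) (t : R) : R[i] := cos t +i* sin t.

Lemma cis0 (R : realType) : cis 0 = 1 :> R[i].
Proof. by rewrite /cis cos0 sin0. Qed.

Lemma cis_conj (R : realType) (t : R) : cis t * (cis t)^* = 1.
Proof.
rewrite /cis; simpc; apply/eqP; rewrite eq_complex /=; apply/andP; split; apply/eqP.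
  by rewrite -!expr2 cos2Dsin2.
by ring.
Qed.

Lemma imag_expr (R : realType) (t : R) k :
  (0 +i* t) ^+ k = (if odd k then 0 else (-1) ^+ k./2 * t ^+ k)
     +i* (if odd k then (-1) ^+ k.-1./2 * t ^+ k else 0).
Proof.
elim: k => [|k IH]; first by rewrite !expr0 mulr1.
rewrite exprS IH /= uphalf_half; case: (boolP (odd k)) => ok; simpc => /=.
  congr (_ +i* _); rewrite exprS (_ : k./2 = k.-1./2); last by lia.
  by rewrite add1n exprS; ring.
by congr (_ +i* _); rewrite exprS; ring.
Qed.

Lemma exp_imag_partial (R : realType) (t : R) K :
  \sum_(k < K) (k`!%:R)^-1 * (0 +i* t) ^+ k =
  series (cos_coeff t) K +i* series (sin_coeff t) K.
Proof.
rewrite /series /= !big_mkord.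
elim: K => [|K IH]; first by rewrite !big_ord0.
rewrite !big_ord_recr /= IH imag_expr /cos_coeff /sin_coeff.
have -> : (K`!%:R)^-1 = ((K`!%:R)^-1)%:C :> R[i].
  by rewrite fmorphV rmorph_nat.
simpc; congr (_ +i* _); congr (_ + _); case: ifP => oK.
- by rewrite /= oK mulr0 !mul0r.
- by rewrite /= oK mul1r; exact: mulrC.
- by rewrite /= oK mul1r; exact: mulrC.
- by rewrite /= oK mulr0 !mul0r.
Qed.

(** Componentwise, because [expmx] takes the limits of real and imaginary parts separately. *)
Definition cvgc (R : realType) (u : nat -> R[i]) (l : R[i]) : Prop :=
  ((fun K => complex.Re (u K)) @ \oo --> complex.Re l)%classic /\
  ((fun K => complex.Im (u K)) @ \oo --> complex.Im l)%classic.

Lemma cvgc_cst (R : realType) (a : R[i]) : cvgc (fun=> a) a.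
Proof. by split; exact: cvg_cst. Qed.

Lemma cvgcD (R : realType) (u v : nat -> R[i]) a b :
  cvgc u a -> cvgc v b -> cvgc (fun K => u K + v K) (a + b).
Proof.
move=> [ua ua'] [vb vb']; split.
  rewrite raddfD (_ : (fun K => _) =
    (fun K => complex.Re (u K)) \+ (fun K => complex.Re (v K))).
    exact: cvgD.
  by apply: funext => K; rewrite raddfD.
rewrite raddfD (_ : (fun K => _) =
  (fun K => complex.Im (u K)) \+ (fun K => complex.Im (v K))).
  exact: cvgD.
by apply: funext => K; rewrite raddfD.
Qed.

Lemma ReM (R : realType) (a b : R[i]) :
  complex.Re (a * b) =
  complex.Re a * complex.Re b - complex.Im a * complex.Im b.
Proof. by case: a; case: b. Qed.

Lemma ImM (R : realType) (a b : R[i]) :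
  complex.Im (a * b) =
  complex.Re a * complex.Im b + complex.Im a * complex.Re b.
Proof. by case: a => ? ?; case: b => ? ? /=. Qed.

Lemma cvgcMl (R : realType) (a : R[i]) (u : nat -> R[i]) l :
  cvgc u l -> cvgc (fun K => a * u K) (a * l).
Proof.
move=> [ul ul']; split.
  rewrite ReM (_ : (fun K => _) =
    (fun K => complex.Re a * complex.Re (u K) -
              complex.Im a * complex.Im (u K))).
    by apply: cvgB; apply: cvgM => //; exact: cvg_cst.
  by apply: funext => K; rewrite ReM.
rewrite ImM (_ : (fun K => _) =
  (fun K => complex.Re a * complex.Im (u K) +
            complex.Im a * complex.Re (u K))).
  by apply: cvgD; apply: cvgM => //; exact: cvg_cst.
by apply: funext => K; rewrite ImM.
Qed.

Lemma cvgc_sum (R : realType) (I : Type) (r : seq I) (u : I -> nat -> R[i]) l :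
  (forall i, cvgc (u i) (l i)) ->
  cvgc (fun K => \sum_(i <- r) u i K) (\sum_(i <- r) l i).
Proof.
move=> ul; elim: r => [|i r IH].
  rewrite big_nil (_ : (fun K => _) = fun=> 0); first exact: cvgc_cst.
  by apply: funext => K; rewrite big_nil.
rewrite big_cons (_ : (fun K => _) = fun K => u i K + \sum_(j <- r) u j K).
  exact: cvgcD.
by apply: funext => K; rewrite big_cons.
Qed.

Lemma expmx_lim (R : realType) n (A L : qop R n) :
  (forall y x, cvgc (fun K => ent (expmx_partial A K) y x) (ent L y x)) ->
  expmx A = L.
Proof.
move=> AL; apply: op_ext => y x; have [ReL ImL] := AL y x.
rewrite /ent mxE; apply/eqP; rewrite eq_complex /=.
apply/andP; split; apply/eqP.
  by apply: cvg_lim ReL; exact: norm_hausdorff.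
by apply: cvg_lim ImL; exact: norm_hausdorff.
Qed.

Lemma expmx_partial_diag (R : realType) n (t : bits n -> R) K :
  expmx_partial (diag_op (fun x => 0 +i* t x)) K =
  diag_op (fun x => series (cos_coeff (t x)) K +i* series (sin_coeff (t x)) K).
Proof.
rewrite /expmx_partial; under eq_bigr => k _ do rewrite diag_opX diag_opZ.
rewrite diag_op_sum; congr diag_op; apply: funext => x.
exact: exp_imag_partial.
Qed.

Lemma expmx_partial_diag_cvg (R : realType) n (t : bits n -> R) y x :
  cvgc (fun K => ent (expmx_partial (diag_op (fun x => 0 +i* t x)) K) y x)
       (ent (diag_op (fun x => cis (t x))) y x).
Proof.
rewrite ent_diag (_ : (fun K => _) = fun K =>
  (series (cos_coeff (t x)) K +i* series (sin_coeff (t x)) K) *+ (y == x)).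
  case: (y == x); last exact: cvgc_cst.
  by split; rewrite /= unlock;
    [exact: is_cvg_series_cos_coeff|exact: is_cvg_series_sin_coeff].
by apply: funext => K; rewrite expmx_partial_diag ent_diag.
Qed.

Lemma expmx_diag (R : realType) n (t : bits n -> R) :
  expmx (diag_op (fun x => 0 +i* t x)) = diag_op (fun x => cis (t x)).
Proof. by apply: expmx_lim => y x; exact: expmx_partial_diag_cvg. Qed.

(** Conjugation by an involution passes through every partial sum. Convergence is assumed
    explicitly, since a value of [limn] alone does not imply it. *)
Lemma expmx_conj (R : realType) n (W A L : qop R n) :
  W *m W = 1%:M ->
  (forall y x, cvgc (fun K => ent (expmx_partial A K) y x) (ent L y x)) ->
  expmx (W *m A *m W) = W *m L *m W.
Proof.
move=> WW AL; apply: expmx_lim => y x.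
have partialE K : expmx_partial (W *m A *m W) K = W *m expmx_partial A K *m W.
  rewrite /expmx_partial mulmx_sumr mulmx_suml; apply: eq_bigr => k _.
  rewrite -scalemxAr -scalemxAl; congr (_ *: _).
  elim: (nat_of_ord k) => [|j IH]; first by rewrite !expr0 mulmx1 WW.
  rewrite !exprS IH -!mulmxE -!mulmxA; congr (W *m (A *m _)).
  by rewrite mulmxA WW mul1mx.
rewrite ent_mul (_ : (fun K => _) = fun K => \sum_z ent W z x *
    \sum_w ent W y w * ent (expmx_partial A K) w z).
  under eq_bigr => z _ do rewrite ent_mul mulrC.
  by apply: cvgc_sum => z; apply/cvgcMl/cvgc_sum => w; exact: cvgcMl.
apply: funext => K; rewrite partialE ent_mul; apply: eq_bigr => z _.
by rewrite ent_mul mulrC.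
Qed.

(** * Hadamard transform and the QAOA circuit *)

Definition rsqrt2 (R : realType) : R[i] := ((Num.sqrt 2)^-1)%:C.

Lemma rsqrt2_sqr (R : realType) : rsqrt2 R * rsqrt2 R = 2^-1.
Proof.
rewrite /rsqrt2 -rmorphM /= -invfM -expr2 sqr_sqrtr //.
by rewrite fmorphV rmorph_nat.
Qed.

Definition hadamards (R : realType) n : qop R n := \prod_(j < n) gate_op (Had R j).

(** The character (-1)^(y.x), kernel of the Walsh-Hadamard transform. *)
Definition sign_dot (R : realType) n (y x : bits n) : R[i] :=
  \prod_j (-1) ^+ (tnth y j && tnth x j).

Arguments gate_op : simpl never.

Lemma ent_had (R : realType) n (j : 'I_n) y x :
  ent (gate_op (Had R j)) y x =
  if [forall k, (k != j) ==> (tnth y k == tnth x k)]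
  then rsqrt2 R * (-1) ^+ (tnth y j && tnth x j) else 0.
Proof. exact: ent_op_of. Qed.

Lemma ent_prod_had (R : realType) n (s : seq 'I_n) y x : uniq s ->
  ent (\prod_(j <- s) gate_op (Had R j) : qop R n) y x =
  if [forall k, (k \notin s) ==> (tnth y k == tnth x k)]
  then rsqrt2 R ^+ size s * \prod_(j <- s) (-1) ^+ (tnth y j && tnth x j)
  else 0.
Proof.
elim: s y => [|j s IH] y /=.
  rewrite !big_nil mul1r => _; rewrite ent1.
  suff -> : (y == x) = [forall k, (k \notin [::]) ==> (tnth y k == tnth x k)].
    by case: ifP.
  apply/eqP/forallP => [-> k|yx]; first by rewrite eqxx implybT.
  by apply: eq_from_tnth => k; apply/eqP; exact: yx.
case/andP=> js us; rewrite !big_cons -[_ * _]/(_ *m _) ent_mul.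
(* The only intermediate string that can contribute: the first factor fixes it off [j], the second
   at [j]. *)
pose z0 : bits n := [tuple if i == j then tnth x j else tnth y i | i < n].
rewrite (bigD1 z0) //= [X in _ + X = _]big1 => [|z zz0]; last first.
  rewrite ent_had IH //; case: ifP => [/forallP yz|_]; last by rewrite mul0r.
  case: ifP => [/forallP zx|_]; last by rewrite mulr0.
  case/eqP: zz0; apply: eq_from_tnth => k; rewrite tnth_mktuple.
  case: eqP => [->|/eqP kj]; first by move: (zx j); rewrite js => /eqP.
  by move: (yz k); rewrite kj => /eqP.
rewrite addr0 ent_had IH // tnth_mktuple eqxx.
have -> : [forall k, (k != j) ==> (tnth y k == tnth z0 k)].
  by apply/forallP => k; rewrite tnth_mktuple; case: (k == j) => //=.
have -> : [forall k, (k \notin s) ==> (tnth z0 k == tnth x k)] =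
    [forall k, (k \notin j :: s) ==> (tnth y k == tnth x k)].
  apply: eq_forallb => k; rewrite tnth_mktuple in_cons negb_or.
  by case: (eqVneq k j) => [->|] //=; rewrite eqxx implybT.
case: ifP => _; last by rewrite mulr0.
rewrite (eq_big_seq (fun i => (-1) ^+ (tnth y i && tnth x i))) => [|i si].
  by rewrite exprS; ring.
rewrite tnth_mktuple; case: eqP => // ij; move: js.
by rewrite -ij si.
Qed.

Lemma ent_hadamards (R : realType) n y x :
  ent (hadamards R n) y x = rsqrt2 R ^+ n * sign_dot R y x.
Proof.
have sz : size (index_enum 'I_n) = n by rewrite /index_enum -enumT size_enum_ord.
rewrite /hadamards ent_prod_had ?index_enum_uniq // sz ifT //.
by apply/forallP => k; rewrite mem_index_enum.
Qed.

Lemma sign_dotC (R : realType) n (y x : bits n) :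
  sign_dot R y x = sign_dot R x y.
Proof. by apply: eq_bigr => j _; rewrite andbC. Qed.

Lemma tnth_flip n k (x : bits n) (i : 'I_n) :
  tnth (flip k x) i = tnth x i (+) (val i == k).
Proof. by rewrite tnth_mktuple. Qed.

Lemma flipK n k : involutive (@flip n k).
Proof.
by move=> x; apply: eq_from_tnth => i; rewrite !tnth_flip addbK.
Qed.

Lemma sign_dot_flip (R : realType) n (y x : bits n) (k : 'I_n) :
  sign_dot R (flip k y) x = (-1) ^+ tnth x k * sign_dot R y x.
Proof.
rewrite /sign_dot (bigD1 k) //= [X in _ = _ * X](bigD1 k) //= [RHS]mulrA; congr (_ * _).
  by rewrite tnth_flip eqxx -signr_addb; case: (tnth y k); case: (tnth x k).
by apply: eq_bigr => i ik; rewrite tnth_flip (negPf (_ : val i != k)) ?addbF.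
Qed.

Lemma hadamardsK (R : realType) n : hadamards R n *m hadamards R n = 1%:M.
Proof.
apply: op_ext => y x; rewrite ent_mul ent1.
under eq_bigr => z _ do rewrite !ent_hadamards mulrACA -exprMn rsqrt2_sqr.
rewrite -mulr_sumr; case: eqP => [->|/eqP yx].
  rewrite (eq_bigr (fun=> 1)) => [|z _].
    by rewrite big_const iter_addr_0 card_tuple card_bool natrX exprVn mulVf.
  rewrite [sign_dot R z x]sign_dotC /sign_dot -big_split big1 // => j _.
  by rewrite /= -signr_addb addbb.
have [k yxk] : exists k, tnth y k != tnth x k.
  apply/existsP; apply: contraR yx => /existsPn yx; apply/eqP.
  by apply: eq_from_tnth => k; apply/eqP; rewrite -[_ == _]negbK yx.
(* Orthogonality of characters: flipping the bit [k] of [z], where [y] and [x] differ, negates each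
   summand. *)
set S := \sum_z _; suff : S = - S.
  move/eqP; rewrite -addr_eq0 -mulr2n mulrn_eq0 /= => /eqP ->.
  by rewrite mulr0.
rewrite {1}/S (reindex_inj (inv_inj (@flipK n k))) /= -sumrN.
apply: eq_bigr => z _; rewrite [sign_dot R y _]sign_dotC !sign_dot_flip.
rewrite [sign_dot R z y]sign_dotC mulrACA -signr_addb.
by move: yxk; case: (tnth y k); case: (tnth x k) => //= _; rewrite expr1 mulN1r.
Qed.

Lemma rsqrt2_conj (R : realType) k : (rsqrt2 R ^+ k)^* = rsqrt2 R ^+ k.
Proof. by rewrite rmorphXn; congr (_ ^+ _); exact: conjc_real. Qed.

Lemma sign_conj (R : realType) (b : bool) : ((-1) ^+ b : R[i])^* = (-1) ^+ b.
Proof. by rewrite rmorphXn rmorphN rmorph1. Qed.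

Lemma unitary_hadamards (R : realType) n : unitary_op (hadamards R n).
Proof.
rewrite /unitary_op (_ : adj _ = hadamards R n) ?hadamardsK //.
apply: op_ext => y x; rewrite ent_adj !ent_hadamards rmorphM /= rsqrt2_conj.
rewrite sign_dotC; congr (_ * _); rewrite /sign_dot rmorph_prod.
by apply: eq_bigr => j _; exact: sign_conj.
Qed.

Lemma ent_mul_map (R : realType) n (A : qop R n) (f : bits n -> bits n) y x :
  ent (A *m map_op R f) y x = ent A y (f x).
Proof. by rewrite -!amp_mul_ket -mulmxA map_op_ket. Qed.

Lemma ent_diag_mul (R : realType) n (A : qop R n) g y x :
  ent (diag_op g *m A) y x = g y * ent A y x.
Proof. by rewrite -!amp_mul_ket -mulmxA amp_diag. Qed.

(** Eigenvalue of the mixer on the Hadamard transform of the basis state [x]. *)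
Definition mixer_energy n (x : bits n) : int :=
  \sum_(1 <= j < n.+1) (-1) ^+ nth false x j.-1.

(** Hadamard gates exchange Pauli X and Pauli Z. *)
Lemma mixerE (R : realType) n :
  mixer R n = hadamards R n *m diag_op (fun x => (mixer_energy x)%:~R)
                *m hadamards R n.
Proof.
suff : hadamards R n *m mixer R n =
    diag_op (fun x => (mixer_energy x)%:~R) *m hadamards R n.
  move=> HX; rewrite -[LHS]mul1mx -hadamardsK -mulmxA HX.
  by rewrite mulmxA.
apply: op_ext => y x; rewrite ent_diag_mul /mixer mulmx_sumr ent_sum.
rewrite /mixer_energy rmorph_sum mulr_suml big_nat [RHS]big_nat.
apply: eq_bigr => j jn; rewrite /pauliX ent_mul_map !ent_hadamards.
have lt_j : (j.-1 < n)%N by lia.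
rewrite sign_dotC -[j.-1]/(val (Ordinal lt_j)) sign_dot_flip sign_dotC.
by rewrite rmorph_sign (tnth_nth false) /=; ring.
Qed.

Lemma expmx_mixer (R : realType) n (beta : R) :
  expmx ((0 -i* beta) *: mixer R n) =
  hadamards R n *m diag_op (fun x => cis (- beta * (mixer_energy x)%:~R))
    *m hadamards R n.
Proof.
rewrite mixerE scalemxAl scalemxAr diag_opZ.
rewrite (_ : (fun x => _) =
    fun x : bits n => 0 +i* (- beta * (mixer_energy x)%:~R)).
  by apply: expmx_conj (hadamardsK _ _) _; exact: expmx_partial_diag_cvg.
apply: funext => x.
have -> : (mixer_energy x)%:~R = ((mixer_energy x)%:~R)%:C :> R[i].
  by rewrite rmorph_int.
by simpc.
Qed.

Definition labs_energy n (x : bits n) : int :=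
  2 * (\sum_(1 <= i < (n - 3).+1)
         spin x i * \sum_(1 <= t < ((n - i - 1) %/ 2).+1)
                      \sum_(t.+1 <= k < (n - i - t).+1)
                        spin x (i + t) * spin x (i + k) * spin x (i + k + t))
  + \sum_(1 <= i < (n - 2).+1)
      spin x i * \sum_(1 <= k < ((n - i) %/ 2).+1) spin x (i + 2 * k).

Lemma pauliZE (R : realType) n j :
  pauliZ R n j = diag_op (fun x => (spin x j)%:~R).
Proof. by congr diag_op; apply: funext => x; rewrite rmorph_sign. Qed.

Definition diagonal_of (R : realType) n (A : qop R n) (f : bits n -> int) :
  Prop := A = diag_op (fun x => (f x)%:~R).

Lemma diagonal_ofD (R : realType) n (A B : qop R n) f g :
  diagonal_of A f -> diagonal_of B g ->
  diagonal_of (A + B) (fun x => f x + g x).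
Proof.
move=> -> ->; rewrite /diagonal_of diag_opD; congr diag_op.
by apply: funext => x; rewrite rmorphD.
Qed.

Lemma diagonal_ofM (R : realType) n (A B : qop R n) f g :
  diagonal_of A f -> diagonal_of B g ->
  diagonal_of (A * B) (fun x => f x * g x).
Proof.
move=> -> ->; rewrite /diagonal_of -[_ * _]/(_ *m _) diag_op_mul.
by congr diag_op; apply: funext => x; rewrite rmorphM.
Qed.

Lemma diagonal_of_sum (R : realType) n (I : Type) (r : seq I)
    (A : I -> qop R n) f :
  (forall i, diagonal_of (A i) (f i)) ->
  diagonal_of (\sum_(i <- r) A i) (fun x => \sum_(i <- r) f i x).
Proof.
move=> Af; rewrite /diagonal_of; under eq_bigr => i _ do rewrite Af.
rewrite diag_op_sum; congr diag_op; apply: funext => x.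
by rewrite rmorph_sum.
Qed.

Lemma labs_hamiltonianE (R : realType) n :
  labs_hamiltonian R n = diag_op (fun x => (labs_energy x)%:~R).
Proof.
have Z j : diagonal_of (pauliZ R n j) (fun x => spin x j) by exact: pauliZE.
apply: diagonal_ofD.
  have two B f : diagonal_of B f ->
      diagonal_of (2%:R *: B : qop R n) (fun x => 2 * f x).
    move=> ->; rewrite /diagonal_of diag_opZ; congr diag_op.
    by apply: funext => x; rewrite rmorphM.
  apply/two/diagonal_of_sum => i; apply: diagonal_ofM => //.
  apply: diagonal_of_sum => t; apply: diagonal_of_sum => k.
  by do 2 apply: diagonal_ofM => //.
apply: diagonal_of_sum => i; apply: diagonal_ofM => //.
exact: diagonal_of_sum.
Qed.

Lemma expmx_labs (R : realType) n (gamma : R) :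
  expmx ((0 -i* gamma) *: labs_hamiltonian R n) =
  diag_op (fun x => cis (- gamma * (labs_energy x)%:~R)).
Proof.
rewrite labs_hamiltonianE diag_opZ -expmx_diag; congr expmx.
congr diag_op; apply: funext => x.
have -> : (labs_energy x)%:~R = ((labs_energy x)%:~R)%:C :> R[i].
  by rewrite rmorph_int.
by simpc.
Qed.

Lemma qaoa_layerE (R : realType) n (beta gamma : R) :
  qaoa_layer n beta gamma =
  hadamards R n *m diag_op (fun x => cis (- beta * (mixer_energy x)%:~R))
    *m hadamards R n
    *m diag_op (fun x => cis (- gamma * (labs_energy x)%:~R)).
Proof. by rewrite /qaoa_layer expmx_mixer expmx_labs. Qed.

Lemma unitary_qaoa (R : realType) n l (beta gamma : 'I_l -> R) :
  unitary_op (qaoa n beta gamma).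
Proof.
rewrite /qaoa -/(hadamards R n); have := unitary_hadamards R n.
elim: (enum 'I_l) (hadamards R n) => //= i s IH A uA; apply: IH.
apply: unitaryM uA; rewrite qaoa_layerE.
have cis_unitary (t : bits n -> R) : unitary_op (diag_op (fun x => cis (t x))).
  by apply: unitary_diag => x; exact: cis_conj.
by do !apply: unitaryM => //; exact: unitary_hadamards.
Qed.

(** * Spin symmetries *)

(* Global spin flip ([b.1]) and sign alternation ([b.2]). *)
Definition mask n (b : bool * bool) (x : bits n) : bits n :=
  [tuple tnth x i (+) (b.1 (+) (b.2 && odd i)) | i < n].

Lemma maskK n b : involutive (@mask n b).
Proof. by move=> x; apply: eq_from_tnth => i; rewrite !tnth_mktuple addbK. Qed.

Lemma mask_inj n b : injective (@mask n b).
Proof. exact: inv_inj (@maskK n b). Qed.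

Lemma mask_flip n b k (x : bits n) : mask b (flip k x) = flip k (mask b x).
Proof.
apply: eq_from_tnth => i; rewrite !tnth_mktuple.
by rewrite addbAC.
Qed.

Lemma nth_mask n b (x : bits n) k : (k < n)%N ->
  nth false (mask b x) k = nth false x k (+) (b.1 (+) (b.2 && odd k)).
Proof.
by move=> lt_k; rewrite -[k]/(val (Ordinal lt_k)) -!tnth_nth tnth_mktuple.
Qed.

Lemma spin_mask n b (x : bits n) j : (0 < j <= n)%N ->
  spin (mask b x) j = (-1) ^+ (b.1 (+) (b.2 && odd j.-1)) * spin x j.
Proof.
move=> jn; rewrite /spin nth_mask; last by lia.
by rewrite signr_addb mulrC.
Qed.

Lemma signMM (b : bool) (x y : int) :
  (-1) ^+ b * x * ((-1) ^+ b * y) = x * y.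
Proof. by rewrite mulrACA -signr_addb addbb mul1r. Qed.

(** The global sign occurs twice in each product, and the alternating signs at distance k combine to
    (-1)^k, whatever the position. *)
Lemma autocorr_mask n b (x : bits n) k :
  autocorr (mask b x) k = (-1) ^+ (b.2 && odd k) * autocorr x k.
Proof.
rewrite /autocorr mulr_sumr big_nat [RHS]big_nat; apply: eq_bigr => i ik.
rewrite !spin_mask; [|lia|lia].
rewrite mulrACA -signr_addb; congr (_ ^+ _ * _); congr nat_of_bool.
have -> : odd (i + k).-1 = odd i.-1 (+) odd k.
  by rewrite -oddD; congr odd; lia.
by case: (b.1); case: (b.2); case: (odd i.-1); case: (odd k).
Qed.

Lemma sidelobe_mask n b (x : bits n) : sidelobe (mask b x) = sidelobe x.
Proof.
apply: eq_bigr => k _.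
by rewrite autocorr_mask exprMn sqrr_sign mul1r.
Qed.

(** Monomials have even degree, and their positions i, i+t, i+k, i+k+t or i, i+2k include an even
    number of odd ones, so all signs cancel. *)
Lemma labs_energy_mask n b (x : bits n) :
  labs_energy (mask b x) = labs_energy x.
Proof.
rewrite /labs_energy; congr (2 * _ + _).
  rewrite big_nat [RHS]big_nat; apply: eq_bigr => i hi.
  rewrite !mulr_sumr big_nat [RHS]big_nat; apply: eq_bigr => t ht.
  rewrite !mulr_sumr big_nat [RHS]big_nat; apply: eq_bigr => k hk.
  have it : (t <= (n - i - 1) %/ 2)%N by lia.
  have it2 : (t * 2 <= n - i - 1)%N.
    by rewrite (leq_trans _ (leq_divM _ 2)) // leq_mul2r it orbT.
  rewrite !spin_mask; [|lia|lia|lia|lia].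
  rewrite -(signMM (b.1 (+) (b.2 && odd i.-1)) (spin x i)) [RHS]mulrAC.
  set s1 := spin x i; set s2 := spin x _; set s3 := spin x _; set s4 := spin x _.
  have -> : odd (i + t).-1 = odd i.-1 (+) odd t by rewrite -oddD; congr odd; lia.
  have -> : odd (i + k).-1 = odd i.-1 (+) odd k by rewrite -oddD; congr odd; lia.
  have -> : odd (i + k + t).-1 = odd i.-1 (+) odd k (+) odd t.
    by rewrite -!oddD; congr odd; lia.
  case: (b.1); case: (b.2); case: (odd i.-1); case: (odd k); case: (odd t);
    rewrite /=; ring.
rewrite big_nat [RHS]big_nat; apply: eq_bigr => i hi.
rewrite !mulr_sumr big_nat [RHS]big_nat; apply: eq_bigr => k hk.
have ik : (k * 2 <= n - i)%N.
  by rewrite (leq_trans _ (leq_divM _ 2)) // leq_mul2r; lia.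
rewrite !spin_mask; [|lia|lia].
have -> : odd (i + 2 * k).-1 = odd i.-1.
  by rewrite (_ : (i + 2 * k).-1 = i.-1 + k.*2)%N ?oddD ?odd_double ?addbF //; lia.
exact: signMM.
Qed.

(** For bijective [s]: commutation with the permutation operator of [s]. *)
Definition invariant_op (R : realType) n (s : bits n -> bits n) (A : qop R n) :
  Prop := forall y x, ent A (s y) (s x) = ent A y x.

Lemma invariant_mul (R : realType) n (s : bits n -> bits n) (A B : qop R n) :
  injective s -> invariant_op s A -> invariant_op s B ->
  invariant_op s (A *m B).
Proof.
move=> s_inj sA sB y x; rewrite !ent_mul (reindex_inj s_inj).
by apply: eq_bigr => z _; rewrite sA sB.
Qed.

(** The two sequences of partial sums are equal, so [limn] agrees on them. *)
Lemma invariant_expmx (R : realType) n (s : bits n -> bits n) (A : qop R n) :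
  injective s -> invariant_op s A -> invariant_op s (expmx A).
Proof.
move=> s_inj sA y x; rewrite /ent !mxE.
suff partialE K : expmx_partial A K (enum_rank (s y)) (enum_rank (s x)) =
    expmx_partial A K (enum_rank y) (enum_rank x).
  by congr (limn _ +i* limn _); apply: funext => K; rewrite partialE.
rewrite -!/(ent _ _ _) /expmx_partial !ent_sum; apply: eq_bigr => k _.
rewrite !entZ; congr (_ * _).
suff : invariant_op s (A ^+ k) by apply.
elim: (nat_of_ord k) => [|j IH] {y x}; last first.
  by rewrite exprS; exact: invariant_mul.
by rewrite expr0 => y x; rewrite !ent1 (inj_eq s_inj).
Qed.

Lemma invariant_scale (R : realType) n (s : bits n -> bits n) a (A : qop R n) :
  invariant_op s A -> invariant_op s (a *: A).
Proof. by move=> sA y x; rewrite !entZ sA. Qed.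

Lemma invariant_qaoa_layer (R : realType) n b (beta gamma : R) :
  invariant_op (@mask n b) (qaoa_layer n beta gamma).
Proof.
apply: invariant_mul (@mask_inj n b) _ _.
  apply/invariant_expmx/invariant_scale => [|y x]; first exact: mask_inj.
  rewrite /mixer !ent_sum; apply: eq_bigr => j _.
  by rewrite !ent_op_of -mask_flip (inj_eq (@mask_inj n b)).
apply/invariant_expmx/invariant_scale => [|y x]; first exact: mask_inj.
by rewrite labs_hamiltonianE !ent_diag labs_energy_mask (inj_eq (@mask_inj n b)).
Qed.

Lemma qaoa_amp_mask (R : realType) n b l (beta gamma : 'I_l -> R) x :
  amp (qaoa n beta gamma *m ket R (zeros n)) (mask b x) =
  amp (qaoa n beta gamma *m ket R (zeros n)) x.
Proof.
rewrite /qaoa -/(hadamards R n).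
have : forall x, amp (hadamards R n *m ket R (zeros n)) (mask b x) =
    amp (hadamards R n *m ket R (zeros n)) x.
  move=> {}x; rewrite !amp_mul_ket !ent_hadamards; congr (_ * _).
  apply: eq_bigr => j _.
  by rewrite (_ : tnth (zeros n) j = false) ?andbF // tnth_nseq.
elim: (enum 'I_l) (hadamards R n) x => //= i s IH A x Ab; apply: IH => {}x.
rewrite -mulmxA !amp_mul (reindex_inj (@mask_inj n b)); apply: eq_bigr => z _.
by rewrite invariant_qaoa_layer Ab.
Qed.

(** The first two bits already tell the four masks apart. *)
Lemma mask_injl n (x : bits n) : (2 <= n)%N -> injective (fun b => mask b x).
Proof.
move=> n2 [b1 b2] [c1 c2] /(congr1 (fun y : bits n => nth false y)) xE.
have e0 := congr1 (fun f => f 0%N) xE; have e1 := congr1 (fun f => f 1%N) xE.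
move: e0 e1 {xE}; rewrite !nth_mask // ?(ltnW n2) //=.
case: (nth _ _ 0); case: (nth _ _ 1); case: b1; case: b2; case: c1; case: c2 => //.
Qed.

(* The four masked copies of an optimal string are optimal and equally
   likely. *)
Lemma optimal_mass (R : realType) n l (beta gamma : 'I_l -> R) (xopt : bits n)
    (popt : R) :
  (2 <= n)%N -> 0 <= popt ->
  (Num.sqrt popt)%:C <= `|amp (qaoa n beta gamma *m ket R (zeros n)) xopt| ->
  4 * popt <= mass_below (born (qaoa n beta gamma *m ket R (zeros n)))
                (@energy n) (energy xopt).+1.
Proof.
set psi := _ *m _ => n2 p0 le_amp.
have le_born : popt <= born psi xopt.
  rewrite -lecR /born normc_def -rmorphXn /=.
  move: le_amp; rewrite normc_def lecR => le_amp.
  rewrite lecR sqr_sqrtr ?addr_ge0 ?sqr_ge0 //.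
  rewrite -[popt]sqr_sqrtr // -[leRHS]sqr_sqrtr ?addr_ge0 ?sqr_ge0 //.
  by apply: lerXn2r; rewrite ?nnegrE ?sqrtr_ge0.
rewrite /mass_below (bigID (mem [set mask b xopt | b in [set: bool * bool]])) /=.
apply: (@le_trans _ _ (\sum_(x in [set mask b xopt | b in [set: bool * bool]])
    born psi x)); last first.
  rewrite [X in _ <= X + _](eq_bigl
    (fun x => x \in [set mask b xopt | b in [set: bool * bool]])).
    by rewrite lerDl sumr_ge0 // => x _; exact: born_ge0.
  move=> x; case: imsetP => [[b _ ->]|_]; last by rewrite andbF.
  by rewrite /energy sidelobe_mask ltnS leqnn.
rewrite big_imset /=; last by move=> b c _ _; exact: mask_injl.
rewrite (eq_bigr (fun=> born psi xopt)) => [|b _]; last first.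
  by rewrite /born qaoa_amp_mask.
rewrite sumr_const cardsT card_prod card_bool -[leRHS]mulr_natl.
by rewrite -[(_ * _)%:R]/(4 : R) ler_pM2l.
Qed.

(** * Circuits with ancillas *)

Lemma circuit_op_foldl (R : realType) n (c : seq (gate R n)) (v : qstate R n) :
  circuit_op c *m v = foldl (fun w g => gate_op g *m w) v c.
Proof.
rewrite /circuit_op -[in RHS](mul1mx v).
by elim: c (1%:M) => //= g c IH A; rewrite IH mulmxA.
Qed.

Lemma circuit_op_cat (R : realType) n (c d : seq (gate R n)) :
  circuit_op (c ++ d) = circuit_op d *m circuit_op c.
Proof.
have E e (A : qop R n) :
    foldl (fun A g => gate_op g *m A) A e = circuit_op e *m A.
  rewrite /circuit_op -{1}[A]mul1mx.
  by elim: e (1%:M) => //= g e IH B; rewrite mulmxA IH.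
by rewrite /circuit_op foldl_cat E.
Qed.

Lemma circuit_op1 (R : realType) n (g : gate R n) :
  circuit_op [:: g] = gate_op g.
Proof. exact: mulmx1. Qed.

Lemma circuit_op_nil (R : realType) n : circuit_op ([::] : seq (gate R n)) = 1%:M.
Proof. by []. Qed.

(** [gate_complexity_le] with ancilla count and circuit exposed, so that circuits on the same wires
    can be composed. *)
Definition implements (R : realType) n a (A : qop R n)
    (c : seq (gate R (n + a))) : Prop :=
  all (@gate_wf R (n + a)) c /\
  forall x : bits n,
    circuit_op c *m ket R (cat_tuple x (zeros a)) =
    \sum_(y : bits n) amp (A *m ket R x) y *: ket R (cat_tuple y (zeros a)).

Lemma implements_complexity (R : realType) n a (A : qop R n)
    (c : seq (gate R (n + a))) g :
  implements A c -> (size c <= g)%N -> gate_complexity_le A g.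
Proof. by case=> wf_c cE le_g; exists a, c. Qed.

Lemma implements1 (R : realType) n a :
  implements (1%:M : qop R n) ([::] : seq (gate R (n + a))).
Proof.
split=> // x; rewrite circuit_op_nil !mul1mx (bigD1 x) //= big1 => [|y yx].
  by rewrite amp_ket eqxx scale1r addr0.
by rewrite amp_ket (negPf yx) scale0r.
Qed.

(** The first circuit returns its ancillas clean, and the second reuses them. *)
Lemma implements_mul (R : realType) n a (A B : qop R n)
    (c d : seq (gate R (n + a))) :
  implements A c -> implements B d -> implements (B *m A) (c ++ d).
Proof.
move=> [wc cE] [wd dE]; split=> [|x]; first by rewrite all_cat wc wd.
rewrite circuit_op_cat -mulmxA cE mulmx_sumr.
under eq_bigr => y _ do rewrite -scalemxAr dE scaler_sumr.
rewrite exchange_big /=; apply: eq_bigr => z _.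
under eq_bigr => y _ do rewrite scalerA.
rewrite -scaler_suml -mulmxA amp_mul; congr (_ *: _); apply: eq_bigr => y _.
by rewrite [amp (B *m _) z]amp_mul_ket mulrC.
Qed.

Lemma implements_diag (R : realType) n a (f : bits n -> R[i])
    (c : seq (gate R (n + a))) :
  all (@gate_wf R (n + a)) c ->
  (forall x, circuit_op c *m ket R (cat_tuple x (zeros a)) =
             f x *: ket R (cat_tuple x (zeros a))) ->
  implements (diag_op f) c.
Proof.
move=> wc cE; split=> // x; rewrite cE (bigD1 x) //= big1 => [|y yx].
  by rewrite amp_diag amp_ket eqxx mulr1 addr0.
by rewrite amp_diag amp_ket (negPf yx) mulr0 scale0r.
Qed.

Lemma implements_map (R : realType) n a (f : bits n -> bits n)
    (c : seq (gate R (n + a))) :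
  all (@gate_wf R (n + a)) c ->
  (forall x, circuit_op c *m ket R (cat_tuple x (zeros a)) =
             ket R (cat_tuple (f x) (zeros a))) ->
  implements (map_op R f) c.
Proof.
move=> wc cE; split=> // x; rewrite cE map_op_ket (bigD1 (f x)) //= big1.
  by rewrite amp_ket eqxx scale1r addr0.
by move=> y yx; rewrite amp_ket (negPf yx) scale0r.
Qed.

Lemma cat_tupleP n a (w : bits (n + a)) :
  exists y z, w = cat_tuple y z :> bits (n + a).
Proof.
exists [tuple tnth w (lshift a i) | i < n], [tuple tnth w (rshift n i) | i < a].
apply: eq_from_tnth => k; case: (split_ordP k) => j ->.
  by rewrite tnth_lshift tnth_mktuple.
by rewrite tnth_rshift tnth_mktuple.
Qed.

Lemma cat_tuple_eq n a (y y' : bits n) (z z' : bits a) :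
  (cat_tuple y z == cat_tuple y' z' :> bits (n + a)) = (y == y') && (z == z').
Proof. by rewrite -val_eqE /= eqseq_cat ?size_tuple. Qed.

Lemma implements_had (R : realType) n a (j : 'I_n) :
  implements (gate_op (Had R j)) [:: Had R (lshift a j)].
Proof.
split=> // x; rewrite circuit_op1; apply: state_ext => w.
have [y [z ->]] := cat_tupleP w.
rewrite amp_mul_ket ent_had amp_sum !tnth_lshift.
under eq_bigr => u _ do rewrite ampZ amp_ket cat_tuple_eq amp_mul_ket ent_had.
rewrite (bigD1 y) //= [X in _ = _ + X]big1 => [|u uy]; last first.
  by rewrite eq_sym (negPf uy) mulr0.
rewrite eqxx addr0 /=.
have -> : [forall k, (k != lshift a j) ==>
      (tnth (cat_tuple y z) k == tnth (cat_tuple x (zeros a)) k)] =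
    [forall k, (k != j) ==> (tnth y k == tnth x k)] && (z == zeros a).
  apply/forallP/andP => [all_eq|[/forallP yx /eqP ->] k]; last first.
    case: (split_ordP k) => i ->; last by rewrite !tnth_rshift eqxx implybT.
    by rewrite !tnth_lshift (inj_eq (@lshift_inj _ _)).
  split.
    apply/forallP => k; have := all_eq (lshift a k).
    by rewrite !tnth_lshift (inj_eq (@lshift_inj _ _)).
  apply/eqP/eq_from_tnth => i; have := all_eq (rshift n i).
  by rewrite !tnth_rshift eq_rlshift => /eqP.
case: ifP => [/andP[-> ->]|]; first by rewrite mulr1.
by case: ifP => [_ /= ->|]; rewrite ?mul0r ?mulr0.
Qed.

Lemma implements_hadamards (R : realType) n a :
  exists c : seq (gate R (n + a)),
    implements (hadamards R n) c /\ (size c <= n)%N.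
Proof.
rewrite /hadamards.
have sz : size (index_enum 'I_n) = n by rewrite /index_enum -enumT size_enum_ord.
suff : exists c : seq (gate R (n + a)),
    implements (\prod_(j < n) gate_op (Had R j)) c /\
    (size c <= size (index_enum 'I_n))%N by rewrite sz.
elim: (index_enum 'I_n) => [|j s [c [cE le_c]]].
  by exists [::]; rewrite big_nil; split; first exact: implements1.
exists (c ++ [:: Had R (lshift a j)]); rewrite big_cons; split.
  exact: implements_mul cE (implements_had _ _ _).
by rewrite size_cat addn1.
Qed.

Lemma had_ket (R : realType) n (j : 'I_n) (x : bits n) :
  gate_op (Had R j) *m ket R x =
  rsqrt2 R *: ((-1) ^+ tnth x j *: ket R x + ket R (flip j x)).
Proof.
apply: state_ext => y; rewrite amp_mul_ket ent_had ampZ ampD ampZ !amp_ket.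
have off_j : [forall k, (k != j) ==> (tnth y k == tnth x k)] =
    (y == (if tnth y j == tnth x j then x else flip j x)).
  apply/forallP/eqP => [yx|-> k]; last first.
    case: ifP => _; first by rewrite eqxx implybT.
    rewrite tnth_flip val_eqE; case: eqP => //= _.
    by rewrite addbF eqxx.
  apply: eq_from_tnth => k; case: (eqVneq k j) => [->|kj].
    case: eqP => // /eqP; rewrite tnth_flip eqxx.
    by case: (tnth y j); case: (tnth x j).
  have /eqP -> := implyP (yx k) kj; case: ifP => // _.
  by rewrite tnth_flip val_eqE (negPf kj) addbF.
have fx : (flip j x == x) = false.
  apply/eqP => /(congr1 (fun u : bits n => tnth u j)).
  by rewrite tnth_flip eqxx; case: (tnth x j).
rewrite off_j; case: (eqVneq (tnth y j) (tnth x j)) => [yxj|yxj].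
  have -> : (y == flip j x) = false.
    apply/eqP => /(congr1 (fun u : bits n => tnth u j)).
    by rewrite tnth_flip eqxx yxj; case: (tnth x j).
  rewrite yxj andbb addr0; case: eqP => _; first by rewrite mulr1.
  by rewrite !mulr0.
have -> : (y == x) = false by apply: contraNF yxj => /eqP ->.
rewrite mulr0 add0r; case: eqP => _; last by rewrite mulr0.
by rewrite mulr1; case: (tnth y j) yxj; case: (tnth x j); rewrite //= mulr1.
Qed.

(** The gate set has no NOT; it is obtained as H Z H, where Z is the phase gate of angle pi. *)
Lemma not_ket (R : realType) n (j : 'I_n) (x : bits n) :
  circuit_op [:: Had R j; Phase pi j; Had R j] *m ket R x = ket R (flip j x).
Proof.
rewrite circuit_op_foldl /= had_ket -!scalemxAr mulmxDr -scalemxAr.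
rewrite /gate_op -/(gate_op (Had R j)) !diag_op_ket cospi sinpi.
rewrite tnth_flip eqxx addbT.
rewrite mulmxDr -!scalemxAr !had_ket tnth_flip eqxx flipK addbT.
apply: state_ext => y; rewrite !(ampZ, ampD).
have -> : (-1 +i* 0 : R[i]) = -1.
  by apply/eqP; rewrite eq_complex /= oppr0 !eqxx.
have rr : rsqrt2 R * (rsqrt2 R * 2) = 1.
  by rewrite mulrA rsqrt2_sqr mulVf // pnatr_eq0.
set u := amp _ y; set v := amp _ y.
transitivity (rsqrt2 R * (rsqrt2 R * 2) * v); last by rewrite rr mul1r.
by case: (tnth x j); rewrite /= ?expr0 ?expr1; ring.
Qed.

(** * Reversible circuits and straight-line programs *)

(** Gates that permute the basis, so that classical computations are verified on bit strings instead
    of states. *)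
Inductive rgate (m : nat) : Type :=
| RNot of 'I_m
| RCNot of 'I_m & 'I_m
| RToffoli of 'I_m & 'I_m & 'I_m.

Definition rgate_wf m (g : rgate m) : bool :=
  match g with
  | RNot _ => true
  | RCNot c t => c != t
  | RToffoli c d t => [&& c != d, c != t & d != t]
  end.

Definition rgate_wires m (g : rgate m) : seq 'I_m :=
  match g with
  | RNot t => [:: t]
  | RCNot c t => [:: c; t]
  | RToffoli c d t => [:: c; d; t]
  end.

Definition rgate_act m (g : rgate m) (x : bits m) : bits m :=
  match g with
  | RNot t => flip t x
  | RCNot c t => if tnth x c then flip t x else x
  | RToffoli c d t => if tnth x c && tnth x d then flip t x else x
  end.

Definition rgate_gates (R : realType) m (g : rgate m) : seq (gate R m) :=
  match g with
  | RNot t => [:: Had R t; Phase pi t; Had R t]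
  | RCNot c t => [:: CNot R c t]
  | RToffoli c d t => [:: Toffoli R c d t]
  end.

Definition ract m (c : seq (rgate m)) (x : bits m) : bits m :=
  foldl (fun y g => rgate_act g y) x c.

Definition rcircuit (R : realType) m (c : seq (rgate m)) : seq (gate R m) :=
  flatten [seq rgate_gates R g | g <- c].

Lemma rcircuit_ket (R : realType) m (c : seq (rgate m)) x :
  circuit_op (rcircuit R c) *m ket R x = ket R (ract c x).
Proof.
elim: c x => [|g c IH] x; first by rewrite circuit_op_nil mul1mx.
rewrite /rcircuit /= circuit_op_cat -mulmxA -[flatten _]/(rcircuit R c).
rewrite -IH; congr (_ *m _); case: g => [t|d t|d e t].
- exact: not_ket.
- by rewrite circuit_op1 map_op_ket.
- by rewrite circuit_op1 map_op_ket.
Qed.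

Lemma rcircuit_wf (R : realType) m (c : seq (rgate m)) :
  all (@rgate_wf m) c -> all (@gate_wf R m) (rcircuit R c).
Proof.
elim: c => //= g c IH /andP[wf_g wf_c]; rewrite all_cat IH // andbT.
by case: g wf_g => //= [d t|d e t] ->.
Qed.

Lemma size_rcircuit (R : realType) m (c : seq (rgate m)) :
  (size (rcircuit R c) <= 3 * size c)%N.
Proof.
elim: c => //= g c IH; rewrite size_cat mulnS leq_add //.
by case: g.
Qed.

Lemma rgate_actK m (g : rgate m) : rgate_wf g -> involutive (rgate_act g).
Proof.
move=> wf_g x; case: g wf_g => [t|c t|c d t] /=; first by rewrite flipK.
  move=> ct; case xc: (tnth x c); last by rewrite xc.
  by rewrite tnth_flip val_eqE (negPf ct) addbF xc flipK.
case/and3P=> _ ct dt; case xc: (tnth x c && tnth x d); last by rewrite xc.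
by rewrite !tnth_flip !val_eqE (negPf ct) (negPf dt) !addbF xc flipK.
Qed.

Lemma ract_cat m (c d : seq (rgate m)) x : ract (c ++ d) x = ract d (ract c x).
Proof. exact: foldl_cat. Qed.

Lemma ract_revK m (c : seq (rgate m)) :
  all (@rgate_wf m) c -> cancel (ract c) (ract (rev c)).
Proof.
elim: c => //= g c IH /andP[wf_g wf_c] x.
by rewrite rev_cons -cats1 ract_cat /= IH // rgate_actK.
Qed.

Lemma rgate_frame m (W : pred 'I_m) (g : rgate m) (s t : bits m) :
  all W (rgate_wires g) -> {in W, forall k, tnth s k = tnth t k} ->
  {in W, forall k, tnth (rgate_act g s) k = tnth (rgate_act g t) k} /\
  {in [predC W], forall k, tnth (rgate_act g t) k = tnth t k}.
Proof.
move=> Wg st.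
have flipW u : W u -> {in W, forall k, tnth (flip u s) k = tnth (flip u t) k}.
  by move=> _ k Wk; rewrite !tnth_flip st.
have flipN u : W u -> {in [predC W], forall k, tnth (flip u t) k = tnth t k}.
  move=> Wu k Wk; rewrite tnth_flip val_eqE; case: eqP => [ku|_]; last exact: addbF.
  by move: Wk; rewrite ku inE /= -topredE /= Wu.
case: g Wg => [u|c u|c d u] /=.
- by rewrite andbT => Wu; split; [exact: flipW|exact: flipN].
- case/and3P=> Wc Wu _; rewrite (st c) //.
  by case: ifP => _; split=> //; [exact: flipW|exact: flipN].
- case/and4P=> Wc Wd Wu _; rewrite (st c) // (st d) //.
  by case: ifP => _; split=> //; [exact: flipW|exact: flipN].
Qed.

(** This lets a computation be undone after its outputs were copied to wires outside [W]. *)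
Lemma ract_frame m (W : pred 'I_m) (c : seq (rgate m)) (s t : bits m) :
  all (fun g => all W (rgate_wires g)) c ->
  {in W, forall k, tnth s k = tnth t k} ->
  {in W, forall k, tnth (ract c s) k = tnth (ract c t) k} /\
  {in [predC W], forall k, tnth (ract c t) k = tnth t k}.
Proof.
elim: c s t => [|g c IH] s t //= /andP[Wg Wc] st.
have [actW actN] := rgate_frame Wg st; have [IHW IHN] := IH _ _ Wc actW.
by split=> // k Wk; rewrite IHN // actN.
Qed.

(** The operations that NOT, CNOT and Toffoli gates can write onto a clean wire. *)
Definition slp_step n (fs : seq (bits n -> bool)) (f : bits n -> bool) : Prop :=
  [\/ f = xpredT,
      exists j, f = fun x => tnth x j,
      exists g h, [/\ g \in fs, h \in fs & f = fun x => g x (+) h x] |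
      exists g h, [/\ g \in fs, h \in fs & f = fun x => g x && h x]].

(* Straight-line programs, latest function first. *)
Fixpoint slp n (fs : seq (bits n -> bool)) : Prop :=
  if fs is f :: fs' then slp_step fs' f /\ slp fs' else True.

Definition inputs n m (inp : 'I_n -> 'I_m) (s : bits m) : bits n :=
  [tuple tnth s (inp j) | j < n].

Lemma slp_compile n m L (inp : 'I_n -> 'I_m) (anc : 'I_L -> 'I_m)
    (fs : seq (bits n -> bool)) :
  slp fs -> (0 < L)%N -> (size fs <= L)%N -> injective anc ->
  (forall j i, inp j != anc i) ->
  exists (c : seq (rgate m)) (w : (bits n -> bool) -> 'I_m),
  [/\ all (@rgate_wf m) c,
      all (fun g => all [pred k | (k \in codom inp) || (k \in codom anc)]
                      (rgate_wires g)) c,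
      (size c <= 2 * size fs)%N,
      forall f, f \in fs -> w f \in codom anc &
      forall s : bits m, (forall i, tnth s (anc i) = false) ->
        (forall k, k \notin codom anc -> tnth (ract c s) k = tnth s k) /\
        (forall f, f \in fs -> tnth (ract c s) (w f) = f (inputs inp s))].
Proof.
move=> slp_fs L0 le_L anc_inj inp_anc.
(* Stronger claim for the induction: a program of length k changes only the first k ancillas, so the
   next one is still clean. *)
suff [c [w [wf_c W_c sz_c w_anc cE]]] :
  exists (c : seq (rgate m)) (w : (bits n -> bool) -> 'I_L),
  [/\ all (@rgate_wf m) c,
      all (fun g => all [pred k | (k \in codom inp) || (k \in codom anc)]
                      (rgate_wires g)) c,
      (size c <= 2 * size fs)%N,
      forall f, f \in fs -> (w f < size fs)%N &
      forall s : bits m, (forall i, tnth s (anc i) = false) ->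
        (forall k, (forall i : 'I_L, (i < size fs)%N -> k != anc i) ->
           tnth (ract c s) k = tnth s k) /\
        (forall f, f \in fs -> tnth (ract c s) (anc (w f)) = f (inputs inp s))].
  exists c, (anc \o w); split=> //= [f _|s s0]; first exact: codom_f.
  have [sE fE] := cE s s0; split=> // k kN; apply: sE => i _.
  by apply: contraNneq kN => ->; exact: codom_f.
elim: fs slp_fs le_L => [|f fs IH] /=.
  (* The wire assignment is total, so a default wire is needed; hence [0 < L]. *)
  by exists [::], (fun=> Ordinal L0); split.
case=> fstep slp_fs lt_L; have [c [w [wf_c W_c sz_c w_lt cE]]] := IH slp_fs (ltnW lt_L).
pose t := anc (Ordinal lt_L).
have tW : (t \in codom inp) || (t \in codom anc) by rewrite codom_f orbT.
have wt g : g \in fs -> anc (w g) != t.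
  move=> gfs; apply/eqP => /anc_inj/(congr1 val) /= wgE.
  by have := w_lt _ gfs; rewrite wgE ltnn.
suff [d [wf_d W_d sz_d dE]] : exists d : seq (rgate m),
  [/\ all (@rgate_wf m) d,
      all (fun g => all [pred k | (k \in codom inp) || (k \in codom anc)]
                      (rgate_wires g)) d,
      (size d <= 2)%N &
      forall s : bits m, (forall i, tnth s (anc i) = false) ->
        ract d (ract c s) =
        if f (inputs inp s) then flip t (ract c s) else ract c s].
  exists (c ++ d), (fun g => if g == f then Ordinal lt_L else w g).
  split; rewrite ?all_cat ?wf_c ?W_c ?size_cat //.
  - by rewrite mulnS addnC leq_add.
  - move=> g; rewrite in_cons; case: eqP => [_|_] //= gfs.
    by rewrite ltnS ltnW // w_lt.
  move=> s s0; have [sE fE] := cE s s0; rewrite ract_cat dE //; split.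
    move=> k kN; have kt : k != t by apply: kN.
    have kE : tnth (ract c s) k = tnth s k.
      by apply: sE => i lt_i; apply: kN; rewrite ltnW.
    by case: ifP => // _; rewrite tnth_flip val_eqE (negPf kt) addbF.
  have t0 : tnth (ract c s) t = false.
    rewrite sE ?s0 // => i lt_i; apply/eqP => /anc_inj iE.
    by move: lt_i; rewrite -iE ltnn.
  move=> g; rewrite in_cons; case: eqP => [-> _|_] /=.
    rewrite -/t; case: ifP => _; last exact: t0.
    by rewrite tnth_flip eqxx t0.
  move=> gfs; rewrite -(fE g gfs); case: ifP => // _.
  by rewrite tnth_flip val_eqE (negPf (wt _ gfs)) addbF.
case: fstep => [->|[j ->]|[g [h [gfs hfs ->]]]|[g [h [gfs hfs ->]]]].
- by exists [:: RNot t]; split=> //=; rewrite tW.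
- exists [:: RCNot (inp j) t]; split=> //=; rewrite ?inp_anc ?tW ?codom_f //.
  move=> s s0; have [sE _] := cE s s0.
  rewrite /inputs tnth_mktuple sE // => i _; exact: inp_anc.
- exists [:: RCNot (anc (w g)) t; RCNot (anc (w h)) t]; split=> //=.
  + by rewrite !wt.
  + by rewrite tW !codom_f !orbT.
  move=> s s0; have [_ fE] := cE s s0; rewrite !fE //.
  have hE : tnth (if g (inputs inp s) then flip t (ract c s) else ract c s)
      (anc (w h)) = h (inputs inp s).
    rewrite -(fE h hfs); case: ifP => // _.
    by rewrite tnth_flip val_eqE (negPf (wt _ hfs)) addbF.
  by rewrite hE; case: (g _); case: (h _) => //=; rewrite flipK.
(* A Toffoli gate needs distinct controls. If both functions sit on one wire, their values agree and
   a CNOT suffices. *)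
- case: (eqVneq (w g) (w h)) => [wgh|wgh].
    exists [:: RCNot (anc (w g)) t]; split=> //=.
    + by rewrite wt.
    + by rewrite tW !codom_f !orbT.
    move=> s s0; have [_ fE] := cE s s0; rewrite fE //.
    suff -> : h (inputs inp s) = g (inputs inp s) by rewrite andbb.
    by rewrite -(fE h hfs) -(fE g gfs) wgh.
  exists [:: RToffoli (anc (w g)) (anc (w h)) t]; split=> //=.
  + by rewrite (inj_eq anc_inj) wgh !wt.
  + by rewrite tW !codom_f !orbT.
  by move=> s s0; have [_ fE] := cE s s0; rewrite !fE.
Qed.

Lemma phases_ket (R : realType) m (ps : seq (R * 'I_m)) (x : bits m) :
  circuit_op [seq Phase p.1 p.2 | p <- ps] *m ket R x =
  (\prod_(p <- ps) if tnth x p.2 then cis p.1 else 1) *: ket R x.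
Proof.
elim: ps => [|p ps IH] /=; first by rewrite circuit_op_nil mul1mx big_nil scale1r.
rewrite -cat1s circuit_op_cat -mulmxA circuit_op1 [gate_op _ *m _]diag_op_ket.
by rewrite -scalemxAr IH scalerA big_cons.
Qed.

Lemma all_gate_wf_phases (R : realType) m (ps : seq (R * 'I_m)) :
  all (@gate_wf R m) [seq Phase p.1 p.2 | p <- ps].
Proof. by elim: ps. Qed.

(** Compute, apply phases to the output wires, uncompute. The factor 12 is two passes, two
    reversible gates per step and three gates per reversible gate. *)
Lemma slp_phase (R : realType) n a (fs : seq (bits n -> bool))
    (ps : seq (R * (bits n -> bool))) :
  slp fs -> (size fs < a)%N -> (forall p, p \in ps -> p.2 \in fs) ->
  exists c : seq (gate R (n + a)),
    implements (diag_op (fun x =>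
      \prod_(p <- ps) if p.2 x then cis p.1 else 1)) c /\
    (size c <= 12 * size fs + size ps)%N.
Proof.
move=> slp_fs lt_a ps_fs.
have [||j i|c [w [wf_c _ sz_c w_anc cE]]] :=
  @slp_compile n (n + a) a (lshift a) (@rshift n a) fs slp_fs _ (ltnW lt_a).
- exact: leq_ltn_trans lt_a.
- exact: rshift_inj.
- by rewrite eq_lrshift.
exists (rcircuit R c ++ [seq Phase p.1 p.2 | p <- [seq (p.1, w p.2) | p <- ps]]
          ++ rcircuit R (rev c)).
split; last first.
  rewrite !size_cat !size_map.
  have := size_rcircuit R c; have := size_rcircuit R (rev c).
  rewrite size_rev; lia.
apply: implements_diag => [|x].
  by rewrite !all_cat !rcircuit_wf ?all_rev // all_gate_wf_phases.
have zero_anc i : tnth (cat_tuple x (zeros a)) (rshift n i) = false.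
  by rewrite tnth_rshift tnth_nseq.
have [_ fE] := cE _ zero_anc.
rewrite !circuit_op_cat -!mulmxA rcircuit_ket phases_ket -scalemxAr rcircuit_ket.
rewrite ract_revK // big_map; congr (_ *: _).
apply: eq_big_seq => p p_ps /=; rewrite fE ?ps_fs //.
suff -> : inputs (lshift a) (cat_tuple x (zeros a)) = x by [].
by apply: eq_from_tnth => j; rewrite tnth_mktuple tnth_lshift.
Qed.

(* Compute, copy the outputs and uncompute. *)
Lemma slp_xor (R : realType) n b a (fs : seq (bits n -> bool))
    (es : 'I_b -> bits n -> bool) :
  slp fs -> (size fs < a)%N -> (forall i, es i \in fs) ->
  exists c : seq (gate R (n + b + a)),
    implements (map_op R (fun z : bits (n + b) =>
      let x : bits n := [tuple tnth z (lshift b i) | i < n] in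
      cat_tuple x [tuple tnth z (rshift n i) (+) es i x | i < b])) c /\
    (size c <= 12 * size fs + 3 * b)%N.
Proof.
move=> slp_fs lt_a es_fs.
pose inp (j : 'I_n) := lshift a (lshift b j).
have [||j i|c [w [wf_c W_c sz_c w_anc cE]]] :=
  @slp_compile n (n + b + a) a inp (@rshift (n + b) a) fs slp_fs _ (ltnW lt_a).
- exact: leq_ltn_trans lt_a.
- exact: rshift_inj.
- by rewrite eq_lrshift.
pose out (i : 'I_b) := lshift a (rshift n i).
pose copy := [seq RCNot (w (es i)) (out i) | i <- enum 'I_b].
have copy_wf : all (@rgate_wf _) copy.
  rewrite all_map; apply/allP => i _ /=.
  have /codomP[k ->] := w_anc _ (es_fs i).
  by rewrite /out eq_rlshift.
exists (rcircuit R (c ++ copy ++ rev c)); split; last first.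
  have := size_rcircuit R (c ++ copy ++ rev c).
  by rewrite !size_cat size_rev size_map size_enum_ord; lia.
apply: implements_map => [|z].
  by rewrite rcircuit_wf // !all_cat all_rev wf_c copy_wf.
rewrite rcircuit_ket !ract_cat; congr (ket R _).
set s := cat_tuple z _.
have zero_anc i : tnth s (rshift _ i) = false.
  by rewrite tnth_rshift tnth_nseq.
have [sE fE] := cE _ zero_anc.
have inputsE : inputs inp s = [tuple tnth z (lshift b i) | i < n].
  by apply: eq_from_tnth => j; rewrite !tnth_mktuple tnth_lshift.
set x := [tuple _ | i < n] in inputsE *.
have w_out i j : w (es j) != out i.
  by have /codomP[k ->] := w_anc _ (es_fs j); rewrite /out eq_rlshift.
have copyP (r : seq 'I_b) (u : bits (n + b + a)) : uniq r ->
    (forall k, (forall i, i \in r -> k != out i) ->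
      tnth (ract [seq RCNot (w (es i)) (out i) | i <- r] u) k = tnth u k) /\
    (forall i, i \in r ->
      tnth (ract [seq RCNot (w (es i)) (out i) | i <- r] u) (out i) =
      tnth u (out i) (+) tnth u (w (es i))).
  elim: r u => [|i r IH] u //= /andP[ir ur].
  set u' := if _ then _ else _; have [IHN IHE] := IH u' ur.
  have u'N k : k != out i -> tnth u' k = tnth u k.
    move=> ki; rewrite /u'; case: ifP => // _.
    by rewrite tnth_flip (_ : (val k == _) = false) ?addbF //; exact: negPf ki.
  have out_inj : injective out.
    by move=> j k /lshift_inj/rshift_inj.
  split=> [k kN|j].
    rewrite IHN ?u'N // => [|j jr]; apply: kN; rewrite in_cons ?eqxx //.
    by rewrite jr orbT.
  rewrite in_cons; case: (eqVneq j i) => [-> _|ji /= jr].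
    rewrite IHN => [|k kr]; last first.
      by rewrite (inj_eq out_inj); apply: contraNneq ir => ->.
    rewrite /u'; case: ifP => _; last by rewrite addbF.
    by rewrite tnth_flip (_ : (val _ == _) = true) //; exact: eqxx.
  by rewrite IHE // !u'N // (inj_eq out_inj).
(* The output register lies outside the wires of [c], so the copies do not disturb the
   uncomputation. *)
pose W := [pred k | (k \in codom inp) || (k \in codom (@rshift (n + b) a))].
have outW i : out i \in [predC W].
  rewrite inE /= negb_or; apply/andP; split; apply/codomP => -[j].
    by move/lshift_inj/eqP; rewrite eq_rlshift.
  by move/eqP; rewrite eq_lrshift.
have [copyN copyE] := copyP _ (ract c s) (enum_uniq 'I_b).
have sameW : {in W, forall k, tnth (ract c s) k = tnth (ract copy (ract c s)) k}.
  move=> k Wk; rewrite copyN // => i _; apply: contraTneq Wk => ->.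
  exact: outW.
have W_rev : all (fun g => all W (rgate_wires g)) (rev c) by rewrite all_rev.
have [backW backN] := ract_frame W_rev sameW.
apply: eq_from_tnth => k; case: (split_ordP k) => l -> {k}; last first.
  rewrite tnth_rshift tnth_nseq -backW ?ract_revK //.
  by rewrite inE /= codom_f orbT.
rewrite tnth_lshift; case: (split_ordP l) => i -> {l}.
  rewrite tnth_lshift tnth_mktuple -backW ?ract_revK ?tnth_lshift //.
  by rewrite inE /= (codom_f inp).
rewrite tnth_rshift tnth_mktuple backN ?outW // copyE ?mem_enum //.
rewrite fE // inputsE sE ?tnth_lshift //.
by apply/codomP => -[j] /eqP; rewrite eq_lrshift.
Qed.

(** * Counting parities *)

Definition computes n (k : nat) (gs : seq (bits n -> bool)) : Prop :=
  exists fs, [/\ slp fs, {subset gs <= fs} & (size fs <= k)%N].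

(* [m] further steps compute [f] once all functions of [gs] are available. *)
Definition derivable_in n (m : nat) (gs : seq (bits n -> bool))
    (f : bits n -> bool) : Prop :=
  forall k hs, {subset gs <= hs} -> computes k hs -> computes (k + m) (f :: hs).

Lemma slp_step_sub n (gs hs : seq (bits n -> bool)) f :
  {subset gs <= hs} -> slp_step gs f -> slp_step hs f.
Proof.
move=> gh [->|[j ->]|[g [h [gg hg ->]]]|[g [h [gg hg ->]]]].
- by constructor 1.
- by constructor 2; exists j.
- by constructor 3; exists g, h; split=> //; exact: gh.
- by constructor 4; exists g, h; split=> //; exact: gh.
Qed.

Lemma computes_nil n : computes 0 ([::] : seq (bits n -> bool)).
Proof. by exists [::]. Qed.

Lemma computes_sub n k l (gs hs : seq (bits n -> bool)) :
  {subset gs <= hs} -> (k <= l)%N -> computes k hs -> computes l gs.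
Proof.
move=> gh kl [fs [slp_fs hf le_k]]; exists fs; split=> //.
  by move=> g /gh/hf.
exact: leq_trans kl.
Qed.

Lemma computes_step n k (gs : seq (bits n -> bool)) f :
  slp_step gs f -> computes k gs -> computes k.+1 (f :: gs).
Proof.
move=> step [fs [slp_fs gf le_k]]; exists (f :: fs); split=> //=.
  by split=> //; exact: slp_step_sub step.
by move=> g; rewrite !in_cons => /orP[->|/gf ->] //; rewrite orbT.
Qed.

Lemma derivable_step n (gs : seq (bits n -> bool)) f :
  slp_step gs f -> derivable_in 1 gs f.
Proof.
move=> step k hs gh; rewrite addn1; apply: computes_step.
exact: slp_step_sub step.
Qed.

Lemma derivable_mem n (gs : seq (bits n -> bool)) f :
  f \in gs -> derivable_in 0 gs f.
Proof.
move=> fg k hs gh; rewrite addn0; apply: computes_sub => // g.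
by rewrite in_cons => /orP[/eqP ->|//]; exact: gh.
Qed.

Lemma derivable_sub n l m (gs hs : seq (bits n -> bool)) f :
  {subset gs <= hs} -> (l <= m)%N -> derivable_in l gs f ->
  derivable_in m hs f.
Proof.
move=> gh lm df k us hu /(df k us) d.
apply: (@computes_sub _ (k + l) _ _ (f :: us)); [by []|by rewrite leq_add2l|].
by apply: d => g /gh/hu.
Qed.

Lemma derivable_op n l m (gs : seq (bits n -> bool)) f g h :
  (forall hs, f \in hs -> g \in hs -> slp_step hs h) ->
  derivable_in l gs f -> derivable_in m gs g -> derivable_in (l + m).+1 gs h.
Proof.
move=> step df dg k hs gh ck; rewrite addnS addnA.
have cf := df _ _ gh ck.
have sub_f : {subset gs <= f :: hs}.
  by move=> u /gh uh; rewrite in_cons uh orbT.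
have := dg _ _ sub_f cf.
move/(computes_step (f := h)) => c.
apply: computes_sub (leqnn _) (c _).
  move=> u; rewrite !in_cons => /orP[->|uh] //.
  by rewrite uh !orbT.
by apply: step; rewrite !in_cons eqxx ?orbT.
Qed.

Lemma derivable_xor n l m (gs : seq (bits n -> bool)) f g :
  derivable_in l gs f -> derivable_in m gs g ->
  derivable_in (l + m).+1 gs (fun x => f x (+) g x).
Proof. by apply: derivable_op => hs ff gg; constructor 3; exists f, g. Qed.

Lemma derivable_and n l m (gs : seq (bits n -> bool)) f g :
  derivable_in l gs f -> derivable_in m gs g ->
  derivable_in (l + m).+1 gs (fun x => f x && g x).
Proof. by apply: derivable_op => hs ff gg; constructor 4; exists f, g. Qed.

Lemma derivable_true n (gs : seq (bits n -> bool)) : derivable_in 1 gs xpredT.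
Proof. by apply: derivable_step; constructor 1. Qed.

Lemma derivable_false n (gs : seq (bits n -> bool)) :
  derivable_in 3 gs (fun=> false).
Proof.
by have := derivable_xor (@derivable_true _ gs) (@derivable_true _ gs).
Qed.

Lemma derivable_bool n (gs : seq (bits n -> bool)) (b : bool) :
  derivable_in 3 gs (fun=> b).
Proof.
case: b; last exact: derivable_false.
exact: derivable_sub (@derivable_true _ gs).
Qed.

Lemma derivable_nth n (gs : seq (bits n -> bool)) j :
  derivable_in 3 gs (fun x => nth false x j).
Proof.
case: (ltnP j n) => [lt_j|le_n]; last first.
  rewrite (_ : (fun x => _) = fun=> false); first exact: derivable_false.
  by apply: funext => x; rewrite nth_default ?size_tuple.
rewrite (_ : (fun x => _) = fun x : bits n => tnth x (Ordinal lt_j)).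
  apply: (@derivable_sub _ 1 _ gs) => //.
  by apply: derivable_step; constructor 2; exists (Ordinal lt_j).
by apply: funext => x; rewrite (tnth_nth false).
Qed.

Lemma derivable_seq n k m (gs fs : seq (bits n -> bool)) :
  (forall f, f \in fs -> derivable_in m gs f) -> computes k gs ->
  computes (k + m * size fs) (fs ++ gs).
Proof.
move=> dfs ck; elim: fs dfs => [|f fs IH] dfs; first by rewrite muln0 addn0.
rewrite /= mulnS [(m + _)%N]addnC addnA.
have df := dfs f (mem_head _ _); apply: df.
  by move=> g gg; rewrite mem_cat gg orbT.
by apply: IH => g gf; apply: dfs; rewrite in_cons gf orbT.
Qed.

Definition hot n (bs : seq (bits n -> bool)) (c : nat) (x : bits n) : bool :=
  count (fun b => b x) bs == c.

Definition hots n (T : nat) (bs : seq (bits n -> bool)) :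
  seq (bits n -> bool) := [seq hot bs c | c <- iota 0 T.+1].

Lemma mem_hots n T (bs : seq (bits n -> bool)) c :
  (c <= T)%N -> hot bs c \in hots T bs.
Proof. by move=> le_c; apply: map_f; rewrite mem_iota. Qed.

Lemma size_hots n T (bs : seq (bits n -> bool)) : size (hots T bs) = T.+1.
Proof. by rewrite size_map size_iota. Qed.

(** A further function [b] shifts the one-hot encoding exactly when it is true: a multiplexer for
    each entry. The cost m + 6 is [m] for [b], three operations, and at most three steps for the
    shifted entry, which is constantly false at 0. *)
Lemma computes_hots n m T (bs : seq (bits n -> bool)) :
  (forall b, b \in bs -> derivable_in m [::] b) ->
  computes (3 * T.+1 + (m + 6) * T.+1 * size bs) (hots T bs).
Proof.
elim: bs => [|b bs IH] dbs.
  have d0 f : f \in hots T ([::] : seq (bits n -> bool)) -> derivable_in 3 [::] f.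
    by case/mapP=> c _ ->; exact: derivable_bool.
  have := derivable_seq d0 (computes_nil n).
  by rewrite size_hots cats0 muln0 addn0 add0n.
have cbs : computes (3 * T.+1 + (m + 6) * T.+1 * size bs) (hots T bs).
  by apply: IH => g gb; apply: dbs; rewrite in_cons gb orbT.
suff dstep f : f \in hots T (b :: bs) -> derivable_in (m + 6) (hots T bs) f.
  have := derivable_seq dstep cbs; rewrite size_hots -addnA -mulnSr.
  by apply: computes_sub => // f ff; rewrite mem_cat ff.
case/mapP=> c; rewrite mem_iota add0n => /= lt_c ->.
have db : derivable_in m (hots T bs) b.
  by apply: (@derivable_sub _ m m [::]) => //; apply: dbs; exact: mem_head.
have dc : derivable_in 0 (hots T bs) (hot bs c).
  by apply/derivable_mem/mem_hots; rewrite -ltnS.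
have [p dp hotE] : exists2 p, derivable_in 3 (hots T bs) p &
    forall x, p x = (0 < c)%N && hot bs c.-1 x.
  case: c lt_c {dc} => [|c] lt_c.
    by exists (fun=> false); first exact: derivable_false.
  exists (hot bs c) => //.
  apply: (@derivable_sub _ 0 3 (hots T bs)) => //.
  by apply/derivable_mem/mem_hots; rewrite ltnW.
rewrite (_ : hot (b :: bs) c =
    fun x => hot bs c x (+) (b x && (hot bs c x (+) p x))).
  have d := derivable_xor dc (derivable_and db (derivable_xor dc dp)).
  by apply: derivable_sub d => //; lia.
apply: funext => x; rewrite hotE /hot /=; case: (b x) => /=; last by rewrite addbF.
by rewrite addKb; case: c {lt_c dc hotE}.
Qed.

(* Selects the values of [phi] by a sum over the one-hot encoding. *)
Lemma derivable_count n T (bs : seq (bits n -> bool)) (phi : nat -> bool) :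
  (size bs <= T)%N ->
  derivable_in (T + 4) (hots T bs) (fun x => phi (count (fun b => b x) bs)).
Proof.
move=> le_T.
pose sel (r : seq nat) x := foldr (fun c acc => (phi c && hot bs c x) (+) acc) false r.
suff dsel r : {subset r <= iota 0 T.+1} ->
    derivable_in (3 + size r) (hots T bs) (sel r).
  rewrite (_ : (fun x => _) = sel (iota 0 T.+1)).
    rewrite (_ : T + 4 = 3 + size (iota 0 T.+1))%N; last by rewrite size_iota; lia.
    exact: dsel.
  apply: funext => x; rewrite /sel.
  have : count (fun b => b x) bs \in iota 0 T.+1.
    by rewrite mem_iota ltnS (leq_trans (count_size _ _)).
  have := iota_uniq 0 T.+1; elim: (iota 0 T.+1) => //= c r IH /andP[cr ur].
  rewrite in_cons; case: eqP => [xc _|xc /= xr]; last first.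
    rewrite -IH // /hot; case: eqP => [/xc //|_].
    by rewrite andbF.
  rewrite {1}/hot xc eqxx andbT (_ : foldr _ _ _ = false) ?addbF //.
  elim: r cr {IH ur} => //= d r IH; rewrite in_cons negb_or => /andP[cd /IH ->].
  by rewrite /hot xc (negPf cd) andbF.
elim: r => [|c r IH] sub_r; first by rewrite addn0; exact: derivable_false.
have dr : derivable_in (3 + size r) (hots T bs) (sel r).
  by apply: IH => d dr; apply: sub_r; rewrite in_cons dr orbT.
have le_c : (c <= T)%N by have := sub_r c (mem_head _ _); rewrite mem_iota.
rewrite (_ : sel (c :: r) =
    if phi c then (fun x => hot bs c x (+) sel r x) else sel r); last first.
  by apply: funext => x; rewrite /sel /=; case: (phi c).
case: (phi c); last by apply: (@derivable_sub _ (3 + size r) _ (hots T bs)).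
have := derivable_xor (derivable_mem (mem_hots bs le_c)) dr.
by rewrite add0n addnS.
Qed.

Lemma computes_counts n m (bs : seq (bits n -> bool)) (phis : seq (nat -> bool)) :
  (forall b, b \in bs -> derivable_in m [::] b) ->
  let T := size bs in
  computes (3 * T.+1 + (m + 6) * T.+1 * T + (T + 4) * size phis)
    [seq (fun x => phi (count (fun b => b x) bs)) | phi <- phis].
Proof.
move=> dbs T.
have dphis f : f \in [seq (fun x => phi (count (fun b => b x) bs)) | phi <- phis] ->
    derivable_in (T + 4) (hots T bs) f.
  by move=> /mapP[phi _ ->]; exact: derivable_count.
have := derivable_seq dphis (computes_hots T dbs); rewrite size_map.
by apply: computes_sub => // f ff; rewrite mem_cat ff.
Qed.

Definition slp_cost (m T : nat) : nat := 3 * T.+1 + (m + 6) * T.+1 * T.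

(** Exactly one wire of the one-hot encoding is set, so a phase gate on each wire selects the right
    angle. *)
Lemma phase_count (R : realType) n a m (bs : seq (bits n -> bool))
    (theta : nat -> R) :
  (forall b, b \in bs -> derivable_in m [::] b) ->
  (slp_cost m (size bs) < a)%N ->
  exists c : seq (gate R (n + a)),
    implements (diag_op (fun x => cis (theta (count (fun b => b x) bs)))) c /\
    (size c <= 12 * slp_cost m (size bs) + (size bs).+1)%N.
Proof.
move=> dbs lt_a; have [fs [slp_fs sub_fs le_fs]] := computes_hots (size bs) dbs.
pose ps := [seq (theta c, hot bs c) | c <- iota 0 (size bs).+1].
have [p|c [cE sz_c]] := slp_phase (ps := ps) slp_fs (leq_ltn_trans le_fs lt_a).
  by case/mapP=> c c_iota -> /=; apply/sub_fs/mem_hots; rewrite mem_iota in c_iota.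
exists c; split; last first.
  apply: leq_trans sz_c _; rewrite size_map size_iota leq_add2r.
  by rewrite leq_mul2l le_fs orbT.
suff <- : (fun x : bits n => \prod_(p <- ps) if p.2 x then cis p.1 else 1) =
    (fun x => cis (theta (count (fun b => b x) bs))) by [].
apply: funext => x; rewrite big_map.
set k := count _ bs; have k_iota : k \in iota 0 (size bs).+1.
  by rewrite mem_iota ltnS count_size.
rewrite (bigD1_seq k) ?iota_uniq //= [X in _ * X = _]big1 => [|d dk].
  by rewrite /hot eqxx mulr1.
by rewrite /hot eq_sym (negPf dk).
Qed.

(** * Energies as sums of spin monomials *)

Definition monomial n (q : seq nat) (x : bits n) : int :=
  \prod_(j <- q) spin x j.

(** All coefficients are one; integer multiples are expressed by repeating terms. *)
Definition spin_sum n (h : bits n -> int) (k d : nat) : Prop :=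
  exists terms : seq (seq nat),
  [/\ (size terms <= k)%N, all (fun q => size q <= d)%N terms &
      forall x, h x = \sum_(q <- terms) monomial q x].

Lemma spin_sum_le n (h : bits n -> int) k d k' d' :
  (k <= k')%N -> (d <= d')%N -> spin_sum h k d -> spin_sum h k' d'.
Proof.
move=> kk dd [ts [sz_t deg_t hE]]; exists ts; split=> //; first exact: leq_trans kk.
by apply: sub_all deg_t => q; move/leq_trans; apply.
Qed.

Lemma spin_sum_spin n j : spin_sum (fun x : bits n => spin x j) 1 1.
Proof.
by exists [:: [:: j]]; split=> // x; rewrite /monomial !big_seq1.
Qed.

Lemma spin_sumD n (g h : bits n -> int) k l d :
  spin_sum g k d -> spin_sum h l d -> spin_sum (fun x => g x + h x) (k + l) d.
Proof.
move=> [ts [sz_t deg_t gE]] [us [sz_u deg_u hE]]; exists (ts ++ us); split.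
- by rewrite size_cat leq_add.
- by rewrite all_cat deg_t.
- by move=> x; rewrite big_cat gE hE.
Qed.

Lemma spin_sumM n (g h : bits n -> int) k l d e :
  spin_sum g k d -> spin_sum h l e ->
  spin_sum (fun x => g x * h x) (k * l) (d + e).
Proof.
move=> [ts [sz_t deg_t gE]] [us [sz_u deg_u hE]].
exists [seq t ++ u | t <- ts, u <- us]; split.
- by rewrite size_allpairs leq_mul.
- apply/allP => q /allpairsP[[t u] /= [tt uu ->]]; rewrite size_cat leq_add //.
    exact: (allP deg_t).
  exact: (allP deg_u).
move=> x; rewrite gE hE big_allpairs_dep mulr_suml; apply: eq_bigr => t _.
by rewrite mulr_sumr; apply: eq_bigr => u _; rewrite /monomial big_cat.
Qed.

Lemma spin_sum_sum n (h : nat -> bits n -> int) a b K k d :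
  (forall i, spin_sum (h i) k d) -> (b - a <= K)%N ->
  spin_sum (fun x => \sum_(a <= i < b) h i x) (K * k) d.
Proof.
move=> hs le_K; apply: (@spin_sum_le _ _ ((b - a) * k) d) => //.
  by rewrite leq_mul2r le_K orbT.
rewrite -[(b - a)%N](size_iota a) /index_iota.
elim: (iota _ _) => [|i r IH].
  by exists [::]; split=> // x; rewrite !big_nil.
rewrite mulSn (_ : (fun x => _) =
  fun x => h i x + \sum_(j <- r) h j x); first exact: spin_sumD.
by apply: funext => x; rewrite big_cons.
Qed.

Definition parity n (q : seq nat) (x : bits n) : bool :=
  foldr (fun j b => nth false x j.-1 (+) b) false q.

Lemma monomialE n q (x : bits n) : monomial q x = (-1) ^+ parity q x.
Proof.
rewrite /monomial; elim: q => [|j q IH]; first by rewrite big_nil.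
by rewrite big_cons IH /= signr_addb.
Qed.

Lemma derivable_parity n q : derivable_in (4 * size q + 3) [::] (@parity n q).
Proof.
elim: q => [|j q IH]; first exact: derivable_false.
have := derivable_xor (@derivable_nth n [::] j.-1) IH.
by rewrite (_ : (3 + _).+1 = 4 * size (j :: q) + 3)%N //=; lia.
Qed.

(** A monomial equals 1 - 2 b with [b] its parity, so the sum depends only on how many parities are
    odd. *)
Lemma spin_sum_count n (h : bits n -> int) k d : spin_sum h k d ->
  exists bs : seq (bits n -> bool),
  [/\ (size bs <= k)%N, forall b, b \in bs -> derivable_in (4 * d + 3) [::] b &
      forall x, h x = (size bs)%:Z - (2 * count (fun b => b x) bs)%:Z].
Proof.
move=> [ts [sz_t deg_t hE]]; exists [seq @parity n q | q <- ts]; split.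
- by rewrite size_map.
- move=> b /mapP[q qt ->].
  apply: (@derivable_sub _ (4 * size q + 3) _ [::]) => //.
    by rewrite leq_add2r leq_mul2l (allP deg_t).
  exact: derivable_parity.
move=> x; rewrite hE; elim: ts {sz_t deg_t hE} => [|q ts IH].
  by rewrite big_nil.
rewrite big_cons IH monomialE /=; case: (parity q x); rewrite /= ?expr1 ?expr0; lia.
Qed.

Lemma spin_sum_mixer n : spin_sum (@mixer_energy n) n 1.
Proof.
rewrite -[n in spin_sum _ n]muln1.
apply: (@spin_sum_sum n (fun j x => spin x j)) => [j|]; first exact: spin_sum_spin.
by rewrite subn1.
Qed.

Lemma spin_sum_labs n : spin_sum (@labs_energy n) (3 * n ^ 3) 4.
Proof.
have pair i : spin_sum (fun x : bits n =>
    spin x i * \sum_(1 <= k < ((n - i) %/ 2).+1) spin x (i + 2 * k))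
    (1 * (n * 1)) (1 + 1).
  apply: spin_sumM (spin_sum_spin _ _) _.
  apply: spin_sum_sum => [k|]; first exact: spin_sum_spin.
  by rewrite subn1 /= (leq_trans (leq_div _ _)) // leq_subr.
have quad i : spin_sum (fun x : bits n =>
    spin x i * \sum_(1 <= t < ((n - i - 1) %/ 2).+1)
      \sum_(t.+1 <= k < (n - i - t).+1)
         spin x (i + t) * spin x (i + k) * spin x (i + k + t))
    (1 * (n * (n * (1 * 1 * 1)))) (1 + (1 + 1 + 1)).
  apply: spin_sumM (spin_sum_spin _ _) _.
  apply: spin_sum_sum => [t|]; last first.
    by rewrite subn1 /= (leq_trans (leq_div _ _)) // -subnDA leq_subr.
  apply: spin_sum_sum => [k|]; last by rewrite subSS -!subnDA leq_subr.
  by do 2 apply: spin_sumM (spin_sum_spin _ _); exact: spin_sum_spin.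
have le_n m : ((n - m).+1 - 1 <= n)%N by rewrite subn1 leq_subr.
have Q := spin_sum_sum quad (le_n 3); have P := spin_sum_sum pair (le_n 2).
have P4 := spin_sum_le (leqnn _) (isT : (2 <= 4)%N) P.
(* The coefficient 2 becomes a repetition; n^3 + n^3 + n^2 terms in all. *)
have H := spin_sumD (spin_sumD Q Q) P4.
set h := (fun x => _) in H; have <- : h = @labs_energy n.
  by apply: funext => x; rewrite /h /labs_energy mulr_natl mulr2n.
apply: spin_sum_le H => //; rewrite !mul1n !muln1 !expnS expn0 muln1.
have : (n * n <= n * (n * n))%N by case: (posnP n) => [-> //|n0]; rewrite leq_pmull.
lia.
Qed.

Lemma spin_sum_sidelobe n : spin_sum (@sidelobe n) (n ^ 3) 4.
Proof.
have corr k : spin_sum (fun x : bits n => autocorr x k) (n * (1 * 1)) (1 + 1).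
  apply: spin_sum_sum => [i|]; last by rewrite subn1 leq_subr.
  by apply: spin_sumM; exact: spin_sum_spin.
have sq k := spin_sumM (corr k) (corr k).
have le_n : (n - 1 <= n)%N by rewrite leq_subr.
apply: spin_sum_le (spin_sum_sum sq le_n) => //.
by rewrite !expnS expn0 !muln1.
Qed.

(** * Gate complexity of the building blocks *)

(** 19 = 4 * 4 + 3 is the cost of a parity of degree four, and 28 = 3 + (19 + 6). *)
Lemma slp_cost_le m k : (m <= 19)%N -> (slp_cost m k <= 28 * k.+1 ^ 2)%N.
Proof.
move=> le_m; rewrite /slp_cost (@leq_trans (3 * k.+1 + 25 * k.+1 * k))%N //.
  by rewrite leq_add2l !leq_mul2r (leq_add2r 6 m 19) le_m !orbT.
by rewrite expnS expn1; lia.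
Qed.

Lemma phase_count_le (R : realType) n a m k (bs : seq (bits n -> bool))
    (theta : nat -> R) :
  (m <= 19)%N -> (size bs <= k)%N ->
  (forall b, b \in bs -> derivable_in m [::] b) -> (28 * k.+1 ^ 2 < a)%N ->
  exists c : seq (gate R (n + a)),
    implements (diag_op (fun x => cis (theta (count (fun b => b x) bs)))) c /\
    (size c <= 337 * k.+1 ^ 2)%N.
Proof.
move=> le_m le_k dbs lt_a.
have le_sq : ((size bs).+1 ^ 2 <= k.+1 ^ 2)%N by rewrite leq_exp2r.
have le_cost := leq_trans (slp_cost_le (size bs) le_m) (leq_mul (leqnn 28) le_sq).
have [c [cE sz_c]] := phase_count theta dbs (leq_ltn_trans le_cost lt_a).
exists c; split=> //; apply: leq_trans sz_c _.
(* 12 * 28 for computing and uncomputing, 1 for the phase gates. *)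
rewrite -[337%N]/(12 * 28 + 1)%N mulnDl mul1n -mulnA leq_add //.
  by rewrite leq_mul2l le_cost orbT.
by rewrite (leq_trans (_ : _ <= k.+1)%N) // -[X in (X <= _)%N]expn1 leq_pexp2l.
Qed.

Lemma phase_spin_sum (R : realType) n a k d (h : bits n -> int) (theta : R) :
  (d <= 4)%N -> spin_sum h k d -> (28 * k.+1 ^ 2 < a)%N ->
  exists c : seq (gate R (n + a)),
    implements (diag_op (fun x => cis (theta * (h x)%:~R))) c /\
    (size c <= 337 * k.+1 ^ 2)%N.
Proof.
move=> le_d /spin_sum_count[bs [le_k dbs hE]] lt_a.
pose th c := theta * ((size bs)%:Z - (2 * c)%:Z)%:~R.
have le_m : (4 * d + 3 <= 19)%N by lia.
have [c [cE sz_c]] := phase_count_le th le_m le_k dbs lt_a.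
exists c; split=> //.
rewrite (_ : (fun x => _) = fun x => cis (th (count (fun b => b x) bs))) //.
by apply: funext => x; rewrite /th hE.
Qed.

Lemma qaoa_gates (R : realType) n l (beta gamma : 'I_l -> R) : (0 < n)%N ->
  gate_complexity_le (qaoa n beta gamma)
    (n + l * (2 * n + 674 * (3 * n ^ 3).+1 ^ 2)).
Proof.
(* One ancilla register serves both exponentials of every layer: the mixer has only n <= K terms. *)
move=> n0; set K := (3 * n ^ 3)%N; pose a := (28 * K.+1 ^ 2).+1.
have nK : (n <= K)%N.
  rewrite /K !expnS expn0 muln1.
  apply: leq_trans (_ : n * (n * n) <= _)%N; last by rewrite leq_pmull.
  by rewrite leq_pmulr // muln_gt0 n0.
have [h [hE sz_h]] := implements_hadamards R n a.
have layer b g : exists c : seq (gate R (n + a)),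
    implements (qaoa_layer n b g) c /\ (size c <= 2 * n + 674 * K.+1 ^ 2)%N.
  rewrite qaoa_layerE.
  have [c [cE sz_c]] := phase_spin_sum (- g) (leqnn 4) (@spin_sum_labs n) (ltnSn _).
  have mixK := spin_sum_le nK (leqnn 1) (@spin_sum_mixer n).
  have [d [dE sz_d]] := phase_spin_sum (- b) (isT : (1 <= 4)%N) mixK (ltnSn _).
  exists (c ++ (h ++ (d ++ h))); split.
    apply: (implements_mul cE); apply: (implements_mul hE).
    exact: implements_mul dE hE.
  have split_cost X : (2 * n + 674 * X = 337 * X + (n + (337 * X + n)))%N by lia.
  by rewrite !size_cat split_cost !leq_add.
suff step (s : seq 'I_l) (A : qop R n) (e : seq (gate R (n + a))) :
    implements A e ->
    exists c : seq (gate R (n + a)),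
    implements (foldl (fun A i => qaoa_layer n (beta i) (gamma i) *m A) A s) c /\
    (size c <= size e + size s * (2 * n + 674 * K.+1 ^ 2))%N.
  have [c [cE sz_c]] := step (enum 'I_l) _ _ hE.
  apply: implements_complexity cE _; apply: leq_trans sz_c _.
  by rewrite size_enum_ord leq_add2r.
elim: s A e => [|i s IH] A e eE /=; first by exists e; rewrite addn0.
have [d [dE sz_d]] := layer (beta i) (gamma i).
have [c [cE sz_c]] := IH _ _ (implements_mul eE dE).
exists c; split=> //; apply: leq_trans sz_c _.
by rewrite size_cat mulSn -addnA leq_add2l leq_add2r.
Qed.

Lemma cispi (R : realType) : cis pi = -1 :> R[i].
Proof.
by rewrite /cis cospi sinpi; apply/eqP; rewrite eq_complex /= oppr0 !eqxx.
Qed.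

(** Being the zero string is a condition on the number of true bits. *)
Lemma reflect_zero_gates (R : realType) n :
  gate_complexity_le (reflect_zero R n) (337 * n.+1 ^ 2).
Proof.
pose bs := [seq (fun x : bits n => nth false x j) | j <- iota 0 n].
have sz_bs : size bs = n by rewrite size_map size_iota.
have dbs b : b \in bs -> derivable_in 3 [::] b.
  by case/mapP=> j _ ->; exact: derivable_nth.
pose theta c : R := if c == 0%N then pi else 0.
have le_bs : (size bs <= n)%N by rewrite sz_bs.
have [c [cE sz_c]] := phase_count_le theta (isT : (3 <= 19)%N) le_bs dbs (ltnSn _).
apply: implements_complexity sz_c.
rewrite /reflect_zero (_ : (fun x => _) =
  fun x => cis (theta (count (fun b => b x) bs))) //.
apply: funext => x; rewrite /theta.
suff -> : (x == zeros n) = (count (fun b => b x) bs == 0%N).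
  by case: ifP => _; rewrite ?cispi ?cis0.
rewrite eqn0Ngt -has_count has_map; apply/eqP/hasPn => [-> j _ /=|x0].
  by rewrite nth_nseq if_same.
apply: eq_from_tnth => j; rewrite tnth_nseq (tnth_nth false).
by apply/negbTE/x0; rewrite mem_iota /= add0n.
Qed.

(** Repeating bit i 2^i times makes the binary value a count. The list stays polynomial, since 2^b
    <= 2 n^3 for b = [reg_size n] and n >= 2. *)
Lemma reg_value_count b (r : bits b) :
  reg_value r = count (fun f => f r)
    (flatten [seq nseq (2 ^ i) (fun x : bits b => nth false x i) | i <- iota 0 b]).
Proof.
rewrite /reg_value count_flatten -map_comp sumnE big_map.
transitivity (\sum_(0 <= i < b) nth false r i * 2 ^ i)%N.
  by rewrite big_mkord; apply: eq_bigr => i _; rewrite (tnth_nth false).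
rewrite /index_iota subn0; apply: eq_bigr => i _ /=.
by rewrite count_nseq.
Qed.

Lemma compare_gates (R : realType) n (s : option (bits n)) :
  gate_complexity_le (compare_op R s) (337 * (2 ^ reg_size n).+1 ^ 2).
Proof.
set b := reg_size n.
pose bs := flatten [seq nseq (2 ^ i) (fun x : bits b => nth false x i) | i <- iota 0 b].
have le_bs : (size bs <= 2 ^ b)%N.
  rewrite size_flatten /shape -map_comp sumnE big_map.
  rewrite (eq_bigr (fun i => 2 ^ i)%N) => [|i _]; last by rewrite /= size_nseq.
  elim: (b) => [|k IH]; first by rewrite big_nil.
  rewrite -[k.+1]addn1 iotaD big_cat big_seq1 /= add0n addn1.
  by rewrite expnS mul2n -addnn leq_add2r.
have dbs f : f \in bs -> derivable_in 3 [::] f.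
  case/flattenP=> fs /mapP[j _ ->] /nseqP[-> _]; exact: derivable_nth.
pose theta c : R := if (if s is Some y then (c < energy y)%N else true) then pi else 0.
have [c [cE sz_c]] := phase_count_le theta (isT : (3 <= 19)%N) le_bs dbs (ltnSn _).
apply: implements_complexity sz_c.
rewrite /compare_op (_ : (fun r => _) =
  fun r => cis (theta (count (fun f => f r) bs))) //.
apply: funext => r; rewrite /theta -reg_value_count -/(energy _).
by case: s {theta cE} => [y|]; rewrite ?cispi //; case: ifP => _; rewrite ?cispi ?cis0.
Qed.

Lemma V_labs_gates (R : realType) n :
  gate_complexity_le (V_labs R n)
    (12 * (28 * (n ^ 3).+1 ^ 2 + (n ^ 3 + 4) * reg_size n) + 3 * reg_size n).
Proof.
have [bs [le_bs dbs sE]] := spin_sum_count (@spin_sum_sidelobe n).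
pose phi (i : 'I_(reg_size n)) (c : nat) :=
  odd (`|(size bs)%:Z - (2 * c)%:Z|%N %/ 2 ^ i).
have [fs [slp_fs sub_fs le_fs]] :=
  computes_counts [seq phi i | i <- enum 'I_(reg_size n)] dbs.
have [i|c [cE sz_c]] := @slp_xor R n (reg_size n) _ fs
  (fun i x => phi i (count (fun f => f x) bs)) slp_fs (ltnSn _).
  apply: sub_fs; apply/mapP; exists (phi i) => //.
  by apply: map_f; rewrite mem_enum.
apply: (@implements_complexity _ _ _ _ c); last first.
  apply: leq_trans sz_c _; rewrite leq_add2r leq_mul2l /=.
  apply: leq_trans le_fs _; rewrite size_map size_enum_ord leq_add //.
    apply: leq_trans (slp_cost_le (size bs) (leqnn 19)) _.
    by rewrite leq_mul2l leq_exp2r.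
  by rewrite leq_mul2r leq_add2r le_bs orbT.
rewrite /V_labs (_ : (fun z => _) = fun z : bits (n + reg_size n) =>
      let x : bits n := [tuple tnth z (lshift (reg_size n) i) | i < n] in
      cat_tuple x [tuple tnth z (rshift n i) (+) phi i (count (fun f => f x) bs)
                  | i < reg_size n]) //.
apply: funext => z /=; congr cat_tuple; apply: eq_from_tnth => i.
by rewrite !tnth_mktuple /phi -sE.
Qed.

(** * Gate count of the algorithm *)

Definition labs_gate_counts (l n : nat) : gate_counts :=
  GateCounts (n + l * (2 * n + 674 * (3 * n ^ 3).+1 ^ 2))
    (12 * (28 * (n ^ 3).+1 ^ 2 + (n ^ 3 + 4) * reg_size n) + 3 * reg_size n)
    (337 * (2 ^ reg_size n).+1 ^ 2)
    (337 * n.+1 ^ 2).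

Lemma labs_gate_counts_realizable (R : realType) l n (beta gamma : 'I_l -> R) :
  (0 < n)%N -> realizable (qaoa n beta gamma) (labs_gate_counts l n).
Proof.
move=> n0; split=> [||s|].
- exact: qaoa_gates.
- exact: V_labs_gates.
- exact: compare_gates.
- exact: reflect_zero_gates.
Qed.

(** Every cost is at most quadratic in n^3, the order of the number of monomials and of the register
    range. The largest coefficient of n^6 is 674 * 16 + 2, for one layer, and the constant exceeds
    it. *)
Lemma op_gates_le l n o : (2 <= n)%N ->
  (op_gates (labs_gate_counts l n) o <= (20 * 540) * l.+1 * n ^ 6)%N.
Proof.
move=> n2; pose y := (n ^ 3)%N.
have n0 : (0 < n)%N by lia.
have y0 : (0 < y)%N by rewrite expn_gt0 n0.
have ny : (n <= y)%N by rewrite -[X in (X <= _)%N]expn1 leq_pexp2l.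
have y2 : (1 < y)%N by rewrite (leq_trans n2).
have b_pred := up_log_gtn (isT : (1 < 2)%N) y2.
have b0 : (0 < reg_size n)%N by rewrite up_log_gt0.
have pb : (2 ^ reg_size n <= 2 * y)%N.
  by rewrite -(prednK b0) expnS leq_mul2l ltnW.
have by' : (reg_size n <= y)%N.
  rewrite -(prednK b0); apply: leq_trans b_pred; rewrite ltnS ltnW //.
  exact: ltn_expl.
have -> : (n ^ 6 = y ^ 2)%N by rewrite /y -expnM.
have sq k c : (k <= c * y)%N -> (k ^ 2 <= c ^ 2 * y ^ 2)%N.
  by move=> kc; rewrite -expnMn leq_exp2r.
have yy : (y <= y ^ 2)%N by rewrite -[X in (X <= _)%N]expn1 leq_pexp2l.
have s1 := sq (3 * y).+1 4%N; have s2 := sq y.+1 2%N.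
have s3 := sq (2 ^ reg_size n).+1 3%N; have s4 := sq n.+1 2%N.
have s5 : ((y + 4) * reg_size n <= 5 * y ^ 2)%N.
  rewrite expnS expn1 mulnA leq_mul //; lia.
have {}s1 : ((3 * y).+1 ^ 2 <= 16 * y ^ 2)%N by apply: s1; lia.
have {}s2 : (y.+1 ^ 2 <= 4 * y ^ 2)%N by apply: s2; lia.
have {}s3 : ((2 ^ reg_size n).+1 ^ 2 <= 9 * y ^ 2)%N by apply: s3; lia.
have {}s4 : (n.+1 ^ 2 <= 4 * y ^ 2)%N by apply: s4; lia.
rewrite -/y in s1 s2.
move: s1 s2 s3 s4 s5 yy; rewrite /op_gates /labs_gate_counts -/y /=.
move: (y ^ 2)%N ((3 * y).+1 ^ 2)%N (y.+1 ^ 2)%N ((2 ^ reg_size n).+1 ^ 2)%N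
  (n.+1 ^ 2)%N ((y + 4) * reg_size n)%N => Y a1 a2 a3 a4 a5 s1 s2 s3 s4 s5 yy.
have U_le : (n + l * (2 * n + 674 * a1) <= (20 * 540) * l.+1 * Y)%N.
  have nY := leq_trans ny yy.
  have : (2 * n + 674 * a1 <= (20 * 540) * Y)%N by clear -nY s1; lia.
  by move/(leq_mul (leqnn l)); clear -nY; nia.
have Y_le : ((20 * 540) * Y <= (20 * 540) * l.+1 * Y)%N.
  by rewrite leq_mul2r leq_pmulr // orbT.
by case: o => //; lia.
Qed.

(** An operation is a call or a zero reflection, and the latter are at most as numerous: hence the
    factor two. *)
Lemma gates_le gc (G : nat) t :
  (forall o, (op_gates gc o <= G)%N) -> (zero_count t <= calls t)%N ->
  (gates gc t <= 2 * G * calls t)%N.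
Proof.
move=> opG zt; apply: (@leq_trans (G * (calls t + zero_count t))).
  rewrite /gates; elim: t {zt} => [|o t IH]; first by rewrite big_nil.
  rewrite big_cons /calls /zero_count /= addnACA mulnDr leq_add //.
  by rewrite (_ : (is_call o + is_zero o)%N = 1%N) ?muln1 //; case: (o).
by rewrite [(2 * G)%N]mulnC -mulnA leq_mul2l mul2n -addnn leq_add2l zt orbT.
Qed.

Lemma nat_ceil_le (R : realType) (x : R) : 0 <= x -> (nat_ceil x)%:R <= x + 1.
Proof.
move=> x0; rewrite /nat_ceil -[(absz _)%:R]/(`|Num.ceil x|%N%:Z%:~R).
have c0 : 0 <= Num.ceil x by rewrite ceil_ge0 (lt_le_trans _ x0) // ltrN10.
by rewrite gez0_abs //; have := ceilB1_lt x; rewrite intrB; lra.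
Qed.

Lemma qaoa_qmf_success_bound (R : realType) (sched : schedule R) (C : R) l N
    (beta gamma : 'I_l -> R) (xopt : bits N) (popt M delta : R) :
  0 < C -> eqsearch_guarantee sched C ->
  qaoa_qmf_input beta gamma xopt popt M delta ->
  1 - delta <= Pr (qaoa_qmf sched C (qaoa N beta gamma) M delta)
    (fun o => if o.1 is Some x then sidelobe x == sidelobe xopt else false).
Proof.
move=> C0 guarantee [N3 opt le_amp np [M0 _ le_M d01]].
have N0 : (0 < N)%N by lia.
have popt0 : 0 <= popt by apply: le_trans np; rewrite divr_ge0 ?ler0n.
apply: qaoa_qmf_success C0 guarantee (unitary_qaoa _ _ _) opt N0 np _ le_M d01.
by apply: optimal_mass => //; lia.
Qed.

(** Serves to absorb the rounding of the call budget into a multiple of M N. *)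
Lemma qaoa_qmf_input_M_ge1 (R : realType) l N (beta gamma : 'I_l -> R)
    (xopt : bits N) (popt M delta : R) :
  qaoa_qmf_input beta gamma xopt popt M delta -> 1 <= M.
Proof.
move=> [N3 opt le_amp np [M0 _ le_M d01]].
have popt0 : 0 < popt.
  by apply: lt_le_trans np; rewrite divr_gt0 // ltr0n; lia.
have popt1 : popt <= 1.
  have := optimal_mass _ (ltW popt0) le_amp => /(_ (ltnW N3)) mass.
  have le1 : mass_below (born (qaoa N beta gamma *m ket R (zeros N)))
      (@energy N) (energy xopt).+1 <= 1.
    rewrite -(sum_born_ket R (zeros N)) -(unitary_born _ (unitary_qaoa N beta gamma)).
    rewrite [leRHS](bigID (fun x => energy x < (energy xopt).+1)%N) /=.
    by rewrite lerDl sumr_ge0 // => x _; exact: born_ge0.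
  by lra.
apply: le_trans le_M; rewrite ler_pdivlMr ?sqrtr_gt0 // mul1r.
by rewrite -sqrtr1 ler_wsqrtr.
Qed.

(** At least one round is run however close [delta] is to 1, while ln (1 / delta) tends to 0 there.
    Keeping [delta] below [delta0] bounds the rounds by a multiple of the logarithm. *)
Lemma qaoa_qmf_gates (R : realType) (sched : schedule R) (C delta0 : R) (l : nat) :
  0 < C -> 0 < delta0 < 1 ->
  exists (K : R) (d : nat),
  forall (N : nat) (beta gamma : 'I_l -> R) (xopt : bits N)
         (popt M delta : R),
    qaoa_qmf_input beta gamma xopt popt M delta -> delta <= delta0 ->
    exists gc : gate_counts,
      realizable (qaoa N beta gamma) gc /\
      in_every_run (qaoa_qmf sched C (qaoa N beta gamma) M delta)
        (fun o => (gates gc o.2)%:R <= K * N%:R ^+ d * ln (1 / delta) * M).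
Proof.
move=> C0 /andP[d00 d01].
pose lam := ln (1 / delta0).
have lam0 : 0 < lam by rewrite ln_gt0 // ltr_pdivlMr // mul1r.
pose G : R := 2 * ((20 * 540) * l.+1)%:R.
(* The three factors bound gates per call, rounds and calls per round; the degree is 6 for a call
   plus 1 from the call budget. *)
exists (G * (1 + 1 / lam) * (3 * C + 1)), 7.
move=> N beta gamma xopt popt M delta input le_d.
have M1 := qaoa_qmf_input_M_ge1 input.
have [N3 _ _ _ [M0 _ _ /andP[delta0' delta1]]] := input.
exists (labs_gate_counts l N); split.
  by apply: labs_gate_counts_realizable; lia.
apply: always_in_every_run.
pose k := nat_ceil (ln (1 / delta)); pose r := nat_ceil (3 * C * M * N%:R).
apply: (@always_dbind _ _ _ _ _ (fun o => (calls o.2 <= k * r)%N &&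
    (zero_count o.2 <= calls o.2)%N)); first exact: always_qmf_rounds.
move=> -[L t] /andP[/= tkr zt]; rewrite always_dret /=.
have N1 : 1 <= N%:R :> R by rewrite ler1n; lia.
have lnE : lam <= ln (1 / delta).
  rewrite ler_ln ?posrE ?divr_gt0 // ler_pM2l // lef_pV2 //.
have k_le : k%:R <= (1 + 1 / lam) * ln (1 / delta).
  apply: le_trans (nat_ceil_le _) _; first by rewrite (le_trans _ lnE) // ltW.
  have : 1 <= 1 / lam * ln (1 / delta).
    by rewrite [1 / lam]mul1r mulrC ler_pdivlMr // [1 * lam]mul1r.
  lra.
have r_le : r%:R <= (3 * C + 1) * (M * N%:R).
  have MN : 1 <= M * N%:R by rewrite mulr_ege1.
  apply: le_trans (nat_ceil_le _) _; first by rewrite !mulr_ge0 ?ler0n // ltW.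
  rewrite mulrDl mul1r mulrA; lra.
have gates_t := gates_le (fun o => op_gates_le l o (ltnW N3)) zt.
apply: (@le_trans _ _ ((2 * ((20 * 540) * l.+1 * N ^ 6) * (k * r))%N%:R)).
  by rewrite ler_nat (leq_trans gates_t) // leq_mul2l tkr orbT.
have -> : (2 * ((20 * 540) * l.+1 * N ^ 6) * (k * r))%N%:R =
    G * N%:R ^+ 6 * (k%:R * r%:R) :> R.
  by rewrite -natrX /G; move: (N ^ 6)%N => n6; rewrite !natrM; ring.
have -> : G * (1 + 1 / lam) * (3 * C + 1) * N%:R ^+ 7 * ln (1 / delta) * M =
    G * N%:R ^+ 6 * (((1 + 1 / lam) * ln (1 / delta)) * ((3 * C + 1) * (M * N%:R))).
  by rewrite exprS; ring.
apply: ler_wpM2l; first by rewrite mulr_ge0 ?exprn_ge0 ?ler0n // mulr_ge0 ?ler0n.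
by apply: ler_pM; rewrite ?ler0n.
Qed.

Theorem theorem1 (R : realType) (l : nat) (sched : schedule R) (C : R)
    (C_gt0 : 0 < C) (eqsearchP : eqsearch_guarantee sched C) :
  (forall (N : nat) (beta gamma : 'I_l -> R) (xopt : bits N)
          (popt M delta : R),
     qaoa_qmf_input beta gamma xopt popt M delta ->
     1 - delta <=
     Pr (qaoa_qmf sched C (qaoa N beta gamma) M delta)
        (fun o => if o.1 is Some x then sidelobe x == sidelobe xopt
                  else false))
  /\
  (forall delta0 : R, 0 < delta0 < 1 ->
   exists (K : R) (d : nat),
   forall (N : nat) (beta gamma : 'I_l -> R) (xopt : bits N)
          (popt M delta : R),
     qaoa_qmf_input beta gamma xopt popt M delta -> delta <= delta0 ->
     exists gc : gate_counts,
       realizable (qaoa N beta gamma) gc /\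
       in_every_run (qaoa_qmf sched C (qaoa N beta gamma) M delta)
         (fun o => (gates gc o.2)%:R <= K * N%:R ^+ d * ln (1 / delta) * M)).
Proof.
split; last by move=> delta0 d01; exact: qaoa_qmf_gates.
move=> N beta gamma xopt popt M delta; exact: qaoa_qmf_success_bound.
Qed.
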